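(* Let $C$ be a closed connected Riemann surface, and let $D_\epsilon=\epsilon^{-1}\varphi+D+\epsilon\psi$ ($\epsilon\in\mathbb{C}^\times$) be a family of flat connections on $E\to C$ as described in the context, with $(\bar\partial_E,\varphi)$ a stable, non-zero, nilpotent $\mathrm{SL}(2,\mathbb{C})$-Higgs bundle such that the associated secondary Higgs field $\Phi$ is not nilpotent. Let $\gamma$ be a closed curve on $C$ which is a WKB curve with respect to $\Phi$, with period $Z_\gamma$. Then the holonomy of $D_\epsilon$ along $\gamma$ grows exponentially in $\epsilon^{-1/2}$; more precisely, $$\lim_{\epsilon\searrow 0}\Big(\operatorname{Tr}\operatorname{Hol}_\gamma(D_\epsilon)\cdot\exp\big(-\epsilon^{-1/2}Z_\gamma\big)\Big)\in\mathbb{C}^\times ,$$ where $\operatorname{Re}(\epsilon^{-1/2}Z_\gamma)>0$ and the limit is taken over real $\epsilon>0$.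
   Context: Let $K_C$ be the canonical bundle of $C$ and $E\to C$ a complex vector bundle of rank $2$ with a fixed trivialization of $\det E$. An $\mathrm{SL}(2,\mathbb{C})$-Higgs bundle is a pair $(\bar\partial_E,\varphi)$ of a holomorphic structure $\bar\partial_E$ on $E$ (with holomorphically trivialized determinant) and a traceless $\varphi\in H^0(C,\operatorname{End}(E)\otimes K_C)$. It is stable if every proper holomorphic $\varphi$-invariant line subbundle has negative degree, and nilpotent if $\varphi^2=0$. The harmonic metric of a stable Higgs bundle is the unique Hermitian metric $h$ inducing the trivial metric on $\det E$ with $F_{D_h}+[\varphi,\varphi^{\dagger_h}]=0$, $D_h$ being the Chern connection of $(\bar\partial_E,h)$. The family. $D_\epsilon=\epsilon^{-1}\varphi+D+\epsilon\psi$ is flat for all $\epsilon\in\mathbb{C}^\times$, where $D$ is an $\mathrm{SL}(2,\mathbb{C})$-connection on $E$ with $(0,1)$-part $\bar\partial_E$, and $\varphi$, $\psi$ are $\operatorname{End}(E)$-valued $1$-forms (independent of $\epsilon$) of type $(1,0)$ and $(0,1)$ respectively, with $(\bar\partial_E,\varphi)$ a stable, non-zero, nilpotent Higgs bundle. Secondary Higgs field. Let $L_1=\ker\varphi$ (a holomorphic line subbundle) and let $L_2$ be its orthogonal complement with respect to the harmonic metric of $(\bar\partial_E,\varphi)$. With respect to $E=L_1\oplus L_2$ decompose $D=A_1+D'+A_{-1}$ with $A_1\in\Gamma(\operatorname{Hom}(L_2,L_1)\otimes\Omega^1)$, $A_{-1}\in\Gamma(\operatorname{Hom}(L_1,L_2)\otimes\Omega^1)$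 and $D'$ a direct sum of connections on $L_1$ and $L_2$. Put $\Phi:=A_{-1}+\varphi$ and let $\bar\partial'_E$ be the $(0,1)$-part of $D'$; $\Phi$ is the secondary Higgs field (it is a Higgs field for $\bar\partial'_E$). WKB curves. For a parametrized closed loop $\gamma:[0,1]\to C$, let $\pm\mu(t)\,dt$ be the eigenvalues of $\gamma^*\Phi$. $\gamma$ is a WKB curve with respect to $\Phi$ if, for a suitable continuous choice of sign, $\operatorname{Re}(\mu(t))>0$ for all $t$. Its period is $Z_\gamma:=\int_0^1\mu(t)\,dt$. *)

(* Defs.v *)
From HB Require Import structures.
From mathcomp Require Import all_boot all_order all_algebra.
From mathcomp Require Import all_classical all_reals all_analysis.
From mathcomp Require Import complex.

Set Implicit Arguments.
Unset Strict Implicit.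
Unset Printing Implicit Defensive.

Import Order.TTheory GRing.Theory Num.Theory numFieldNormedType.Exports.

Local Open Scope classical_set_scope.
Local Open Scope ring_scope.
Local Open Scope complex_scope.

(* The complex numbers over [R]; the alias [^o] carries the topology and the
   normed module structure over [R[i]] itself, so that [derivable f z 1] is
   complex differentiability. *)
Notation cplx R := (complex R)^o.

Section Calculus.
Variable R : realType.

Definition ii : R[i] := 0 +i* 1.

Definition cexp (z : R[i]) : R[i] :=
  (expR (complex.Re z))%:C * (cos (complex.Im z) +i* sin (complex.Im z)).

Definition cderivable (f : R -> R[i]) (t : R) : Prop :=
  derivable (fun u => complex.Re (f u)) t 1 /\
  derivable (fun u => complex.Im (f u)) t 1.

Definition cderive (f : R -> R[i]) (t : R) : R[i] :=
  derive1 (fun u => complex.Re (f u)) t +i* derive1 (fun u => complex.Im (f u)) t.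

Definition mxderivable m n (f : R -> 'M[R[i]]_(m, n)) (t : R) : Prop :=
  forall i j, cderivable (fun u => f u i j) t.

Definition mxderive m n (f : R -> 'M[R[i]]_(m, n)) (t : R) : 'M[R[i]]_(m, n) :=
  \matrix_(i, j) cderive (fun u => f u i j) t.

Definition cintegral01 (f : R -> R[i]) : R[i] :=
  (\int[lebesgue_measure]_(t in `[0%R, 1%R]) complex.Re (f t))%R +i*
  (\int[lebesgue_measure]_(t in `[0%R, 1%R]) complex.Im (f t))%R.

(* real directional derivatives of functions on the plane, used for v = 1, i *)
Definition line (F : cplx R -> cplx R) (v z : cplx R) (t : R) : R[i] :=
  F (z + t%:C * v).

Definition partial (v : cplx R) (F : cplx R -> cplx R) (z : cplx R) : cplx R :=
  cderive (line F v z) 0.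

(* [F] is of class C^n on the open set [V] *)
Fixpoint Ck (n : nat) (V : set (cplx R)) (F : cplx R -> cplx R) : Prop :=
  (forall z, V z -> {for z, continuous F}) /\
  (if n is m.+1 then
     [/\ forall z, V z -> cderivable (line F 1 z) 0 /\
                          cderivable (line F ii z) 0,
         Ck m V (partial 1 F) & Ck m V (partial ii F)]
   else True).

Definition smooth (V : set (cplx R)) (F : cplx R -> cplx R) : Prop :=
  forall n, Ck n V F.

(* the Wirtinger derivatives d/dz and d/dzbar *)
Definition wirt (F : cplx R -> cplx R) (z : cplx R) : cplx R :=
  (partial 1 F z - ii * partial ii F z) / 2%:R.

Definition wirtbar (F : cplx R -> cplx R) (z : cplx R) : cplx R :=
  (partial 1 F z + ii * partial ii F z) / 2%:R.

Definition adj m n (A : 'M[R[i]]_(m, n)) : 'M[R[i]]_(n, m) :=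
  map_mx (@conjc R) A^T.

End Calculus.

(* A compact connected Riemann surface, presented by a holomorphic atlas.
   [chart i] and [chart_inv i] are total functions, meaningful only on [dom i]
   and on its image. *)
Record closedRiemannSurface (R : realType) := ClosedRiemannSurface {
  surface :> topologicalType;
  surface_hausdorff : hausdorff_space surface;
  surface_compact : compact [set: surface];
  surface_connected : connected [set: surface];
  cidx : Type;
  dom : cidx -> set surface;
  chart : cidx -> surface -> cplx R;
  chart_inv : cidx -> cplx R -> surface;
  dom_open : forall i, open (dom i);
  dom_cover : forall p, exists i, dom i p;
  chart_open : forall i, open (chart i @` dom i);
  chartK : forall i p, dom i p -> chart_inv i (chart i p) = p;
  chart_cont : forall i p, dom i p -> {for p, continuous (chart i)};
  chart_inv_cont : forall i p,
    dom i p -> {for chart i p, continuous (chart_inv i)};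
  chart_holo : forall i j p, dom i p -> dom j p ->
    derivable (chart j \o chart_inv i) (chart i p) 1 }.

Section LocalCalculus.
Variables (R : realType) (C : closedRiemannSurface R).

Definition smooth_in (i : cidx C) (W : set C) m n
    (F : C -> 'M[R[i]]_(m, n)) : Prop :=
  forall k l, smooth (chart i @` W) (fun z => F (chart_inv i z) k l).

(* the coefficients of dz_i and of its conjugate in the differential of [F],
   z_i being the coordinate [chart i] *)
Definition dz (i : cidx C) m n (F : C -> 'M[R[i]]_(m, n)) (p : C) :=
  \matrix_(k, l) wirt (fun z => F (chart_inv i z) k l) (chart i p)
  : 'M[R[i]]_(m, n).

Definition dzb (i : cidx C) m n (F : C -> 'M[R[i]]_(m, n)) (p : C) :=
  \matrix_(k, l) wirtbar (fun z => F (chart_inv i z) k l) (chart i p)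
  : 'M[R[i]]_(m, n).

(* dz_j / dz_i *)
Definition jac (i j : cidx C) (p : C) : R[i] :=
  'D_1 (chart j \o chart_inv i) (chart i p).

(* velocity of a curve in the coordinate [chart i] *)
Definition velocity (i : cidx C) (g : R -> C) (t : R) : cplx R :=
  cderive (fun u => chart i (g u)) t.

(* A closed curve is a C^1 map from the circle R / Z, i.e. a 1-periodic C^1 map
   on R.  In particular the velocities at times 0 and 1 agree. *)
Definition closed_curve (g : R -> C) : Prop :=
  [/\ continuous g,
      forall t, g (t + 1) = g t
    & forall i t, dom i (g t) ->
        cderivable (fun u => chart i (g u)) t /\
        {for t, continuous (velocity i g)}].

End LocalCalculus.

(* A smooth complex vector bundle of rank 2 with trivialized determinant,
   presented by local frames e_a whose wedge e_a1 /\ e_a2 is the given section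
   of the determinant.  Each frame lives in the domain of the chart [fchart a].
   A section has components s_a in the frame e_a, and s_a = trans a b *m s_b. *)
Record sl2Bundle (R : realType) (C : closedRiemannSurface R) := Sl2Bundle {
  fidx : Type;
  fdom : fidx -> set C;
  fchart : fidx -> cidx C;
  trans : fidx -> fidx -> C -> 'M[R[i]]_2;
  fdom_open : forall a, open (fdom a);
  fdom_cover : forall p, exists a, fdom a p;
  fdom_sub : forall a, fdom a `<=` dom (fchart a);
  trans_id : forall a p, fdom a p -> trans a a p = 1%:M;
  trans_cocycle : forall a b c p, fdom a p -> fdom b p -> fdom c p ->
    trans a b p *m trans b c p = trans a c p;
  trans_det : forall a b p, fdom a p -> fdom b p -> \det (trans a b p) = 1;
  trans_smooth : forall a b,
    smooth_in (fchart a) (fdom a `&` fdom b) (trans a b) }.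

(* In the frame [a], [OneForm P Q] stands for P_a dz + Q_a dzbar, where z is the
   coordinate [chart (fchart a)]: it is the local expression of an
   endomorphism-valued 1-form, or the connection form of d + P_a dz + Q_a dzbar.
   Components are relevant on [fdom a] only. *)
Record oneForm (R : realType) (C : closedRiemannSurface R) (E : sl2Bundle C) :=
  OneForm {
    fz : fidx E -> C -> 'M[R[i]]_2;
    fzb : fidx E -> C -> 'M[R[i]]_2 }.

Section Bundle.
Variables (R : realType) (C : closedRiemannSurface R) (E : sl2Bundle C).

Local Notation M2 := 'M[R[i]]_2.
Local Notation form := (oneForm E).
Local Notation zc a := (fchart (s := E) a).

Definition jacE (a b : fidx E) (p : C) : R[i] := jac (zc a) (zc b) p.

Definition smooth_form (w : form) : Prop :=
  forall a, smooth_in (zc a) (fdom a) (fz w a) /\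
            smooth_in (zc a) (fdom a) (fzb w a).

Definition traceless (w : form) : Prop :=
  forall a p, fdom a p -> \tr (fz w a p) = 0 /\ \tr (fzb w a p) = 0.

(* smooth End(E)-valued 1-forms: w_a = g w_b g^-1 for g = trans a b *)
Definition is_end_form (w : form) : Prop :=
  smooth_form w /\
  forall a b p, fdom a p -> fdom b p ->
    fz w a p *m trans a b p = jacE a b p *: (trans a b p *m fz w b p) /\
    fzb w a p *m trans a b p
      = conjc (jacE a b p) *: (trans a b p *m fzb w b p).

(* connections: w_a = g w_b g^-1 - dg g^-1 for g = trans a b *)
Definition is_connection (w : form) : Prop :=
  smooth_form w /\
  forall a b p, fdom a p -> fdom b p ->
    fz w a p *m trans a b p
      = jacE a b p *: (trans a b p *m fz w b p) - dz (zc a) (trans a b) p /\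
    fzb w a p *m trans a b p
      = conjc (jacE a b p) *: (trans a b p *m fzb w b p)
        - dzb (zc a) (trans a b) p.

Definition type10 (w : form) : Prop := forall a p, fdom a p -> fzb w a p = 0.
Definition type01 (w : form) : Prop := forall a p, fdom a p -> fz w a p = 0.

(* the coefficient of dz /\ dzbar in dw + w /\ w *)
Definition curvature (w : form) (a : fidx E) (p : C) : M2 :=
  dz (zc a) (fzb w a) p - dzb (zc a) (fz w a) p
  + fz w a p *m fzb w a p - fzb w a p *m fz w a p.

Definition flat (w : form) : Prop :=
  is_connection w /\ forall a p, fdom a p -> curvature w a p = 0.

Definition addf (w w' : form) : form :=
  OneForm (fun a p => fz w a p + fz w' a p) (fun a p => fzb w a p + fzb w' a p).

Definition scalef (c : R[i]) (w : form) : form :=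
  OneForm (fun a p => c *: fz w a p) (fun a p => c *: fzb w a p).

Definition eqf (w w' : form) : Prop :=
  forall a p, fdom a p -> fz w a p = fz w' a p /\ fzb w a p = fzb w' a p.

(* the value of [w] at the tangent vector with coordinate [v] *)
Definition evalf (w : form) (a : fidx E) (p : C) (v : R[i]) : M2 :=
  v *: fz w a p + conjc v *: fzb w a p.

Definition nilpotent2 (w : form) : Prop :=
  forall a p v, fdom a p -> evalf w a p v *m evalf w a p v = 0.

Definition nonzero (w : form) : Prop :=
  exists a p, fdom a p /\ (fz w a p != 0 \/ fzb w a p != 0).

(* A holomorphic structure on E with holomorphically trivialized determinant:
   the operator dbar + q_a dzbar with q_a traceless. *)
Definition is_dbar (q : fidx E -> C -> M2) : Prop :=
  [/\ forall a, smooth_in (zc a) (fdom a) (q a),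
      forall a p, fdom a p -> \tr (q a p) = 0
    & forall a b p, fdom a p -> fdom b p ->
        q a p *m trans a b p
          = conjc (jacE a b p) *: (trans a b p *m q b p)
            - dzb (zc a) (trans a b) p].

Definition sl2_higgs (q : fidx E -> C -> M2) (phi : form) : Prop :=
  [/\ is_dbar q,
      is_end_form phi, type10 phi, traceless phi
    & forall a p, fdom a p ->
        dzb (zc a) (fz phi a) p + q a p *m fz phi a p - fz phi a p *m q a p = 0].

(* Local sections over an open set [W]; [s a] is the component in frame [a]. *)
Definition smooth_section (W : set C) (s : fidx E -> C -> 'cV[R[i]]_2) : Prop :=
  (forall a, smooth_in (zc a) (W `&` fdom a) (s a)) /\
  forall a b p, W p -> fdom a p -> fdom b p -> s a p = trans a b p *m s b p.

Definition holo_section (q : fidx E -> C -> M2) (W : set C)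
    (s : fidx E -> C -> 'cV[R[i]]_2) : Prop :=
  smooth_section W s /\
  forall a p, W p -> fdom a p -> dzb (zc a) (s a) p + q a p *m s a p = 0.

(* A family of subsets of the fibres of E, in each local frame. *)
Definition fibrewise := fidx E -> C -> set 'cV[R[i]]_2.

Definition zero_fibres : fibrewise := fun _ _ => [set 0].

Definition values_in (L : fibrewise) (W : set C)
    (s : fidx E -> C -> 'cV[R[i]]_2) : Prop :=
  forall a p, W p -> fdom a p -> L a p (s a p).

Definition holo_line_subbundle (q : fidx E -> C -> M2) (L : fibrewise) : Prop :=
  forall p, exists W s, [/\ open W, W p, holo_section q W s
    & forall a x, W x -> fdom a x ->
        s a x != 0 /\ L a x = [set c *: s a x | c in [set: R[i]]]].

(* [s] is a non-zero meromorphic section of L and [ord] its order function: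
   near every p, s = (z - z(p))^(ord p) * (nowhere vanishing holomorphic
   section of L) off p. *)
Definition mero_section (q : fidx E -> C -> M2) (L : fibrewise)
    (s : fidx E -> C -> 'cV[R[i]]_2) (ord : C -> int) : Prop :=
  forall p, exists (W : set C) sigma (i : cidx C),
    [/\ [/\ open W, W p & W `<=` dom i],
        holo_section q W sigma, values_in L W sigma,
        forall a x, W x -> fdom a x -> sigma a x != 0
      & forall a x, W x -> x <> p -> fdom a x ->
          s a x = ((chart i x - chart i p : R[i]) ^ ord p) *: sigma a x].

(* The degree of a holomorphic line subbundle is the degree of the divisor of
   any of its non-zero meromorphic sections. *)
Definition line_degree (q : fidx E -> C -> M2) (L : fibrewise) : int :=
  xget 0 [set d | exists s (ord : C -> int),
    mero_section q L s ord /\ d = \sum_(p \in [set: C]) ord p].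

Definition higgs_invariant (phi : form) (L : fibrewise) : Prop :=
  forall a p v, fdom a p -> L a p v -> L a p (fz phi a p *m v).

Definition higgs_stable (q : fidx E -> C -> M2) (phi : form) : Prop :=
  forall L, holo_line_subbundle q L -> higgs_invariant phi L ->
    line_degree q L < 0.

(* Hermitian metrics inducing the trivial metric on the determinant;
   <u, v> = adj u *m h *m v in each frame. *)
Definition hermitian_metric (h : fidx E -> C -> M2) : Prop :=
  [/\ forall a, smooth_in (zc a) (fdom a) (h a),
      forall a b p, fdom a p -> fdom b p ->
        h b p = adj (trans a b p) *m h a p *m trans a b p,
      forall a p, fdom a p -> adj (h a p) = h a p,
      forall a p (v : 'cV[R[i]]_2), fdom a p -> v != 0 ->
        0 < (adj v *m h a p *m v) ord0 ord0
    & forall a p, fdom a p -> \det (h a p) = 1].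

(* d<u, v> = <Du, v> + <u, Dv> and the (0,1)-part of D is the given one *)
Definition chern_connection (q h : fidx E -> C -> M2) (w : form) : Prop :=
  is_connection w /\
  forall a p, fdom a p ->
    [/\ fzb w a p = q a p,
        dz (zc a) (h a) p = adj (fzb w a p) *m h a p + h a p *m fz w a p
      & dzb (zc a) (h a) p = adj (fz w a p) *m h a p + h a p *m fzb w a p].

(* For phi = f dz the h-adjoint is (h^-1 f^* h) dzbar, and [phi, phi^dagger]
   is (f f^dagger - f^dagger f) dz /\ dzbar. *)
Definition hadj (h : fidx E -> C -> M2) (phi : form) (a : fidx E) (p : C) : M2 :=
  invmx (h a p) *m adj (fz phi a p) *m h a p.

Definition harmonic_metric (q : fidx E -> C -> M2) (phi : form)
    (h : fidx E -> C -> M2) : Prop :=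
  hermitian_metric h /\
  exists w, chern_connection q h w /\
    forall a p, fdom a p ->
      curvature w a p + (fz phi a p *m hadj h phi a p
                         - hadj h phi a p *m fz phi a p) = 0.

(* The holomorphic line subbundle ker phi.  At the (isolated) zeros of a non-zero
   phi the fibrewise kernel is the whole fibre; the subbundle is the unique
   holomorphic line subbundle contained in the fibrewise kernels. *)
Definition kernel_subbundle (q : fidx E -> C -> M2) (phi : form)
    (L : fibrewise) : Prop :=
  holo_line_subbundle q L /\
  forall a p v, fdom a p -> L a p v -> fz phi a p *m v = 0.

Definition orthogonal (h : fidx E -> C -> M2) (L : fibrewise) : fibrewise :=
  fun a p => [set v | forall u, L a p u -> adj u *m h a p *m v = 0].

Definition maps_to (w : form) (L L' : fibrewise) : Prop :=
  forall a p v, fdom a p -> L a p v ->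
    L' a p (fz w a p *m v) /\ L' a p (fzb w a p *m v).

Definition preserves (w : form) (L : fibrewise) : Prop :=
  forall (W : set C) s, open W -> smooth_section W s -> values_in L W s ->
    forall a p, W p -> fdom a p ->
      L a p (dz (zc a) (s a) p + fz w a p *m s a p) /\
      L a p (dzb (zc a) (s a) p + fzb w a p *m s a p).

(* D = A1 + D' + Am1 with respect to E = L1 (+) L2, where A1 is valued in
   Hom(L2, L1), Am1 in Hom(L1, L2) and D' is a direct sum of connections *)
Definition decomposition (L1 L2 : fibrewise) (D A1 D' Am1 : form) : Prop :=
  [/\ eqf D (addf (addf A1 D') Am1),
      [/\ is_end_form A1, maps_to A1 L2 L1 & maps_to A1 L1 zero_fibres],
      [/\ is_end_form Am1, maps_to Am1 L1 L2 & maps_to Am1 L2 zero_fibres],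
      is_connection D'
    & preserves D' L1 /\ preserves D' L2].

Definition secondary_higgs (q : fidx E -> C -> M2) (phi D Phi : form) : Prop :=
  exists (h : fidx E -> C -> M2) (L1 : fibrewise) (A1 D' Am1 : form),
    [/\ harmonic_metric q phi h,
        kernel_subbundle q phi L1,
        decomposition L1 (orthogonal h L1) D A1 D' Am1
      & eqf Phi (addf Am1 phi)].

Definition conn_family (phi D psi : form) (eps : R[i]) : form :=
  addf (addf (scalef eps^-1 phi) D) (scalef eps psi).

(* the coefficient of dt in the pull-back of [w] along the curve [g] *)
Definition pullback (w : form) (g : R -> C) (a : fidx E) (t : R) : M2 :=
  evalf w a (g t) (velocity (zc a) g t).

(* [g] is a WKB curve for [Phi], and [mu] is the choice of eigenvalue of
   positive real part *)
Definition wkb_curve (Phi : form) (g : R -> C) (mu : R -> cplx R) : Prop :=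
  [/\ {within `[0%R, 1%R], continuous mu},
      forall t, 0 <= t <= 1 -> 0 < complex.Re (mu t)
    & forall a t, 0 <= t <= 1 -> fdom a (g t) ->
        char_poly (pullback Phi g a t)
          = ('X - (mu t : R[i])%:P) * ('X + (mu t : R[i])%:P)].

(* Columns of [Y] are parallel sections of the pull-back of E to [0, 1].  The
   values of [Y a] at times outside [0, 1], or at which the curve is not in
   [fdom a], only serve to make sense of two-sided derivatives. *)
Definition parallel_frame (w : form) (g : R -> C) (Y : fidx E -> R -> M2) :
    Prop :=
  (forall a t, 0 <= t <= 1 -> fdom a (g t) ->
     mxderivable (Y a) t /\ mxderive (Y a) t = - (pullback w g a t *m Y a t)) /\
  forall a b t, 0 <= t <= 1 -> fdom a (g t) -> fdom b (g t) ->
     Y a t = trans a b (g t) *m Y b t.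

(* Trace of the holonomy: parallel transport from time 0 to time 1, as an
   endomorphism of the fibre at [g 0] = [g 1], written in a frame [a] there.
   The trace does not depend on [a]. *)
Definition tr_hol (w : form) (g : R -> C) : R[i] :=
  xget 0 [set c | exists a Y, [/\ fdom a (g 0), parallel_frame w g Y,
                                  Y a 0 = 1%:M & c = \tr (Y a 1)]].

End Bundle.

(* Main.v *)
(* Let m be the eigenvalue of Phi on the velocity of the curve and L1 = ker phi.
   Choose along the curve a section v transverse to L1 and put s = phi(v) / m.  In
   the frame (s, v) phi becomes m times the elementary nilpotent matrix and D has
   lower left entry m, because Phi^2 = m^2 and Phi is phi plus the second fundamental
   form of L1.  Rescaling the second coordinate by eta = sqrt epsilon turns the
   equation of parallel transport into x' = (m / eta) sigma x + O(1), whose solutions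
   along the two eigenlines of sigma are damped, respectively amplified, at rate
   Re m / eta.  An energy estimate shows that, after dividing by
   exp (eta^-1 int m), the amplified component converges to the exponential of the
   integral of the diagonal term, which is not 0.  Comparing the frame at times 0
   and 1, which commutes with the nilpotent part, multiplies the limit of the trace
   by a constant k <> 0.

   Only C^1 regularity of s is at stake: m itself is merely continuous, but the
   quotient of the velocity by m is of class C^1. *)

Require Import Defs.
From HB Require Import structures.
From mathcomp Require Import all_boot all_order all_algebra.
From mathcomp Require Import all_classical all_reals all_analysis.
From mathcomp Require Import complex.
From mathcomp Require Import ring lra.

Set Implicit Arguments.
Unset Strict Implicit.
Unset Printing Implicit Defensive.

Import Order.TTheory GRing.Theory Num.Theory numFieldNormedType.Exports.

Local Open Scope classical_set_scope.
Local Open Scope ring_scope.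
Local Open Scope complex_scope.

(** * Complex valued functions *)

(** Two solutions are followed, one starting in each eigenline. In that basis the trace of the
    transport is the amplified component of the first plus the damped component of the second, and
    only the former survives. Errors are measured by squared moduli and are O(eta), so the limit
    comes with a rate. The moving frame is not made periodic. Its defect is a monodromy k + q N with
    N the elementary nilpotent matrix; q only multiplies the lower left entry of the transport,
    which after normalization is O(eta) because of the rescaling of the second coordinate. A
    transverse section exists because the pull-back of phi vanishes nowhere on the curve: otherwise
    the square of Phi would have a kernel, whereas it is the non-zero scalar m^2. Derivatives are
    two-sided while the equation is posed on [0, 1] only. Hence the eigenvalue is continued
    periodically, the frame is built on a larger open interval, and coefficients are continued by
    their boundary values. *)

Section ComplexCalculus.
Variable R : realType.
Implicit Types (f g q : R -> cplx R) (t : R) (l m : cplx R).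
Local Notation Re := (@complex.Re R).
Local Notation Im := (@complex.Im R).

Lemma ReD (x y : R[i]) : Re (x + y) = Re x + Re y. Proof. by case: x; case: y. Qed.
Lemma ImD (x y : R[i]) : Im (x + y) = Im x + Im y. Proof. by case: x; case: y. Qed.
Lemma ReN (x : R[i]) : Re (- x) = - Re x. Proof. by case: x. Qed.
Lemma ImN (x : R[i]) : Im (- x) = - Im x. Proof. by case: x. Qed.
Lemma ReM (x y : R[i]) : Re (x * y) = Re x * Re y - Im x * Im y.
Proof. by case: x; case: y. Qed.
Lemma ImM (x y : R[i]) : Im (x * y) = Re x * Im y + Im x * Re y.
Proof. by case: x => a b; case: y => c d; rewrite /= addrC. Qed.

Lemma ext_complex (x y : R[i]) : Re x = Re y -> Im x = Im y -> x = y.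
Proof. by case: x => a b; case: y => c d /= -> ->. Qed.

(** The squared modulus as a real polynomial in the two parts, so that all estimates are
    inequalities between real numbers. *)
Definition nsq (z : R[i]) : R := Re z ^+ 2 + Im z ^+ 2.

Lemma nsq_ge0 z : 0 <= nsq z. Proof. by rewrite addr_ge0 // sqr_ge0. Qed.

Lemma nsqM x y : nsq (x * y) = nsq x * nsq y.
Proof. by rewrite /nsq ReM ImM; ring. Qed.

Lemma normc_ge_Im (z : R[i]) : `|Im z|%:C <= `|z|.
Proof. by rewrite normc_def lecR -sqrtr_sqr ler_wsqrtr // lerDr sqr_ge0. Qed.

Lemma normc_le_add (z : R[i]) : `|z| <= (`|Re z| + `|Im z|)%:C.
Proof.
rewrite {1}[z]complexE; apply: le_trans (ler_normD _ _) _.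
rewrite rmorphD /= !normc_def /= !(expr0n, addr0, mul0r, mul1r, mulr0, subr0, add0r, sqrtr_sqr) /=.
by rewrite oppr0 expr0n add0r sqrtr_sqr.
Qed.

Lemma cvg_complexP (T : Type) (F : set_system T) {FF : Filter F} (f : T -> cplx R) l :
  f @ F --> l <-> (fun x => Re (f x)) @ F --> Re l /\ (fun x => Im (f x)) @ F --> Im l.
Proof.
split.
  move=> /cvgrPdist_lt h; split; apply/cvgrPdist_lt => e e0;
  have := h e%:C; rewrite ltcR => /(_ e0); apply: filterS => x;
    rewrite -ltcR; apply: le_lt_trans.
    by rewrite -ReN -ReD; exact: normc_ge_Re.
  by rewrite -ImN -ImD; exact: normc_ge_Im.
(* Radii live in [R[i]]; a positive one has imaginary part 0. *)
move=> [/cvgrPdist_lt h1 /cvgrPdist_lt h2]; apply/cvgrPdist_lt => -[e e'] /=.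
rewrite ltcE /= => /andP[/eqP -> e0].
have e2 : 0 < e / 2 by rewrite divr_gt0.
have := h1 _ e2; have := h2 _ e2; apply: filterS2 => x xi xr.
apply: le_lt_trans (normc_le_add _) _.
by rewrite ReD ReN ImD ImN ltcR [ltRHS](splitr e) ltrD.
Qed.

Definition ccont (T : topologicalType) (f : T -> cplx R) (t : T) : Prop :=
  {for t, continuous f}.

Lemma continuous_complexP (T : topologicalType) (f : T -> cplx R) (t : T) :
  ccont f t <->
  {for t, continuous (fun x => Re (f x))} /\ {for t, continuous (fun x => Im (f x))}.
Proof. exact: cvg_complexP. Qed.

Lemma ccontinuous_cst (T : topologicalType) l (t : T) :
  ccont (fun=> l) t.
Proof. exact: cvg_cst. Qed.

Lemma ccontinuousD (T : topologicalType) (f g : T -> cplx R) (t : T) :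
  ccont f t -> ccont g t ->
  ccont (fun z => f z + g z) t.
Proof. by move=> cf cg; exact: (cvgD cf cg). Qed.

Lemma ccontinuousN (T : topologicalType) (f : T -> cplx R) (t : T) :
  ccont f t -> ccont (fun z => - f z) t.
Proof. by move=> cf; exact: (cvgN cf). Qed.

Lemma ccontinuousM (T : topologicalType) (f g : T -> cplx R) (t : T) :
  ccont f t -> ccont g t ->
  ccont (fun z => f z * g z) t.
Proof. by move=> cf cg; exact: (cvgM cf cg). Qed.

Lemma ccontinuousV (T : topologicalType) (f : T -> cplx R) (t : T) :
  f t != 0 -> ccont f t -> ccont (fun z => (f z)^-1) t.
Proof. by move=> f0 cf; exact: (cvgV f0 cf). Qed.

Lemma ccontinuous_sum (T : topologicalType) n (f : 'I_n -> T -> cplx R) (t : T) :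
  (forall i, ccont (f i) t) ->
  ccont (fun z => \sum_i f i z) t.
Proof.
elim: n f => [|n IH] f hf.
  rewrite (_ : (fun z => _) = fun=> 0); first exact: ccontinuous_cst.
  by apply/funext => z; rewrite big_ord0.
rewrite (_ : (fun z => _) = fun z => f ord0 z + \sum_i f (lift ord0 i) z).
  by apply: ccontinuousD; [exact: hf|apply: IH => i; exact: hf].
by apply/funext => z; rewrite big_ord_recl.
Qed.

Lemma ccontinuous_conj (T : topologicalType) (f : T -> cplx R) (t : T) :
  ccont f t -> ccont (fun z => conjc (f z)) t.
Proof.
move=> /continuous_complexP [a b]; apply/continuous_complexP; split.
  by rewrite (_ : (fun x => _) = fun x => Re (f x)) //; apply/funext => x; case: (f x).
rewrite (_ : (fun x => _) = fun x => - Im (f x)); first exact: (cvgN b).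
by apply/funext => x; case: (f x).
Qed.

Lemma ccontinuous_neq0 (T : topologicalType) (f : T -> cplx R) (t : T) :
  ccont f t -> f t != 0 -> \forall z \near t, f z != 0.
Proof. by move=> cf f0; exact: (cvgr_neq0 (f t) cf f0). Qed.

Lemma ccontinuous_near (T : topologicalType) (f g : T -> cplx R) (t : T) :
  (\near t, f t = g t) -> ccont f t -> ccont g t.
Proof.
move=> fg; rewrite /ccont /prop_for /continuous_at -(nbhs_singleton fg) => h.
by apply: cvg_trans h; apply: near_eq_cvg; apply: filterS fg => x ->.
Qed.

Definition is_cderive f t l :=
  is_derive t 1 (fun u => Re (f u)) (Re l) /\ is_derive t 1 (fun u => Im (f u)) (Im l).

Lemma is_cderive_cderivable f t l : is_cderive f t l -> cderivable f t.
Proof. by move=> [h k]; split; [have [] := h|have [] := k]. Qed.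

Lemma is_cderiveE f t l : is_cderive f t l -> cderive f t = l.
Proof.
by move=> [[_ h] [_ k]]; apply: ext_complex; rewrite /= derive1E.
Qed.

Lemma cderivableP f t : cderivable f t -> is_cderive f t (cderive f t).
Proof.
move=> [h k]; split; [apply: (DeriveDef h)|apply: (DeriveDef k)]; exact/esym/derive1E.
Qed.

Lemma is_cderive_near f g t l :
  (\near t, f t = g t) -> is_cderive f t l -> is_cderive g t l.
Proof.
move=> fg [h k]; split.
  by apply: near_eq_is_derive h; apply: filterS fg => x ->.
by apply: near_eq_is_derive k; apply: filterS fg => x ->.
Qed.

(* Caratheodory's form of the derivative turns the rules of calculus into algebra. *)
Lemma is_cderiveP f t l : is_cderive f t l <->
  exists q, [/\ forall z, f z - f t = q z * (z - t)%:C, ccont q t & q t = l].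
Proof.
split.
  move=> [/is_derive1_caratheodory [a [ha ca al]] /is_derive1_caratheodory [b [hb cb bl]]].
  exists (fun z => a z +i* b z); split.
  - move=> z; apply: ext_complex; rewrite ?ReM ?ImM ?ReD ?ImD ?ReN ?ImN /= ?(ha, hb); ring.
  - by apply/continuous_complexP.
  - by rewrite al bl; apply: ext_complex.
move=> [q [hq /continuous_complexP [ca cb] ql]].
split; apply/is_derive1_caratheodory.
  exists (fun z => Re (q z)); split => //; last by rewrite ql.
  by move=> z; rewrite -ReN -ReD hq ReM /=; ring.
exists (fun z => Im (q z)); split => //; last by rewrite ql.
by move=> z; rewrite -ImN -ImD hq ImM /=; ring.
Qed.

(** Quotients and square roots have an explicit slope only where a denominator does not vanish, so
    the identity is asked near [t] only. *)
Lemma is_cderive_slope f q t l :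
  (\forall z \near t, f z - f t = q z * (z - t)%:C) -> ccont q t -> q t = l ->
  is_cderive f t l.
Proof.
move=> hq cq ql.
apply: (@is_cderive_near (fun z => f t + q z * (z - t)%:C)).
  by apply: filterS hq => z <-; rewrite addrC subrK.
apply/is_cderiveP; exists q; split => // z.
by rewrite subrr mulr0 addr0 addrC addKr.
Qed.

Lemma is_cderive_continuous f t l : is_cderive f t l -> ccont f t.
Proof.
move=> [h k]; apply/continuous_complexP; split; apply: differentiable_continuous;
  apply/derivable1_diffP; [exact: (@ex_derive _ _ _ _ _ _ _ h)|exact: (@ex_derive _ _ _ _ _ _ _ k)].
Qed.

Lemma is_cderive_cst l t : is_cderive (fun=> l) t 0.
Proof. by split; exact: is_derive_cst. Qed.

Lemma is_cderiveD f g t l m :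
  is_cderive f t l -> is_cderive g t m -> is_cderive (fun u => f u + g u) t (l + m).
Proof.
move=> /is_cderiveP [a [ha ca <-]] /is_cderiveP [b [hb cb <-]]; apply/is_cderiveP.
exists (fun z => a z + b z); split; [|exact: (cvgD ca cb)|reflexivity].
by move=> z; rewrite mulrDl -ha -hb; ring.
Qed.

Lemma is_cderiveM f g t l m :
  is_cderive f t l -> is_cderive g t m ->
  is_cderive (fun u => f u * g u) t (l * g t + f t * m).
Proof.
move=> hf hg; have cg := is_cderive_continuous hg; move: hf hg.
move=> /is_cderiveP [a [ha ca <-]] /is_cderiveP [b [hb cb <-]]; apply/is_cderiveP.
exists (fun z => a z * g z + f t * b z); split; last reflexivity.
  by move=> z; rewrite mulrDl mulrAC -ha -mulrA -hb; ring.
apply: (@cvgD _ (cplx R)); first exact: (cvgM ca cg).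
by apply: (@cvgM (complex R)); [exact: cvg_cst|exact: cb].
Qed.

Lemma is_cderiveN f t l : is_cderive f t l -> is_cderive (fun u => - f u) t (- l).
Proof.
move=> h; have := is_cderiveM (is_cderive_cst (-1) t) h.
by rewrite mul0r add0r mulN1r; apply: is_cderive_near; near=> x; rewrite mulN1r.
Unshelve. all: by end_near.
Qed.

Lemma is_cderive_sum n (f : 'I_n -> R -> cplx R) t (l : 'I_n -> cplx R) :
  (forall i, is_cderive (f i) t (l i)) ->
  is_cderive (fun u => \sum_i f i u) t (\sum_i l i).
Proof.
elim: n f l => [|n IH] f l h.
  rewrite (_ : (fun u => _) = fun=> 0); first by rewrite big_ord0; exact: is_cderive_cst.
  by apply/funext => u; rewrite big_ord0.
rewrite (_ : (fun u => _) = fun u => f ord0 u + \sum_i f (lift ord0 i) u).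
  by rewrite big_ord_recl; apply: is_cderiveD => //; apply: IH => i; exact: h.
by apply/funext => u; rewrite big_ord_recl.
Qed.

Lemma is_cderiveV f t l : f t != 0 -> is_cderive f t l ->
  is_cderive (fun u => (f u)^-1) t (- l / f t ^+ 2).
Proof.
move=> f0 hf; have cf := is_cderive_continuous hf; move: hf => /is_cderiveP [a [ha ca <-]].
apply: (@is_cderive_slope _ (fun z => - a z * ((f z)^-1 * (f t)^-1))).
- apply: filterS (ccontinuous_neq0 cf f0) => z fz.
  rewrite mulrAC mulNr -ha; field.
  by rewrite fz f0.
- apply: ccontinuousM; first exact: ccontinuousN.
  by apply: ccontinuousM; [exact: ccontinuousV|exact: ccontinuous_cst].
- by rewrite expr2 invfM.
Qed.

(** The slope of [f] is that of [g] divided by [f z + f t]. Continuity of [f] selects the branch and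
    keeps this denominator away from 0. *)
Lemma is_cderive_sqrt f g t l : f t != 0 -> (\forall z \near t, f z ^+ 2 = g z) ->
  ccont f t -> is_cderive g t l -> is_cderive f t (l / (f t *+ 2)).
Proof.
move=> f0 fg cf /is_cderiveP [a [ha ca <-]].
have f20 : f t + f t != 0 by rewrite -mulr2n mulrn_eq0.
have cs : ccont (fun z => f z + f t) t.
  by apply: ccontinuousD; [exact: cf|exact: ccontinuous_cst].
have fgt := nbhs_singleton fg.
apply: (@is_cderive_slope _ (fun z => a z / (f z + f t))).
- have := ccontinuous_neq0 cs f20; apply: filterS2 fg => z fgz fz.
  by rewrite mulrAC -ha -fgt -fgz; field.
- by apply: ccontinuousM; [exact: ca|exact: ccontinuousV].
- by rewrite mulr2n.
Qed.

(** A pointwise form of class C^1, so that regularity can be checked at each time in whatever chart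
    is available there. *)
Definition C1at f t :=
  (\forall u \near t, cderivable f u) /\ ccont (cderive f) t.

Lemma C1atI f (df : R -> cplx R) t :
  (\forall u \near t, is_cderive f u (df u)) -> ccont df t -> C1at f t.
Proof.
move=> h c; split; first by apply: filterS h => u; exact: is_cderive_cderivable.
by apply: ccontinuous_near c; apply: filterS h => u /is_cderiveE.
Qed.

Lemma C1atP f t : C1at f t ->
  (\forall u \near t, is_cderive f u (cderive f u)) /\ ccont (cderive f) t.
Proof.
by move=> [h c]; split; [apply: filterS h => u; exact: cderivableP|exact: c].
Qed.

Lemma C1at_is_cderive f t : C1at f t -> is_cderive f t (cderive f t).
Proof. by move=> /C1atP [/nbhs_singleton]. Qed.

Lemma C1at_continuous f t : C1at f t -> ccont f t.
Proof. by move=> /C1at_is_cderive /is_cderive_continuous. Qed.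

Lemma near_near (P : R -> Prop) t :
  (\forall u \near t, P u) -> \forall u \near t, \forall w \near u, P w.
Proof. by move=> /nbhs_interior. Qed.

Lemma C1at_near f g t : (\near t, f t = g t) -> C1at f t -> C1at g t.
Proof.
move=> fg /C1atP [h c]; apply: C1atI c; have fg' := near_near fg.
by apply: filterS2 h fg' => u a b; exact: is_cderive_near a.
Qed.

Lemma C1at_cst l t : C1at (fun=> l) t.
Proof.
apply: (@C1atI _ (fun=> 0)); last exact: ccontinuous_cst.
by apply: filterE => u; exact: is_cderive_cst.
Qed.

Lemma C1atD f g t : C1at f t -> C1at g t -> C1at (fun u => f u + g u) t.
Proof.
move=> /C1atP [hf cf] /C1atP [hg cg].
apply: (@C1atI _ (fun u => cderive f u + cderive g u)); last exact: ccontinuousD.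
by apply: filterS2 hf hg => u; exact: is_cderiveD.
Qed.

Lemma C1atM f g t : C1at f t -> C1at g t -> C1at (fun u => f u * g u) t.
Proof.
move=> hf hg; have := C1at_continuous hf; have := C1at_continuous hg.
move: hf hg => /C1atP [hf cf] /C1atP [hg cg] cg0 cf0.
apply: (@C1atI _ (fun u => cderive f u * g u + f u * cderive g u)).
  by apply: filterS2 hf hg => u; exact: is_cderiveM.
by apply: ccontinuousD; apply: ccontinuousM.
Qed.

Lemma C1atN f t : C1at f t -> C1at (fun u => - f u) t.
Proof.
move=> /C1atP [hf cf]; apply: (@C1atI _ (fun u => - cderive f u)).
  by apply: filterS hf => u; exact: is_cderiveN.
exact: ccontinuousN.
Qed.

Lemma C1at_sum n (f : 'I_n -> R -> cplx R) t :
  (forall i, C1at (f i) t) -> C1at (fun u => \sum_i f i u) t.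
Proof.
elim: n f => [|n IH] f h.
  rewrite (_ : (fun u => _) = fun=> 0); first exact: C1at_cst.
  by apply/funext => u; rewrite big_ord0.
rewrite (_ : (fun u => _) = fun u => f ord0 u + \sum_i f (lift ord0 i) u).
  by apply: C1atD => //; apply: IH => i; exact: h.
by apply/funext => u; rewrite big_ord_recl.
Qed.

Lemma C1atV f t : f t != 0 -> C1at f t -> C1at (fun u => (f u)^-1) t.
Proof.
move=> f0 hf; have cf0 := C1at_continuous hf.
move: hf => /C1atP [hf cf].
apply: (@C1atI _ (fun u => - cderive f u * ((f u)^-1 * (f u)^-1))).
  have n0 := ccontinuous_neq0 cf0 f0.
  apply: filterS2 hf n0 => u h fu; have := is_cderiveV fu h.
  by rewrite expr2 invfM.
apply: ccontinuousM; first exact: ccontinuousN.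
by apply: ccontinuousM; apply: ccontinuousV.
Qed.

Lemma C1at_sqrt f g t : f t != 0 -> (\forall z \near t, f z ^+ 2 = g z) ->
  (\forall z \near t, ccont f z) -> C1at g t -> C1at f t.
Proof.
move=> f0 fg cf /C1atP [hg cg]; have cft := nbhs_singleton cf.
apply: (@C1atI _ (fun u => cderive g u / (f u + f u))).
  have n0 := ccontinuous_neq0 cft f0.
  have fg' := near_near fg.
  have : \forall u \near t, f u != 0 /\ ccont f u by exact: filterI n0 cf.
  apply: filterS3 hg fg' => u h fgu [fu cfu]; rewrite -mulr2n.
  exact: is_cderive_sqrt h.
apply: ccontinuousM; first exact: cg.
apply: ccontinuousV; last exact: ccontinuousD.
by rewrite -mulr2n mulrn_eq0.
Qed.

Lemma is_cderive_affine (a b : cplx R) t0 t :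
  is_cderive (fun u => a + b * (u - t0)%:C) t b.
Proof.
apply/is_cderiveP; exists (fun=> b); split; [|exact: ccontinuous_cst|reflexivity].
by move=> z; rewrite !rmorphB /=; ring.
Qed.

Lemma is_cderive_glue f g t l : f t = g t -> is_cderive f t l -> is_cderive g t l ->
  is_cderive (fun u => if u < t then f u else g u) t l.
Proof.
move=> fg /is_cderiveP [a [ha ca al]] /is_cderiveP [b [hb cb bl]]; apply/is_cderiveP.
exists (fun z => if z < t then a z else b z); split.
- by move=> z; rewrite ltxx; case: ifP => _; rewrite -?ha -?hb ?fg.
- rewrite /ccont /prop_for /continuous_at ltxx; apply/cvgrPdist_lt => e e0.
  have /cvgrPdist_lt /(_ e e0) h1 := ca; have /cvgrPdist_lt /(_ e e0) h2 := cb.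
  apply: filterS2 h1 h2 => z; rewrite al bl.
  by case: ifP.
- by rewrite ltxx.
Qed.

End ComplexCalculus.

(** * Chain rules for functions on the plane composed with curves *)

Section ChainRule.
Variable R : realType.
Implicit Types (f g q : R -> cplx R) (t : R) (l m : cplx R).
Local Notation Re := (@complex.Re R).
Local Notation Im := (@complex.Im R).

(** Squares suit the mean value argument of [real_C1_slopes], which moves parallel to the axes. *)
Lemma nbhs_complexP (z : cplx R) (P : cplx R -> Prop) :
  (\forall w \near z, P w) <->
  exists2 d : R, 0 < d & forall w, `|Re (w - z)| < d -> `|Im (w - z)| < d -> P w.
Proof.
split.
  move=> /nbhs_ballP [[e e'] /=]; rewrite ltcE /= => /andP[/eqP -> e0] h.
  exists (e / 2); first by rewrite divr_gt0.
  move=> w h1 h2; apply: h; rewrite /ball /= -opprB normrN.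
  apply: le_lt_trans (normc_le_add _) _.
  by rewrite ltcR [ltRHS](splitr e) ltrD.
move=> [d d0 h]; apply/nbhs_ballP; exists d%:C => /=; first by rewrite ltcR.
move=> w; rewrite /ball /= -opprB normrN => hw.
by apply: h; rewrite -ltcR; apply: le_lt_trans hw; [exact: normc_ge_Re|exact: normc_ge_Im].
Qed.

Lemma MVT_centered (f df : R -> R) (a : R) :
  (forall x : R, `|x| <= `|a| -> is_derive x 1 f (df x)) ->
  exists2 c, `|c| <= `|a| & f a - f 0 = df c * a.
Proof.
move=> h.
have cf x : `|x| <= `|a| -> {for x, continuous f}.
  move=> /h hx; apply: differentiable_continuous; apply/derivable1_diffP.
  by have [] := hx.
case: (leP 0 a) => a0.
  have [x|  |c] := @MVT_segment _ f df 0 a a0.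
  - by rewrite in_itv /= => /andP[x0 xa]; apply: h; rewrite !ger0_norm // ltW.
  - apply: continuous_in_subspaceT => x; rewrite inE /= in_itv /= => /andP[x0 xa].
    by apply: cf; rewrite !ger0_norm.
  - rewrite in_itv /= => /andP[x0 xa] e; exists c; first by rewrite !ger0_norm.
    by rewrite e subr0.
have [x|  |c] := @MVT_segment _ f df a 0 (ltW a0).
- by rewrite in_itv /= => /andP[x0 xa]; apply: h; rewrite !ler0_norm ?lerN2 // ltW.
- apply: continuous_in_subspaceT => x; rewrite inE /= in_itv /= => /andP[x0 xa].
  by apply: cf; rewrite !ler0_norm ?lerN2 // ltW.
- rewrite in_itv /= => /andP[x0 xa] e; exists c.
    by rewrite !ler0_norm ?lerN2 // ltW.
  by rewrite -opprB e sub0r mulrN opprK.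
Qed.

Lemma is_derive_line (h : R -> R) (s l : R) :
  is_derive (0 : R) 1 (fun u => h (s + u)) l -> is_derive s 1 h l.
Proof.
move=> /is_derive1_caratheodory [q [hq cq ql]]; apply/is_derive1_caratheodory.
exists (fun u => q (u - s)); split.
- by move=> z; have := hq (z - s); rewrite subr0 addr0 addrCA subrr addr0.
- rewrite /prop_for /continuous_at subrr.
  apply: (@cvg_comp _ _ _ (fun u => u - s) q (nbhs s) (nbhs 0)) => //.
  by rewrite -(subrr s); apply: cvgB => //; exact: cvg_cst.
- by rewrite subrr.
Qed.

(** Caratheodory's form in two variables. The path from [z0] to [w] goes vertically to the corner
    [p w], then horizontally; the mean value theorem on each leg turns the slope into a partial
    derivative at a nearby point, and these are continuous at [z0]. *)
Lemma real_C1_slopes (U dx dy : cplx R -> R) (z0 : cplx R) :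
  (\forall z \near z0, is_derive (0 : R) 1 (fun s => U (z + s%:C * 1)) (dx z)) ->
  (\forall z \near z0, is_derive (0 : R) 1 (fun s => U (z + s%:C * ii R)) (dy z)) ->
  {for z0, continuous dx} -> {for z0, continuous dy} ->
  exists A B : cplx R -> R,
    [/\ forall w, U w - U z0 = A w * Re (w - z0) + B w * Im (w - z0),
        {for z0, continuous A}, {for z0, continuous B}, A z0 = dx z0 & B z0 = dy z0].
Proof.
move=> hx hy cx cy.
pose p (w : cplx R) : cplx R := z0 + (Im (w - z0))%:C * ii R.
(* Where a leg is degenerate its slope is arbitrary; the partial derivative at [z0] is the value
   that makes it continuous. *)
pose A (w : cplx R) : R := if Re (w - z0) == 0 then dx z0 else (U w - U (p w)) / Re (w - z0).
pose B (w : cplx R) : R := if Im (w - z0) == 0 then dy z0 else (U (p w) - U z0) / Im (w - z0).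
have A0 : A z0 = dx z0 by rewrite /A subrr eqxx.
have B0 : B z0 = dy z0 by rewrite /B subrr eqxx.
exists A, B.
have Ep w : w = p w + (Re (w - z0))%:C * 1.
  apply: ext_complex; rewrite /p /ii !(ReD, ImD, ReM, ImM, ReN, ImN) /=; ring.
split => //.
- move=> w; rewrite [LHS](_ : _ = (U w - U (p w)) + (U (p w) - U z0)); last by rewrite addrA subrK.
  congr (_ + _); rewrite /A /B; case: eqP => [e|/eqP e].
  + by rewrite {1}(Ep w) e mul0r addr0 subrr mulr0.
  + by rewrite divfK.
  + by rewrite /p e mul0r addr0 subrr mulr0.
  + by rewrite divfK.
- rewrite /prop_for /continuous_at A0; apply/(@cvgrPdist_lt _ _ _ (nbhs z0)) => e e0.
  have /(@cvgrPdist_lt _ _ _ (nbhs z0)) /(_ e e0) cxe := cx.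
  have [d d0 hd] := (nbhs_complexP _ _).1 (filterI hx cxe).
  apply/nbhs_complexP; exists d => // w w1 w2.
  rewrite /A /B; case: eqP => [_|/eqP w0]; first by rewrite subrr normr0.
  have [s|c ca cE] := @MVT_centered (fun s => U (p w + s%:C * 1)) (fun s => dx (p w + s%:C * 1)) (Re (w - z0)).
    move=> sw; apply: is_derive_line.
    have [|| H _] := hd (p w + s%:C * 1).
    + move: sw w1; rewrite /p /ii !(ReD, ImD, ReM, ImM, ReN, ImN) /= => sw w1.
      by apply: le_lt_trans w1; apply: le_trans sw; rewrite le_eqVlt; apply/orP; left; apply/eqP; congr (`|_|); ring.
    + move: w2; rewrite /p /ii !(ReD, ImD, ReM, ImM, ReN, ImN) /= => w2.
      by apply: le_lt_trans w2; rewrite le_eqVlt; apply/orP; left; apply/eqP; congr (`|_|); ring.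
    + rewrite (_ : (fun u => _) = fun u => U (p w + s%:C * 1 + u%:C * 1)); first exact: H.
      by apply/funext => u; rewrite rmorphD /= mulrDl addrA.
  rewrite /= mul0r addr0 -Ep in cE.
  rewrite cE mulfK //.
  have [||_ //] := hd (p w + c%:C * 1).
  + move: ca w1; rewrite /p /ii !(ReD, ImD, ReM, ImM, ReN, ImN) /= => sw w1.
    by apply: le_lt_trans w1; apply: le_trans sw; rewrite le_eqVlt; apply/orP; left; apply/eqP; congr (`|_|); ring.
  + move: w2; rewrite /p /ii !(ReD, ImD, ReM, ImM, ReN, ImN) /= => w2.
    by apply: le_lt_trans w2; rewrite le_eqVlt; apply/orP; left; apply/eqP; congr (`|_|); ring.
- rewrite /prop_for /continuous_at B0; apply/(@cvgrPdist_lt _ _ _ (nbhs z0)) => e e0.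
  have /(@cvgrPdist_lt _ _ _ (nbhs z0)) /(_ e e0) cye := cy.
  have [d d0 hd] := (nbhs_complexP _ _).1 (filterI hy cye).
  apply/nbhs_complexP; exists d => // w w1 w2.
  rewrite /A /B; case: eqP => [_|/eqP w0]; first by rewrite subrr normr0.
  have [s|c ca cE] := @MVT_centered (fun s => U (z0 + s%:C * ii R)) (fun s => dy (z0 + s%:C * ii R)) (Im (w - z0)).
    move=> sw; apply: is_derive_line.
    have [|| H _] := hd (z0 + s%:C * ii R).
    + rewrite /ii !(ReD, ImD, ReM, ImM, ReN, ImN) /=.
      by rewrite !(mul0r, mulr0, mulr1, subr0, addr0, add0r, subrr) normr0.
    + move: sw w2; rewrite /ii !(ReD, ImD, ReM, ImM, ReN, ImN) /= => sw w2.
      by apply: le_lt_trans w2; apply: le_trans sw; rewrite le_eqVlt; apply/orP; left; apply/eqP; congr (`|_|); ring.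
    + rewrite (_ : (fun u => _) = fun u => U (z0 + s%:C * ii R + u%:C * ii R)); first exact: H.
      by apply/funext => u; rewrite rmorphD /= mulrDl addrA.
  rewrite /= mul0r addr0 in cE.
  rewrite cE mulfK //.
  have [||_ //] := hd (z0 + c%:C * ii R).
  + rewrite /ii !(ReD, ImD, ReM, ImM, ReN, ImN) /=.
    by rewrite !(mul0r, mulr0, mulr1, subr0, addr0, add0r, subrr) normr0.
  + move: ca w2; rewrite /ii !(ReD, ImD, ReM, ImM, ReN, ImN) /= => sw w2.
    by apply: le_lt_trans w2; apply: le_trans sw; rewrite le_eqVlt; apply/orP; left; apply/eqP; congr (`|_|); ring.
Qed.

Lemma ccontinuous_comp (T : topologicalType) (F : cplx R -> cplx R) (z : T -> cplx R) (t : T) :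
  ccont z t -> ccont F (z t) -> ccont (fun u => F (z u)) t.
Proof. by move=> cz cF; exact: (@continuous_comp _ _ _ z F t cz cF). Qed.

Lemma continuous_comp_real (A : cplx R -> R) (z : R -> cplx R) t :
  ccont z t -> {for z t, continuous A} -> {for t, continuous (fun u => A (z u))}.
Proof. by move=> cz cA; exact: (@continuous_comp _ _ _ z A t cz cA). Qed.

(** The slopes of the real and imaginary parts of [F], combined with the slope of [z], form a slope
    of the composite; its value at [t] is then rewritten with Wirtinger derivatives. *)
Lemma is_cderive_Ck (V : set (cplx R)) (F : cplx R -> cplx R) (z : R -> cplx R) t l :
  open V -> Ck 1 V F -> V (z t) -> is_cderive z t l ->
  is_cderive (fun u => F (z u)) t (wirt F (z t) * l + wirtbar F (z t) * conjc l).
Proof.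
move=> oV [_ [hl [c1 _] [c2 _]]] Vz hz.
have nV : \forall w \near z t, V w by exact: open_nbhs_nbhs.
have cz := is_cderive_continuous hz.
have line_Re v w : cderivable (line F v w) 0 ->
    is_derive (0 : R) 1 (fun s => Re (F (w + s%:C * v))) (Re (partial v F w)).
  by move=> /cderivableP [].
have line_Im v w : cderivable (line F v w) 0 ->
    is_derive (0 : R) 1 (fun s => Im (F (w + s%:C * v))) (Im (partial v F w)).
  by move=> /cderivableP [].
have [p1r p1i] := (continuous_complexP _ _).1 (c1 _ Vz).
have [p2r p2i] := (continuous_complexP _ _).1 (c2 _ Vz).
have near_line v : (forall w, V w -> cderivable (line F v w) 0) ->
    (\forall w \near z t, is_derive (0 : R) 1 (fun s => Re (F (w + s%:C * v))) (Re (partial v F w))) /\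
    (\forall w \near z t, is_derive (0 : R) 1 (fun s => Im (F (w + s%:C * v))) (Im (partial v F w))).
  by move=> h; split; apply: filterS nV => w Vw; [apply: line_Re|apply: line_Im]; exact: h.
have [n1r n1i] := near_line 1 (fun w Vw => (hl w Vw).1).
have [n2r n2i] := near_line (ii R) (fun w Vw => (hl w Vw).2).
have [A1 [B1 [E1 cA1 cB1 A10 B10]]] := @real_C1_slopes (fun w => Re (F w))
  (fun w => Re (partial 1 F w)) (fun w => Re (partial (ii R) F w)) (z t) n1r n2r p1r p2r.
have [A2 [B2 [E2 cA2 cB2 A20 B20]]] := @real_C1_slopes (fun w => Im (F w))
  (fun w => Im (partial 1 F w)) (fun w => Im (partial (ii R) F w)) (z t) n1i n2i p1i p2i.
move: hz => /is_cderiveP [q [hq cq ql]].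
have [cqr cqi] := (continuous_complexP _ _).1 cq.
apply/is_cderiveP.
exists (fun u => (A1 (z u) * Re (q u) + B1 (z u) * Im (q u)) +i*
                 (A2 (z u) * Re (q u) + B2 (z u) * Im (q u))); split.
- move=> u; have := E1 (z u); have := E2 (z u); rewrite hq => e2 e1.
  apply: ext_complex.
    by rewrite ReD ReN e1 !ReM ImM /=; ring.
  by rewrite ImD ImN e2 !ImM ReM /=; ring.
- apply/continuous_complexP; split; apply: cvgD; apply: cvgM => //;
    exact: continuous_comp_real.
- rewrite A10 B10 A20 B20 ql /wirt /wirtbar.
  case: (partial 1 F (z t)) => a b; case: (partial (ii R) F (z t)) => c d.
  case: l {hq ql} => x y.
  have -> : (2%:R : R[i])^-1 = (2^-1)%:C by rewrite fmorphV rmorphD /=.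
  apply: ext_complex; rewrite /ii !(ReD, ImD, ReM, ImM, ReN, ImN) /=; by field.
Qed.

Lemma wirt_continuous (V : set (cplx R)) F w : Ck 1 V F -> V w -> ccont (wirt F) w.
Proof.
move=> [_ [_ [c1 _] [c2 _]]] Vw; apply: ccontinuousM; last exact: ccontinuous_cst.
apply: ccontinuousD; first exact: c1.
by apply: ccontinuousN; apply: ccontinuousM; [exact: ccontinuous_cst|exact: c2].
Qed.

Lemma wirtbar_continuous (V : set (cplx R)) F w : Ck 1 V F -> V w -> ccont (wirtbar F) w.
Proof.
move=> [_ [_ [c1 _] [c2 _]]] Vw; apply: ccontinuousM; last exact: ccontinuous_cst.
apply: ccontinuousD; first exact: c1.
by apply: ccontinuousM; [exact: ccontinuous_cst|exact: c2].
Qed.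

Lemma C1at_Ck (V : set (cplx R)) (F : cplx R -> cplx R) (z : R -> cplx R) t :
  open V -> Ck 1 V F -> V (z t) -> C1at z t -> C1at (fun u => F (z u)) t.
Proof.
move=> oV hF Vz hz; have cz := C1at_continuous hz; move: hz => /C1atP [hz cz'].
have nV : \forall u \near t, V (z u) by apply: cz; exact: open_nbhs_nbhs.
apply: (@C1atI _ _ (fun u => wirt F (z u) * cderive z u + wirtbar F (z u) * conjc (cderive z u))).
  by apply: filterS2 nV hz => u Vu; exact: is_cderive_Ck hF Vu.
apply: ccontinuousD; apply: ccontinuousM.
- by apply: ccontinuous_comp; [exact: cz|exact: wirt_continuous hF Vz].
- exact: cz'.
- by apply: ccontinuous_comp; [exact: cz|exact: wirtbar_continuous hF Vz].
- exact: ccontinuous_conj.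
Qed.

(** The complex difference quotient of [F], completed by its derivative at [z t], is continuous
    there and multiplies the slope of [z]. *)
Lemma is_cderive_holo (F : cplx R -> cplx R) (z : R -> cplx R) t l :
  derivable F (z t) 1 -> is_cderive z t l ->
  is_cderive (fun u => F (z u)) t ('D_1 F (z t) * l).
Proof.
move=> dF hz; have cz := is_cderive_continuous hz; move: hz => /is_cderiveP [q [hq cq ql]].
pose A (w : cplx R) : cplx R := if w == z t then 'D_1 F (z t) else (F w - F (z t)) / (w - z t).
have A0 : A (z t) = 'D_1 F (z t) by rewrite /A eqxx.
have cA : ccont A (z t).
  rewrite /ccont /prop_for /continuous_at A0.
  apply/(@cvgrPdist_lt _ _ _ (nbhs (z t))) => e e0.
  have /(@cvgrPdist_lt _ _ _ (0^')) /(_ e e0) := dF.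
  rewrite -/('D_1 F (z t)) /dnbhs /within /= => h.
  have [d d0 hd] := (nbhs_complexP _ _).1 h.
  apply/nbhs_complexP; exists d => // w w1 w2; rewrite /A; case: eqP => [_|/eqP wn].
    by rewrite subrr normr0.
  have := hd (w - z t); rewrite !subr0 => /(_ w1 w2).
  rewrite subr_eq0 => /(_ wn) /=.
  by rewrite /GRing.scale /= mulr1 subrK mulrC.
apply/is_cderiveP; exists (fun u => A (z u) * q u); split.
- move=> u; rewrite -mulrA -hq /A; case: eqP => [->|/eqP wn]; first by rewrite !subrr mulr0.
  by rewrite divfK // subr_eq0.
- by apply: ccontinuousM; [apply: ccontinuous_comp; [exact: cz|exact: cA]|exact: cq].
- by rewrite A0 ql.
Qed.

Lemma is_cderive_cexp f t l : is_cderive f t l ->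
  is_cderive (fun u => cexp (f u)) t (l * cexp (f t)).
Proof.
move=> [hr hi].
have he := is_derive1_comp (is_derive_expR (Re (f t))) hr.
have hc := is_derive1_comp (is_derive_cos (Im (f t))) hi.
have hs := is_derive1_comp (is_derive_sin (Im (f t))) hi.
have a := is_deriveM he hc; have b := is_deriveM he hs.
split.
  rewrite (_ : (fun u => _) = ((@expR R \o (fun u => Re (f u))) * (@cos R \o (fun u => Im (f u))))).
    by apply: is_derive_eq a _; rewrite /cexp ReM ReM ImM /= /GRing.scale /=; ring.
  by apply/funext => u; rewrite /cexp ReM /= mul0r subr0.
rewrite (_ : (fun u => _) = ((@expR R \o (fun u => Re (f u))) * (@sin R \o (fun u => Im (f u))))).
  by apply: is_derive_eq b _; rewrite /cexp ImM ReM ImM /= /GRing.scale /=; ring.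
by apply/funext => u; rewrite /cexp ImM /= mul0r addr0.
Qed.

Lemma cexpD (x y : R[i]) : cexp (x + y) = cexp x * cexp y.
Proof.
rewrite /cexp ReD ImD expRD cosD sinD.
by apply: ext_complex; rewrite !(ReM, ImM) /=; ring.
Qed.

Lemma cexp0 : cexp (0 : R[i]) = 1.
Proof. by rewrite /cexp /= expR0 cos0 sin0 mul1r. Qed.

Lemma cexp_neq0 (x : R[i]) : cexp x != 0.
Proof.
apply/eqP => e; have := cexpD x (- x); rewrite subrr cexp0 e mul0r => /eqP.
by rewrite oner_eq0.
Qed.

Lemma cexp_continuous_comp (f : R -> cplx R) t :
  ccont f t -> ccont (fun u => cexp (f u)) t.
Proof.
move=> /continuous_complexP [a b].
have ce : {for t, continuous (fun u => expR (Re (f u)))}.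
  by apply: (@continuous_comp _ _ _ (fun u => Re (f u)) (@expR R) t) => //; exact: continuous_expR.
have cc : {for t, continuous (fun u => cos (Im (f u)))}.
  by apply: (@continuous_comp _ _ _ (fun u => Im (f u)) (@cos R) t) => //; exact: continuous_cos.
have cs : {for t, continuous (fun u => sin (Im (f u)))}.
  by apply: (@continuous_comp _ _ _ (fun u => Im (f u)) (@sin R) t) => //; exact: continuous_sin.
apply/continuous_complexP; split.
  rewrite (_ : (fun u => _) = fun u => expR (Re (f u)) * cos (Im (f u))); first exact: (cvgM ce cc).
  by apply/funext => u; rewrite /cexp ReM /= mul0r subr0.
rewrite (_ : (fun u => _) = fun u => expR (Re (f u)) * sin (Im (f u))); first exact: (cvgM ce cs).
by apply/funext => u; rewrite /cexp ImM /= mul0r addr0.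
Qed.

Lemma C1at_cexp f t : C1at f t -> C1at (fun u => cexp (f u)) t.
Proof.
move=> hf; have cf := C1at_continuous hf; move: hf => /C1atP [hf cf'].
apply: (@C1atI _ _ (fun u => cderive f u * cexp (f u))).
  by apply: filterS hf => u; exact: is_cderive_cexp.
by apply: ccontinuousM; [exact: cf'|exact: cexp_continuous_comp].
Qed.

End ChainRule.

(** * Linear differential equations and the WKB estimate *)

Section Analysis.
Variable R : realType.
Local Notation Re := (@complex.Re R).
Local Notation Im := (@complex.Im R).

Lemma is_derive_continuous (f : R -> R) (t l : R) :
  is_derive t 1 f l -> {for t, continuous f}.
Proof.
move=> h; apply: differentiable_continuous; apply/derivable1_diffP.
by have [] := h.
Qed.

(** The primitive is based at -2 and integrability used up to 3, to leave room for two-sided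
    derivatives at 0 and 1. *)
Lemma antiderivative (f : R -> R) : continuous f ->
  exists F : R -> R, F 0 = 0 /\ forall t : R, -1 < t < 2 -> is_derive t 1 F (f t).
Proof.
move=> cf; pose G x := \int[lebesgue_measure]_(t in `[-2, x]) f t.
exists (fun t => G t - G 0); split; first by rewrite subrr.
move=> t /andP[t1 t2].
have fi : lebesgue_measure.-integrable `[-2, 3] (EFin \o f).
  apply: continuous_compact_integrable; first exact: segment_compact.
  by apply: continuous_subspaceT => x; exact: cf.
have [||dG eG] := continuous_FTC1_closed _ fi _ (cf t); [by lra|by lra|].
rewrite -[f t]subr0; apply: is_deriveB.
by split; [exact: dG|rewrite -derive1E].
Qed.

Lemma nondecreasing01 (f df : R -> R) :
  (forall t : R, 0 <= t <= 1 -> is_derive t 1 f (df t)) ->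
  (forall t, 0 <= t <= 1 -> 0 <= df t) ->
  forall s t, 0 <= s -> s <= t -> t <= 1 -> f s <= f t.
Proof.
move=> h pos s t s0 st t1.
have [x|  |c] := @MVT_segment _ f df s t st.
- by rewrite in_itv /= => /andP[sx xt]; apply: h; lra.
- apply: continuous_in_subspaceT => x; rewrite inE /= in_itv /= => /andP[sx xt].
  by apply: is_derive_continuous (h x _); lra.
- rewrite in_itv /= => /andP[sc ct] e.
  rewrite -subr_ge0 e; apply: mulr_ge0; last by rewrite subr_ge0.
  by apply: pos; lra.
Qed.

(** [f t * expR (- k * t)] is non-increasing. The sign of [k] is free: [wkb_energy] uses a positive
    one for a growth bound and a negative one for damping. *)
Lemma gronwall (f df : R -> R) (k : R) :
  (forall t : R, 0 <= t <= 1 -> is_derive t 1 f (df t)) ->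
  (forall t, 0 <= t <= 1 -> df t <= k * f t) ->
  forall t, 0 <= t <= 1 -> f t <= f 0 * expR (k * t).
Proof.
move=> h hk t /andP[t0 t1].
have he (u : R) : is_derive u 1 (fun s => expR (- k * s)) (expR (- k * u) * - k).
  apply: (@is_derive1_comp _ (@expR R) (fun s => - k * s)).
  by apply: is_derive_eq; rewrite /GRing.scale /= mulr1.
have hg (u : R) : 0 <= u <= 1 -> is_derive u 1 (fun s => - (f s * expR (- k * s)))
    (- (df u - k * f u) * expR (- k * u)).
  move=> /h hu; have := is_deriveN (is_deriveM hu (he u)).
  by move=> H; apply: (is_derive_eq H); rewrite /GRing.scale /=; ring.
have : - (f 0 * expR (- k * 0)) <= - (f t * expR (- k * t)).
  apply: (nondecreasing01 hg _ (lexx 0) t0 t1) => u hu.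
  apply: mulr_ge0; last exact: expR_ge0.
  by rewrite oppr_ge0 subr_le0 hk.
by rewrite mulr0 expR0 mulr1 lerN2 mulNr expRN ler_pdivrMr ?expR_gt0.
Qed.

Lemma derive_bound (f df g dg : R -> R) :
  (forall t : R, 0 <= t <= 1 -> is_derive t 1 f (df t)) ->
  (forall t : R, 0 <= t <= 1 -> is_derive t 1 g (dg t)) ->
  (forall t, 0 <= t <= 1 -> `|df t| <= dg t) ->
  forall t, 0 <= t <= 1 -> `|f t - f 0| <= g t - g 0.
Proof.
move=> hf hg hd t /andP[t0 t1].
have h1 := @nondecreasing01 (g + f) (fun u => dg u + df u) _ _ 0 t (lexx _) t0 t1.
have h2 := @nondecreasing01 (g - f) (fun u => dg u - df u) _ _ 0 t (lexx _) t0 t1.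
have : g 0 + f 0 <= g t + f t.
  apply: h1 => u hu; first by apply: is_deriveD; [exact: hg|exact: hf].
  by have := hd u hu; rewrite ler_norml => /andP[]; lra.
have : g 0 - f 0 <= g t - f t.
  apply: h2 => u hu; first by apply: is_deriveB; [exact: hg|exact: hf].
  by have := hd u hu; rewrite ler_norml => /andP[]; lra.
rewrite ler_norml => a b; lra.
Qed.

Lemma continuous_bound01 (f : R -> R) : continuous f ->
  exists2 K : R, 0 <= K & forall t, 0 <= t <= 1 -> `|f t| <= K.
Proof.
move=> cf; have [|c _ hc] := @EVT_max _ (fun t => `|f t|) 0 1 ler01.
  by apply: continuous_subspaceT => x; apply: cvg_norm; exact: cf.
by exists `|f c| => // t ht; apply: hc; rewrite in_itv.
Qed.

(** The retraction of the line onto [0, 1]; composing with it makes functions that are continuous at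
    the points of [0, 1] continuous everywhere. *)
Definition clamp01 (t : R) : R := Num.max 0 (Num.min t 1).

Lemma clamp01_itv t : 0 <= clamp01 t <= 1.
Proof. by rewrite /clamp01 le_max lexx ge_max ler01 ge_min lexx orbT. Qed.

Lemma clamp01_id t : 0 <= t <= 1 -> clamp01 t = t.
Proof. by move=> /andP[t0 t1]; rewrite /clamp01 (min_idPl t1) (max_idPr t0). Qed.

Lemma clamp01_continuous : continuous clamp01.
Proof.
move=> t; apply: (@continuous_max R R (fun=> 0) (fun t => Num.min t 1)); first exact: cvg_cst.
by apply: (@continuous_min R R (fun t => t) (fun=> 1)); [exact: cvg_id|exact: cvg_cst].
Qed.

Lemma clamp01_comp_continuous (T : topologicalType) (f : R -> T) :
  (forall t, 0 <= t <= 1 -> {for t, continuous f}) -> continuous (fun t => f (clamp01 t)).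
Proof.
move=> h t; apply: (@continuous_comp _ _ _ clamp01 f); first exact: clamp01_continuous.
exact: h (clamp01_itv t).
Qed.

(** The intervals centred at [u k] with radius [2 * C / 2 ^+ k] are nested, so the supremum of their
    left ends lies in all of them. *)
Lemma geometric_limit (u : nat -> R) (C : R) :
  (forall k, `|u k.+1 - u k| <= C / 2 ^+ k) ->
  exists l, forall k, `|l - u k| <= 2 * C / 2 ^+ k.
Proof.
move=> h; pose v k := u k - 2 * C / 2 ^+ k; pose w k := u k + 2 * C / 2 ^+ k.
have E k : 2 * C / 2 ^+ k.+1 = C / 2 ^+ k.
  by rewrite exprS invfM mulrACA divff ?mul1r // pnatr_eq0.
have E2 k : 2 * C / 2 ^+ k = 2 * (C / 2 ^+ k) by rewrite mulrA.
have vS k : v k <= v k.+1.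
  by have := h k; rewrite /v E E2 ler_norml => /andP[]; lra.
have wS k : w k.+1 <= w k.
  by have := h k; rewrite /w E E2 ler_norml => /andP[]; lra.
have C0 k : 0 <= C / 2 ^+ k by apply: le_trans (h k).
have vw k : v k <= w k by rewrite /v /w E2; have := C0 k; lra.
have vh m n : (m <= n)%N -> v m <= v n.
  by apply: (@homo_leq _ v (fun x y => x <= y)) => //; exact: le_trans.
have wh m n : (m <= n)%N -> w n <= w m.
  by apply: (@homo_leq _ w (fun x y => y <= x)) => // y x z a b; exact: le_trans b a.
have ub k : ubound (range v) (w k).
  move=> _ [m _ <-]; apply: le_trans (vh m (maxn m k) (leq_maxl _ _)) _.
  by apply: le_trans (vw _) _; apply: wh; rewrite leq_maxr.
have hs : has_ubound (range v) by exists (w 0%N); exact: ub.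
exists (sup (range v)) => k.
have h1 : v k <= sup (range v) by apply: ub_le_sup => //; exists k.
have h2 : sup (range v) <= w k by apply: ge_sup (ub k); exists (v 0%N), 0%N.
by rewrite ler_norml; move: h1 h2; rewrite /v /w; lra.
Qed.

Lemma continuous_sumR (I : finType) (f : I -> R -> R) t :
  (forall i, {for t, continuous (f i)}) -> {for t, continuous (fun s => \sum_i f i s)}.
Proof.
move=> h; rewrite (_ : (fun s => _) = \sum_i f i); last first.
  by apply/funext => s; rewrite fct_sumE.
elim/big_ind: _; [exact: cvg_cst|by move=> x y cx cy; exact: (cvgD cx cy)|by move=> i _; exact: h].
Qed.

Lemma ex_choice (X Y : Type) (P : X -> Y -> Prop) :
  (forall x, exists y, P x y) -> exists f, forall x, P x (f x).
Proof. by move=> /choice [f hf]; exists f. Qed.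

Lemma geometric_lt (C e : R) : 0 < e -> exists k, C / 2 ^+ k < e.
Proof.
move=> e0; have h : `|2^-1 : R| < 1.
  by rewrite ger0_norm ?invr_ge0 // invf_lt1 // ltr1n.
have /cvgrPdist_lt /(_ _ e0) [k _ /(_ k (leqnn k))] := @cvg_geometric R C 2^-1 h.
rewrite sub0r normrN /geometric /= exprVn => hk; exists k.
exact: le_lt_trans (ler_norm _) hk.
Qed.

Lemma uniform_limit_continuous (u : R -> R) (v : nat -> R -> R) (C : R) :
  (forall k t, 0 <= t <= 1 -> `|u t - v k t| <= C / 2 ^+ k) ->
  (forall k t, 0 <= t <= 1 -> {for t, continuous (v k)}) ->
  continuous (fun t => u (clamp01 t)).
Proof.
move=> huv cv t; apply/cvgrPdist_lt => e e0.
have e3 : 0 < e / 3 by lra.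
have [k hk] := geometric_lt C e3.
have := @clamp01_comp_continuous _ (v k) (cv k) t => /cvgrPdist_lt /(_ (e / 3)).
move=> /(_ e3); apply: filterS => s.
have := huv k _ (clamp01_itv t); have := huv k _ (clamp01_itv s).
rewrite !ler_norml !ltr_norml => /andP[a1 a2] /andP[b1 b2] /andP[c1 c2].
by apply/andP; lra.
Qed.

(** * Picard iteration for real linear systems on [0, 1] *)

Section Picard.
Variables (I : finType) (A : I -> I -> R -> R) (x0 : I -> R).
Hypothesis cA : forall i j, continuous (A i j).

Definition clamped_continuous (v : I -> R -> R) := forall i t, 0 <= t <= 1 -> {for t, continuous (v i)}.
(** The Picard operator as a relation, since an iterate is only determined on [0, 1]. *)
Definition picard_next (v v' : I -> R -> R) := (forall i, v' i 0 = x0 i) /\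
  forall i (t : R), 0 <= t <= 1 -> is_derive t 1 (v' i) (\sum_j A i j t * v j t).

Lemma picard_step (v : I -> R -> R) : (forall i, continuous (fun t => v i (clamp01 t))) ->
  exists v', picard_next v v'.
Proof.
move=> cv.
have [F hF] : exists F : I -> R -> R, forall i, F i 0 = 0 /\ forall t : R, -1 < t < 2 ->
    is_derive t 1 (F i) (\sum_j A i j (clamp01 t) * v j (clamp01 t)).
  apply: (@ex_choice _ _ (fun i Fi => Fi 0 = 0 /\ forall t : R, -1 < t < 2 ->
    is_derive t 1 Fi (\sum_j A i j (clamp01 t) * v j (clamp01 t)))) => i.
  apply: antiderivative => t; apply: continuous_sumR => j.
  apply: cvgM; last exact: cv.
  by apply: (@clamp01_comp_continuous _ (A i j)) => s _; exact: cA.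
exists (fun i t => x0 i + F i t); split; first by move=> i; rewrite (hF i).1 addr0.
move=> i t /andP[t0 t1]; rewrite -[\sum__ _]add0r.
apply: (is_deriveD (is_derive_cst (x0 i) t 1)).
have := (hF i).2 t; rewrite clamp01_id ?t0 //; apply; lra.
Qed.

Lemma picard : exists x : I -> R -> R, (forall i, x i 0 = x0 i) /\
  forall i (t : R), 0 <= t <= 1 -> is_derive t 1 (x i) (\sum_j A i j t * x j t).
Proof.
have next_clamped_continuous v v' : picard_next v v' -> clamped_continuous v'.
  by move=> [_ h] i t ht; apply: is_derive_continuous (h i t ht).
have good_clamp v : clamped_continuous v -> forall i, continuous (fun t => v i (clamp01 t)).
  by move=> gv i; apply: clamp01_comp_continuous; exact: gv.
have [N N0 hN] : exists2 N : R, 0 < N & forall i t, 0 <= t <= 1 -> \sum_j `|A i j t| <= N.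
  have [K hK] : exists K : I -> I -> R, forall i j, 0 <= K i j /\
      forall t, 0 <= t <= 1 -> `|A i j t| <= K i j.
    apply: (@ex_choice _ _ (fun i Ki => forall j, 0 <= Ki j /\
      forall t, 0 <= t <= 1 -> `|A i j t| <= Ki j)) => i.
    apply: (@ex_choice _ _ (fun j Kij => 0 <= Kij /\
      forall t, 0 <= t <= 1 -> `|A i j t| <= Kij)) => j.
    by have [K K0 hK] := continuous_bound01 (@cA i j); exists K.
  exists (1 + \sum_i \sum_j K i j).
    rewrite ltr_pwDl // sumr_ge0 // => i _; rewrite sumr_ge0 // => j _.
    exact: (hK i j).1.
  move=> i t ht; apply: le_trans (_ : \sum_j K i j <= _).
    by apply: ler_sum => j _; exact: (hK i j).2.
  rewrite [X in _ <= _ + X](bigD1 i) //= addrCA lerDl addr_ge0 // sumr_ge0 // => k _.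
  by rewrite sumr_ge0 // => j _; exact: (hK k j).1.
have sum_bound (d : I -> R) (B : R) i (t : R) : 0 <= t <= 1 -> (forall j, `|d j| <= B) ->
    `|\sum_j A i j t * d j| <= N * B.
  move=> ht hd; apply: le_trans (ler_norm_sum _ _ _) _.
  apply: le_trans (_ : (\sum_j `|A i j t|) * B <= _).
    rewrite mulr_suml; apply: ler_sum => j _; rewrite normrM.
    by apply: ler_wpM2l.
  have B0 : 0 <= B by apply: le_trans (hd i).
  by apply: ler_wpM2r => //; exact: hN.
have [X hX] : exists X : nat -> I -> R -> R, clamped_continuous (X 0%N) /\ forall k, picard_next (X k) (X k.+1).
  have [S hS] : exists S : (I -> R -> R) -> (I -> R -> R), forall v, clamped_continuous v -> picard_next v (S v).
    apply: (@ex_choice _ _ (fun v v' => clamped_continuous v -> picard_next v v')) => v.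
    case: (pselect (clamped_continuous v)) => gv; last by exists v.
    by have [v' h] := picard_step (good_clamp _ gv); exists v'.
  pose X k := iter k S (fun i _ => x0 i).
  have g0 : clamped_continuous (X 0%N) by move=> i t _; exact: cvg_cst.
  have gX k : clamped_continuous (X k) by elim: k => [|k IH]; [exact: g0|exact: next_clamped_continuous (hS _ IH)].
  by exists X; split => // k; exact: hS.
have gX k : clamped_continuous (X k) by case: k => [|k]; [exact: hX.1|exact: next_clamped_continuous (hX.2 k)].
have [C C0 hC] : exists2 C : R, 0 <= C & forall i t, 0 <= t <= 1 -> `|X 1%N i t - X 0%N i t| <= C.
  have [K hK] : exists K : I -> R, forall i, 0 <= K i /\
      forall t, 0 <= t <= 1 -> `|X 1%N i t - X 0%N i t| <= K i.
    apply: (@ex_choice _ _ (fun i Ki => 0 <= Ki /\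
      forall t, 0 <= t <= 1 -> `|X 1%N i t - X 0%N i t| <= Ki)) => i.
    have c : continuous (fun t => X 1%N i (clamp01 t) - X 0%N i (clamp01 t)).
      by move=> t; apply: cvgB; exact: good_clamp.
    have [K K0 hK] := continuous_bound01 c; exists K; split => // t ht.
    by have := hK t ht; rewrite clamp01_id.
  exists (\sum_i K i); first by rewrite sumr_ge0 // => i _; exact: (hK i).1.
  move=> i t ht; apply: le_trans ((hK i).2 t ht) _.
  by rewrite (bigD1 i) //= lerDl sumr_ge0 // => j _; exact: (hK j).1.
(* The weight [expR (2 N t)] makes the Picard operator a contraction of ratio 1/2. *)
have geo k i t : 0 <= t <= 1 ->
    `|X k.+1 i t - X k i t| <= C / 2 ^+ k * expR (2 * N * t).
  elim: k i t => [|k IH] i t ht.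
    rewrite expr0 divr1; apply: le_trans (hC i t ht) _.
    rewrite ler_peMr // -expR0 ler_expR; case/andP: ht => t0 _.
    by rewrite mulr_ge0 // mulr_ge0 // ltW.
  have he (s : R) : is_derive s 1 (fun s => C / 2 ^+ k.+1 * expR (2 * N * s))
      (N * (C / 2 ^+ k * expR (2 * N * s))).
    have h : is_derive s 1 (fun s => 2 * N * s) (2 * N).
      by apply: is_derive_eq; rewrite /GRing.scale /= mulr1.
    have h2 := is_derive1_comp (is_derive_expR (2 * N * s)) h.
    have := is_deriveM (is_derive_cst (C / 2 ^+ k.+1 : R) s 1) h2.
    move=> H; apply: (is_derive_eq H); rewrite /GRing.scale /= /cst mulr0 addr0 exprS.
    by field; rewrite expf_neq0 // pnatr_eq0.
  have h0 : X k.+2 i 0 - X k.+1 i 0 = 0 by rewrite (hX.2 k.+1).1 (hX.2 k).1 subrr.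
  have := @derive_bound (X k.+2 i - X k.+1 i)
     (fun s => \sum_j A i j s * X k.+1 j s - \sum_j A i j s * X k j s) _ _ _ (fun s _ => he s) _ t ht.
  rewrite [(_ - _ : R -> R) 0]h0 subr0 => H; apply: le_trans (H _ _) _.
  - by move=> s hs; apply: is_deriveB; apply: (hX.2 _).2.
  - move=> s hs; rewrite -sumrB; under eq_bigr do rewrite -mulrBr.
    by apply: sum_bound => // j; exact: IH.
  - by rewrite gerBl mulr_ge0 // ?expR_ge0 // divr_ge0 // exprn_ge0.
pose D := C * expR (2 * N).
have geoD k i t : 0 <= t <= 1 -> `|X k.+1 i t - X k i t| <= D / 2 ^+ k.
  move=> ht; apply: le_trans (geo k i t ht) _.
  rewrite [leRHS]mulrAC ler_wpM2l ?divr_ge0 ?exprn_ge0 // ler_expR.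
  by rewrite ler_piMr ?mulr_ge0 ?(ltW N0) //; case/andP: ht.
have [u hu] : exists u : I -> R -> R, forall i t, 0 <= t <= 1 ->
    forall k, `|u i t - X k i t| <= 2 * D / 2 ^+ k.
  apply: (@ex_choice _ _ (fun i ui => forall t, 0 <= t <= 1 ->
    forall k, `|ui t - X k i t| <= 2 * D / 2 ^+ k)) => i.
  apply: (@ex_choice _ _ (fun t l => 0 <= t <= 1 ->
    forall k, `|l - X k i t| <= 2 * D / 2 ^+ k)) => t.
  case: (pselect (0 <= t <= 1)) => ht; last by exists 0.
  have [l hl] := @geometric_limit (fun k => X k i t) D (fun k => geoD k i t ht).
  by exists l.
have cu i : continuous (fun t => u i (clamp01 t)).
  apply: (@uniform_limit_continuous _ (fun k => X k i) (2 * D)) => k t ht; first exact: hu.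
  exact: gX.
(* The uniform limit [u] is so far only continuous. One more step applied to it gives a
   differentiable [x], and [x = u] on [0, 1] because the iterates converge to both. *)
have [x hx] := picard_step cu.
suff xu i t : 0 <= t <= 1 -> x i t = u i t.
  exists x; split; first exact: hx.1.
  by move=> i t ht; have := hx.2 i t ht; under eq_bigr do rewrite -xu //.
move=> ht.
have xX k : `|x i t - X k.+1 i t| <= N * (2 * D) / 2 ^+ k.
  have h0 : x i 0 - X k.+1 i 0 = 0 by rewrite hx.1 (hX.2 k).1 subrr.
  have hg (s : R) : is_derive s 1 (fun s => (N * (2 * D / 2 ^+ k)) * s) (N * (2 * D / 2 ^+ k)).
    by apply: is_derive_eq; rewrite /GRing.scale /= mulr1.
  have := @derive_bound (x i - X k.+1 i)
     (fun s => \sum_j A i j s * u j s - \sum_j A i j s * X k j s) _ _ _ (fun s _ => hg s) _ t ht.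
  rewrite [(_ - _ : R -> R) 0]h0 subr0 mulr0 subr0 => H.
  have D0 : 0 <= N * (2 * D / 2 ^+ k).
    by rewrite mulr_ge0 ?(ltW N0) // divr_ge0 ?exprn_ge0 // mulr_ge0 // mulr_ge0 // expR_ge0.
  apply: le_trans (H _ _) _.
  - move=> s hs; apply: is_deriveB; first exact: (hx.2 i).
    exact: (hX.2 k).2.
  - move=> s hs; rewrite -sumrB; under eq_bigr do rewrite -mulrBr.
    by apply: sum_bound => // j; exact: hu.
  - by rewrite -[leRHS]mulrA ler_piMr //; case/andP: ht.
apply/eqP; rewrite -subr_eq0; apply/eqP.
apply/eqP/negPn/negP; rewrite -normr_gt0 => p.
have [k] := geometric_lt (N * (2 * D) + 2 * D) p.
apply/negP; rewrite -leNgt mulrDl.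
have := hu i t ht k.+1; have := xX k; rewrite exprS.
have -> : 2 * D / (2 * 2 ^+ k) = (2 * D / 2 ^+ k) / 2.
  by field; rewrite expf_neq0 // pnatr_eq0.
rewrite !ler_norml => /andP[a1 a2] /andP[b1 b2].
by apply/andP; lra.
Qed.

End Picard.

Definition is_mxderive m n (X : R -> 'M[R[i]]_(m, n)) (t : R) (L : 'M[R[i]]_(m, n)) : Prop :=
  forall i j, is_cderive (fun u => X u i j) t (L i j).

Lemma complex_linear_ode n (M : R -> 'M[R[i]]_n) (X0 : 'M[R[i]]_n) :
  (forall i j t, ccont (fun u => M u i j) t) ->
  exists X : R -> 'M[R[i]]_n, X 0 = X0 /\
    forall t, 0 <= t <= 1 -> is_mxderive X t (M t *m X t).
Proof.
move=> cM.
(* The underlying real system of twice the size, [true] marking imaginary parts; each column of the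
   unknown matrix is solved separately. *)
pose A (p q : 'I_n * bool) (t : R) : R := let z := M t p.1 q.1 in
  if p.2 then (if q.2 then Re z else Im z) else (if q.2 then - Im z else Re z).
have cA p q : continuous (A p q).
  case: p q => i b [k c] t; have [cr ci] := (continuous_complexP _ _).1 (cM i k t).
  by rewrite /A /=; case: b; case: c => //; exact: (cvgN ci).
have [x hx] : exists x : 'I_n -> 'I_n * bool -> R -> R, forall j,
    (forall p, x j p 0 = (if p.2 then Im (X0 p.1 j) else Re (X0 p.1 j))) /\
    forall p (t : R), 0 <= t <= 1 -> is_derive t 1 (x j p) (\sum_q A p q t * x j q t).
  apply: (@ex_choice _ _ (fun j (xj : 'I_n * bool -> R -> R) =>
    (forall p, xj p 0 = (if p.2 then Im (X0 p.1 j) else Re (X0 p.1 j))) /\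
    forall p (t : R), 0 <= t <= 1 -> is_derive t 1 (xj p) (\sum_q A p q t * xj q t))) => j.
  exact: picard cA.
pose X t := \matrix_(i, j) (x j (i, false) t +i* x j (i, true) t) : 'M[R[i]]_n.
have sumA j p t : \sum_q A p q t * x j q t =
    \sum_k (A p (k, false) t * x j (k, false) t + A p (k, true) t * x j (k, true) t).
  transitivity (\sum_k \sum_c A p (k, c) t * x j (k, c) t).
    by rewrite pair_bigA /=; apply: eq_bigr => -[k c].
  by apply: eq_bigr => k _; rewrite big_bool addrC.
have Re_sum (f : 'I_n -> R[i]) : Re (\sum_k f k) = \sum_k Re (f k).
  exact: (big_morph Re (@ReD R) (erefl _)).
have Im_sum (f : 'I_n -> R[i]) : Im (\sum_k f k) = \sum_k Im (f k).
  exact: (big_morph Im (@ImD R) (erefl _)).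
exists X; split.
  apply/matrixP => i j; rewrite mxE !(hx j).1 /=; exact: ext_complex.
move=> t ht i j; split.
  rewrite (_ : (fun u => _) = x j (i, false)); last by apply/funext => u; rewrite mxE.
  apply: (is_derive_eq ((hx j).2 (i, false) t ht)).
  rewrite sumA mxE Re_sum; apply: eq_bigr => k _.
  by rewrite /A /= mxE ReM /=; ring.
rewrite (_ : (fun u => _) = x j (i, true)); last by apply/funext => u; rewrite mxE.
apply: (is_derive_eq ((hx j).2 (i, true) t ht)).
rewrite sumA mxE Im_sum; apply: eq_bigr => k _.
by rewrite /A /= mxE ImM /=; ring.
Qed.

Lemma complex_antiderivative (f : R -> cplx R) : (forall t, ccont f t) ->
  exists F : R -> cplx R, F 0 = 0 /\ forall t, 0 <= t <= 1 -> is_cderive F t (f t).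
Proof.
move=> cf.
have cr : continuous (fun u => Re (f u)) by move=> t; have [] := (continuous_complexP _ _).1 (cf t).
have ci : continuous (fun u => Im (f u)) by move=> t; have [] := (continuous_complexP _ _).1 (cf t).
have [F [F0 hF]] := antiderivative cr; have [G [G0 hG]] := antiderivative ci.
exists (fun t => F t +i* G t); split; first by rewrite F0 G0.
by move=> t /andP[t0 t1]; split; [apply: hF|apply: hG]; lra.
Qed.

Lemma integral01 (f F : R -> R) : continuous f ->
  (forall t : R, 0 <= t <= 1 -> is_derive t 1 F (f t)) ->
  (\int[lebesgue_measure]_(t in `[0%R, 1%R]) f t)%R = F 1 - F 0.
Proof.
move=> cf hF; rewrite /Rintegral (@continuous_FTC2 _ f F 0 1) //.
- by apply: continuous_subspaceT => x; exact: cf.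
- split.
  + move=> t; rewrite in_itv /= => /andP[t0 t1].
    by have [] := hF t _ => //; lra.
  + apply: cvg_at_right_filter; apply: is_derive_continuous (hF 0 _); lra.
  + apply: cvg_at_left_filter; apply: is_derive_continuous (hF 1 _); lra.
- move=> t; rewrite in_itv /= => /andP[t0 t1]; rewrite derive1E.
  by have [] := hF t _ => //; lra.
Qed.

Lemma cintegral01E (f F : R -> cplx R) : (forall t, ccont f t) ->
  (forall t, 0 <= t <= 1 -> is_cderive F t (f t)) -> cintegral01 f = F 1 - F 0.
Proof.
move=> cf hF.
have cr : continuous (fun u => Re (f u)) by move=> t; have [] := (continuous_complexP _ _).1 (cf t).
have ci : continuous (fun u => Im (f u)) by move=> t; have [] := (continuous_complexP _ _).1 (cf t).
have er := integral01 cr (fun t ht => (hF t ht).1).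
have ei := integral01 ci (fun t ht => (hF t ht).2).
by rewrite /cintegral01; apply: ext_complex; rewrite /= ?er ?ei (ReD, ImD) (ReN, ImN).
Qed.

(** * Energy estimates for the damped and amplified components *)

Definition dotc (z w : R[i]) : R := Re z * Re w + Im z * Im w.

Lemma dotcD z a b : dotc z (a + b) = dotc z a + dotc z b.
Proof. by rewrite /dotc ReD ImD; ring. Qed.

Lemma is_derive_nsq (u : R -> cplx R) t l : is_cderive u t l ->
  is_derive t 1 (fun s => nsq (u s)) (2 * dotc (u t) l).
Proof.
move=> [hr hi]; have := is_deriveD (is_deriveM hr hr) (is_deriveM hi hi).
by move=> H; apply: (is_derive_eq H); rewrite /dotc /GRing.scale /=; ring.
Qed.

Definition cbound (K : R) (b : R[i]) : Prop := `|Re b| <= K /\ `|Im b| <= K.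

(** Of the four products in the expansion, each is at most [K] times the mean of two squares, and
    every square occurs twice. *)
Lemma dotc_le K b w u : cbound K b -> dotc w (b * u) <= K * (nsq w + nsq u).
Proof.
rewrite /cbound !ler_norml => -[/andP[a1 a2] /andP[b1 b2]].
rewrite /dotc /nsq ReM ImM.
have K0 : 0 <= K by lra.
move: (Re b) (Im b) (Re w) (Im w) (Re u) (Im u) a1 a2 b1 b2 => x y p q r s a1 a2 b1 b2.
have h (z v : R) : - K <= z -> z <= K -> z * v <= K * `|v|.
  move=> z1 z2; apply: le_trans (ler_norm _) _; rewrite normrM ler_wpM2r // ler_norml.
  by rewrite z1 z2.
have e (z v : R) : `|z * v| <= (z ^+ 2 + v ^+ 2) / 2.
  rewrite ler_norml; have := sqr_ge0 (z - v); have := sqr_ge0 (z + v).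
  by rewrite sqrrB sqrrD => ? ?; apply/andP; split; lra.
have y1 : - K <= - y by rewrite lerN2.
have y2 : - y <= K by rewrite lerNl.
have := h x (p * r) a1 a2; have := h x (q * s) a1 a2.
have := h y (q * r) b1 b2; have := h (- y) (p * s) y1 y2.
have := ler_wpM2l K0 (e p r); have := ler_wpM2l K0 (e q s).
have := ler_wpM2l K0 (e q r); have := ler_wpM2l K0 (e p s).
lra.
Qed.

Lemma nsqD_le (a b : R[i]) : nsq (a + b) <= 2 * (nsq a + nsq b).
Proof.
rewrite /nsq ReD ImD; have := sqr_ge0 (Re a - Re b); have := sqr_ge0 (Im a - Im b).
by rewrite !sqrrB !sqrrD; lra.
Qed.

Lemma nsq_cbound K b : cbound K b -> nsq b <= 2 * K ^+ 2.
Proof.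
move=> [h1 h2]; rewrite /nsq -[Re b ^+ 2]real_normK ?num_real // -[Im b ^+ 2]real_normK ?num_real //.
have := lerXn2r 2 (normr_ge0 _) (le_trans (normr_ge0 _) h1) h1.
have := lerXn2r 2 (normr_ge0 _) (le_trans (normr_ge0 _) h2) h2.
lra.
Qed.

Lemma nsqC (x : R) : nsq x%:C = x ^+ 2.
Proof. by rewrite /nsq /= expr0n addr0. Qed.

Lemma expRN_le_inv (x : R) : 0 < x -> expR (- x) <= x^-1.
Proof.
move=> x0; rewrite expRN lef_pV2 ?posrE ?expR_gt0 //.
by apply: le_trans (expR_ge1Dx x); rewrite lerDr.
Qed.

(* The energy estimate behind the theorem: the second component is damped at
   rate 1/eta, hence of size O(eta) in square norm, so the first one stays
   constant up to the same order. *)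
Lemma wkb_energy (K m0 : R) : 0 <= K -> 0 < m0 -> exists2 C : R, 0 <= C &
  forall (eta : R) (u w mu b11 b12 b21 b22 : R -> cplx R), 0 < eta <= 1 ->
  (forall t, 0 <= t <= 1 ->
     [/\ cbound K (b11 t), cbound K (b12 t), cbound K (b21 t), cbound K (b22 t)
       & m0 <= Re (mu t)] /\
     (is_cderive u t (eta%:C * (b11 t * u t) + b12 t * w t) /\
      is_cderive w t (- (2 / eta)%:C * (mu t * w t) + b22 t * w t + b21 t * u t))) ->
  nsq (u 0) + nsq (w 0) <= 1 ->
  [/\ nsq (u 1) <= C, nsq (w 1) <= C * eta & w 0 = 0 -> nsq (u 1 - u 0) <= C * eta].
Proof.
move=> K0 m00.
(* Apart from damping, which has the good sign, the derivative of the total energy is at most 2 K (3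
   + 1) times the energy. *)
pose S := expR (8 * K).
have S0 : 0 <= S by exact: expR_ge0.
(* With [kap = 4 * m0 / eta], damping balances forcing when the square norm of [w] is
   [6 * K * S / kap]; the 1 covers the decayed initial value, as [expR (- kap) <= kap^-1]. *)
pose c1 := (6 * K * S + 1) / (4 * m0).
have c10 : 0 <= c1 by rewrite divr_ge0 ?mulr_ge0 ?(ltW m00) // addr_ge0 // mulr_ge0 // mulr_ge0.
(* [C2 * eta] will bound the square norm of the derivative of [u] when [w] starts at 0: one factor 2
   comes from [nsqD_le], the other from [nsq_cbound]. *)
pose C2 := 4 * K ^+ 2 * (S + c1).
have C20 : 0 <= C2 by rewrite /C2 mulr_ge0 ?addr_ge0 // mulr_ge0 // exprn_ge0.
exists (S + c1 + 2 * C2); first by rewrite !addr_ge0 // mulr_ge0.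
move=> eta u w mu b11 b12 b21 b22 /andP[e0 e1] h init.
have t00 : 0 <= (0 : R) <= 1 by rewrite lexx ler01.
have t11 : 0 <= (1 : R) <= 1 by rewrite lexx ler01.
have dotZ (x : R) a b : dotc a (x%:C * b) = x * dotc a b by rewrite /dotc ReM ImM /=; ring.
have dotmu t : 0 <= t <= 1 -> m0 * nsq (w t) <= dotc (w t) (mu t * w t).
  move=> /h [[_ _ _ _ hm] _]; rewrite (_ : dotc _ _ = Re (mu t) * nsq (w t)).
    by rewrite ler_wpM2r // nsq_ge0.
  by rewrite /dotc /nsq ReM ImM; ring.
have cu t : 0 <= t <= 1 ->
    dotc (u t) (eta%:C * (b11 t * u t) + b12 t * w t) <= K * (3 * nsq (u t) + nsq (w t)).
  move=> /h [[h1 h2 _ _ _] _]; rewrite dotcD dotZ.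
  have := dotc_le (u t) (u t) h1; have := dotc_le (u t) (w t) h2.
  have : 0 <= K * (nsq (u t) + nsq (u t)) by rewrite mulr_ge0 // addr_ge0 ?nsq_ge0.
  move: (dotc _ _) (dotc _ _) => x y; nra.
have cw t : 0 <= t <= 1 ->
    dotc (w t) (- (2 / eta)%:C * (mu t * w t) + b22 t * w t + b21 t * u t) <=
    - (2 * m0 / eta) * nsq (w t) + K * (nsq (u t) + 3 * nsq (w t)).
  move=> ht; have := h t ht => -[[_ _ h3 h4 _] _].
  rewrite !dotcD -rmorphN dotZ; have := dotmu t ht.
  have := dotc_le (w t) (w t) h4; have := dotc_le (w t) (u t) h3.
  have : 0 < 2 / eta by rewrite divr_gt0.
  rewrite [2 * m0 / eta]mulrAC.
  move: (dotc _ _) (dotc _ _) (dotc _ _) (2 / eta) => x y z v; nra.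
have E t : 0 <= t <= 1 -> nsq (u t) + nsq (w t) <= S.
  move=> ht.
  have := @gronwall (fun t => nsq (u t) + nsq (w t))
    (fun t => 2 * dotc (u t) (eta%:C * (b11 t * u t) + b12 t * w t) +
              2 * dotc (w t) (- (2 / eta)%:C * (mu t * w t) + b22 t * w t + b21 t * u t)) (8 * K) _ _ t ht.
  move=> H; apply: le_trans (H _ _) _.
  - move=> s /h [_ [hu hw]]; apply: is_deriveD; exact: is_derive_nsq.
  - move=> s hs; have := cu s hs; have := cw s hs.
    have : 0 <= 2 * m0 / eta * nsq (w s).
      by rewrite mulr_ge0 ?nsq_ge0 // divr_ge0 ?(ltW e0) // mulr_ge0 ?(ltW m00).
    lra.
  - have k : expR (8 * K * t) <= S.
      by rewrite ler_expR ler_piMr ?mulr_ge0 //; case/andP: ht.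
    by apply: le_trans k; rewrite ler_piMl ?expR_ge0.
pose kap := 4 * m0 / eta.
have kap0 : 0 < kap by rewrite divr_gt0 // mulr_gt0.
have kapV : kap^-1 = eta / (4 * m0) by rewrite invf_div.
have W t : 0 <= t <= 1 ->
    nsq (w t) <= 6 * K * S / kap + (nsq (w 0) - 6 * K * S / kap) * expR (- kap * t).
  move=> ht.
  have := @gronwall (fun t => nsq (w t) - 6 * K * S / kap)
    (fun t => 2 * dotc (w t) (- (2 / eta)%:C * (mu t * w t) + b22 t * w t + b21 t * u t) - 0) (- kap) _ _ t ht.
  rewrite lerBlDl; apply.
  - move=> s /h [_ [hu hw]]; apply: is_deriveB; exact: is_derive_nsq.
  - move=> s hs; have := cw s hs; have := E s hs.
    have -> : - kap * (nsq (w s) - 6 * K * S / kap) = - (2 * (2 * m0 / eta)) * nsq (w s) + 6 * K * S.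
      by rewrite /kap; field; rewrite !gt_eqF.
    rewrite subr0 => hE hW.
    have := nsq_ge0 (u s); have := nsq_ge0 (w s); move: (nsq (u s)) (nsq (w s)) hE hW => x y hE hW x0 y0.
    have : K * (x + 3 * y) <= 3 * K * S by nra.
    lra.
have c1E : c1 * eta = 6 * K * S * (eta / (4 * m0)) + eta / (4 * m0).
  by rewrite /c1; field; rewrite gt_eqF.
have W1 t : 0 <= t <= 1 -> w 0 = 0 -> nsq (w t) <= c1 * eta.
  move=> ht w0; have := W t ht; rewrite w0 (_ : nsq 0 = 0) ?sub0r; last by rewrite /nsq /= expr0n addr0.
  rewrite kapV c1E.
  have := expR_ge0 (- kap * t).
  have : 0 <= 6 * K * S * (eta / (4 * m0)).
    by rewrite !mulr_ge0 // ?(ltW e0) // invr_ge0 mulr_ge0 // ltW.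
  have : 0 <= eta / (4 * m0) by rewrite divr_ge0 ?(ltW e0) // mulr_ge0 // ltW.
  move: (eta / _) (expR _) (6 * K * S * _) (nsq _) => x y z v.
  nra.
split.
- apply: le_trans (_ : S <= _); first by have := E 1 t11; have := nsq_ge0 (w 1); lra.
  by rewrite -addrA lerDl addr_ge0 // mulr_ge0.
- apply: le_trans (_ : c1 * eta <= _); last first.
    by rewrite ler_wpM2r ?(ltW e0) // addrAC lerDr addr_ge0 // mulr_ge0.
  have := W 1 t11; rewrite mulr1 kapV.
  have := expRN_le_inv kap0; rewrite kapV.
  have := expR_ge0 (- kap).
  have : 0 <= 6 * K * S * (eta / (4 * m0)).
    by rewrite !mulr_ge0 // ?(ltW e0) // invr_ge0 mulr_ge0 // ltW.
  have := nsq_ge0 (u 0); have := nsq_ge0 (w 0).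
  rewrite c1E.
  move: (nsq (w 0)) (nsq (u 0)) init (expR _) (6 * K * S * _) => x y init z v x0 y0 v0 z0 z1.
  nra.
- move=> w0.
  have du t : 0 <= t <= 1 -> nsq (eta%:C * (b11 t * u t) + b12 t * w t) <= C2 * eta.
    move=> ht; have [[h1 h2 _ _ _] _] := h t ht.
    apply: le_trans (nsqD_le _ _) _; rewrite !nsqM nsqC.
    have := nsq_cbound h1; have := nsq_cbound h2; have := E t ht; have := W1 t ht w0.
    have := nsq_ge0 (u t); have := nsq_ge0 (w t); have := nsq_ge0 (b11 t); have := nsq_ge0 (b12 t).
    rewrite /C2; move: (nsq _) (nsq _) (nsq _) (nsq _) => x y z v v0 z0 y0 x0 yc xyS vK zK.
    have h3 : z * x <= 2 * K ^+ 2 * S by apply: ler_pM => //; lra.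
    have h4 : v * y <= 2 * K ^+ 2 * (c1 * eta) by exact: ler_pM.
    have h5 : eta ^+ 2 * (z * x) <= eta * (2 * K ^+ 2 * S).
      apply: ler_pM => //; [exact: exprn_ge0 (ltW e0)|exact: mulr_ge0|].
      by rewrite expr2 ler_piMr // ltW.
    lra.
  have mvt (f df : R -> R) : (forall t : R, 0 <= t <= 1 -> is_derive t 1 f (df t)) ->
      exists2 c, 0 <= c <= 1 & f 1 - f 0 = df c.
    move=> hf; have [x|  |c] := @MVT_segment _ f df 0 1 ler01.
    - by rewrite in_itv /= => /andP[x0 x1]; apply: hf; lra.
    - apply: continuous_in_subspaceT => x; rewrite inE /= in_itv /= => hx.
      exact: is_derive_continuous (hf x hx).
    - by rewrite in_itv /= subr0 mulr1 => hc e; exists c.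
  (* The mean value theorem serves real and imaginary parts at two different times, which costs a
     factor 2. *)
  have [c hc ec] := mvt _ _ (fun t ht => (h t ht).2.1.1).
  have [d hd ed] := mvt _ _ (fun t ht => (h t ht).2.1.2).
  have : nsq (u 1 - u 0) <= 2 * (C2 * eta).
    rewrite /nsq ReD ReN ImD ImN ec ed.
    have := du c hc; have := du d hd; rewrite /nsq.
    move: (eta%:C * _ + _) (eta%:C * _ + _) => p q.
    have := sqr_ge0 (Re p); have := sqr_ge0 (Im p); have := sqr_ge0 (Re q); have := sqr_ge0 (Im q).
    lra.
  move=> H; apply: le_trans H _; rewrite mulrA ler_wpM2r ?(ltW e0) //.
  by rewrite lerDr addr_ge0.
Qed.

End Analysis.

(** * Asymptotics of the trace for the model system *)

Section TraceAsymptotics.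
Variable R : realType.
Local Notation Re := (@complex.Re R).
Local Notation Im := (@complex.Im R).

Lemma cboundD K L (a b : R[i]) : cbound K a -> cbound L b -> cbound (K + L) (a + b).
Proof.
by move=> [h1 h2] [h3 h4]; split; rewrite ?ReD ?ImD; apply: le_trans (ler_normD _ _) _; exact: lerD.
Qed.

Lemma cboundZ K (x : R) (a : R[i]) : `|x| <= 1 -> cbound K a -> cbound K (x%:C * a).
Proof.
move=> x1 [h1 h2]; split; rewrite ?ReM ?ImM /= mul0r ?subr0 ?addr0 normrM;
  by apply: le_trans (_ : 1 * _ <= _); [exact: ler_wpM2r|rewrite mul1r].
Qed.

Lemma cboundN K (a : R[i]) : cbound K a -> cbound K (- a).
Proof. by move=> [h1 h2]; split; rewrite ?ReN ?ImN normrN. Qed.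

Lemma cbound01 (f : R -> cplx R) : (forall t, ccont f t) ->
  exists2 K : R, 0 <= K & forall t, 0 <= t <= 1 -> cbound K (f t).
Proof.
move=> cf.
have cr : continuous (fun u => Re (f u)) by move=> t; have [] := (continuous_complexP _ _).1 (cf t).
have ci : continuous (fun u => Im (f u)) by move=> t; have [] := (continuous_complexP _ _).1 (cf t).
have [K K0 hK] := continuous_bound01 cr; have [L L0 hL] := continuous_bound01 ci.
exists (K + L); first exact: addr_ge0.
move=> t ht; split; [apply: le_trans (hK t ht) _|apply: le_trans (hL t ht) _].
  by rewrite lerDl.
by rewrite lerDr.
Qed.

Lemma cbound_le K L (a : R[i]) : K <= L -> cbound K a -> cbound L a.
Proof. by move=> KL [h1 h2]; split; apply: le_trans KL. Qed.

Lemma cbound01_mx n (M : R -> 'M[R[i]]_n) : (forall i j t, ccont (fun u => M u i j) t) ->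
  exists2 K : R, 0 <= K & forall i j t, 0 <= t <= 1 -> cbound K (M t i j).
Proof.
move=> cM.
have [K hK] : exists K : 'I_n -> 'I_n -> R, forall i j, 0 <= K i j /\
    forall t, 0 <= t <= 1 -> cbound (K i j) (M t i j).
  apply: (@ex_choice _ _ (fun i Ki => forall j, 0 <= Ki j /\
    forall t, 0 <= t <= 1 -> cbound (Ki j) (M t i j))) => i.
  apply: (@ex_choice _ _ (fun j Kij => 0 <= Kij /\
    forall t, 0 <= t <= 1 -> cbound Kij (M t i j))) => j.
  by have [K K0 hK] := cbound01 (cM i j); exists K.
have K0 i : 0 <= \sum_j K i j by rewrite sumr_ge0 // => j _; exact: (hK i j).1.
exists (\sum_i \sum_j K i j); first by rewrite sumr_ge0.
move=> i j t ht; apply: cbound_le ((hK i j).2 t ht).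
rewrite (bigD1 i) //= (bigD1 j) //= -addrA lerDl addr_ge0 //.
  by rewrite sumr_ge0 // => l _; exact: (hK i l).1.
by rewrite sumr_ge0.
Qed.

(** The connection matrix of the family in the moving frame, for epsilon equal to [eta ^+ 2]: the
    three terms come from phi, D and psi. *)
Definition wkb_matrix (mu : R -> cplx R) (M0 Psi : R -> 'M[R[i]]_2) (eta t : R) : 'M[R[i]]_2 :=
  (eta ^- 2)%:C *: (mu t *: delta_mx 0 1) + M0 t + (eta ^+ 2)%:C *: Psi t.

Lemma is_cderive_eq (f : R -> cplx R) t l m : is_cderive f t l -> l = m -> is_cderive f t m.
Proof. by move=> h <-. Qed.

Lemma sum_ord2 (V : nmodType) (f : 'I_2 -> V) : \sum_i f i = f 0 + f 1.
Proof. by rewrite big_ord_recl big_ord1; congr (_ + f _); exact/val_inj. Qed.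

Lemma trace_upper (k q : R[i]) (X : 'M[R[i]]_2) :
  \tr ((k%:M + q *: delta_mx 0 1) *m X) = k * (X 0 0 + X 1 1) + q * X 1 0.
Proof. by rewrite /mxtrace sum_ord2 !mxE !sum_ord2 !mxE /=; ring. Qed.

(** Off-diagonal entries mu / eta^2 and mu have eigenvalues plus and minus mu / eta, whence the
    condition on [M0 t 1 0]. On each eigenline the rest of [M0] acts to leading order by half its
    trace, so [l] is [k] times the exponential of minus half the integral of that trace. *)
Lemma trace_wkb_limit (mu F : R -> cplx R) (M0 Psi : R -> 'M[R[i]]_2) (k q : R[i]) :
  (forall i j t, ccont (fun u => M0 u i j) t) ->
  (forall i j t, ccont (fun u => Psi u i j) t) ->
  (forall t, M0 t 1 0 = mu t) -> (forall t, 0 <= t <= 1 -> 0 < Re (mu t)) ->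
  (forall t, 0 <= t <= 1 -> is_cderive F t (mu t)) -> k != 0 ->
  exists2 l : R[i], l != 0 & exists2 C : R, 0 <= C &
    forall (eta : R) (X : R -> 'M[R[i]]_2), 0 < eta <= 1 -> X 0 = 1%:M ->
    (forall t, 0 <= t <= 1 -> is_mxderive X t (- (wkb_matrix mu M0 Psi eta t *m X t))) ->
    nsq (\tr ((k%:M + q *: delta_mx 0 1) *m X 1)
         * cexp (- ((eta^-1)%:C * (F 1 - F 0))) - l) <= C * eta.
Proof.
move=> cM0 cPsi muE mu0 hF k0.
have t00 : 0 <= (0 : R) <= 1 by rewrite lexx ler01.
have t11 : 0 <= (1 : R) <= 1 by rewrite lexx ler01.
have cmu t : ccont mu t by rewrite (_ : mu = fun u => M0 u 1 0) //; apply/funext.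
have [m0 m00 hm0] : exists2 m0 : R, 0 < m0 & forall t, 0 <= t <= 1 -> m0 <= Re (mu t).
  have cr : continuous (fun u => Re (mu u)) by move=> t; have [] := (continuous_complexP _ _).1 (cmu t).
  have [|c hc hmin] := @EVT_min _ (fun u => Re (mu u)) 0 1 ler01.
    exact: continuous_subspaceT.
  rewrite in_itv /= in hc; exists (Re (mu c)); first exact: mu0.
  by move=> t ht; apply: hmin; rewrite in_itv.
have [K1 K10 hK1] := cbound01_mx cM0; have [K2 K20 hK2] := cbound01_mx cPsi.
pose K := K1 + K2.
have hM i j t : 0 <= t <= 1 -> cbound K (M0 t i j).
  by move=> ht; apply: cbound_le (hK1 i j t ht); rewrite lerDl.
have hP i j t : 0 <= t <= 1 -> cbound K (Psi t i j).
  by move=> ht; apply: cbound_le (hK2 i j t ht); rewrite lerDr.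
have K0 : 0 <= K by exact: addr_ge0.
have [C C0 energy] := @wkb_energy R (7 * K) m0 (mulr_ge0 (ler0n _ 7) K0) m00.
(* The order 0 diagonal coefficient on both eigenlines, with the sign of the equation X' = - M X. *)
pose alpha t : R[i] := - (2^-1)%:C * (M0 t 0 0 + M0 t 1 1).
have calpha t : ccont alpha t.
  apply: ccontinuousM; first exact: ccontinuous_cst.
  by apply: ccontinuousD; exact: cM0.
have [A [A0 hA]] := complex_antiderivative calpha.
pose L0 := cexp (A 1).
exists (L0 * k); first by rewrite mulf_neq0 // cexp_neq0.
pose C' := nsq L0 * (2 * (nsq k * (4 * C) + nsq (q * (2^-1)%:C) * (16 * C))).
exists C'.
  by rewrite /C'; repeat (first [exact: nsq_ge0|exact: C0|exact: ler0n|apply: mulr_ge0|apply: addr_ge0]).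
move=> eta X /andP[e0 e1] X0 hX.
have ee : eta != 0 by rewrite gt_eqF.
(* This factor removes both the growth and the diagonal term from the amplified component, leaving a
   derivative made of O(eta) [u] and O(1) [w]. *)
pose e t : R[i] := cexp (- ((eta^-1)%:C * (F t + - F 0)) + - A t).
have he t : 0 <= t <= 1 -> is_cderive e t (- ((eta^-1)%:C * mu t + alpha t) * e t).
  move=> ht; apply: is_cderive_eq.
    apply: is_cderive_cexp; apply: is_cderiveD; apply: is_cderiveN; last exact: hA.
    apply: is_cderiveM; first exact: is_cderive_cst.
    by apply: is_cderiveD; [exact: hF|exact: is_cderive_cst].
  by rewrite /e; ring.
have e00 : e 0 = 1 by rewrite /e subrr mulr0 A0 oppr0 addr0 cexp0.
pose s i j t := Psi t i j; pose a t := M0 t 0 0; pose b t := M0 t 0 1; pose d t := M0 t 1 1.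
pose h := eta%:C : R[i].
have h0 : h != 0 by rewrite /h fmorph_eq0.
have hV : (eta^-1)%:C = h^-1 by rewrite /h fmorphV.
have hVV : (eta ^- 2)%:C = h ^- 2 by rewrite /h fmorphV rmorphXn.
have two : (2^-1)%:C = 2^-1 :> R[i] by rewrite fmorphV rmorphMn.
have row0 j t : 0 <= t <= 1 -> is_cderive (fun u => X u 0 j) t
    (- ((a t + h ^+ 2 * s 0 0 t) * X t 0 j + (h ^- 2 * mu t + b t + h ^+ 2 * s 0 1 t) * X t 1 j)).
  move=> ht; apply: is_cderive_eq (hX t ht 0 j) _.
  by rewrite !mxE sum_ord2 !mxE /= hVV /a /b /s /h rmorphXn /= mulr0 mulr1 mulr0 add0r.
have row1 j t : 0 <= t <= 1 -> is_cderive (fun u => X u 1 j) t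
    (- ((mu t + h ^+ 2 * s 1 0 t) * X t 0 j + (d t + h ^+ 2 * s 1 1 t) * X t 1 j)).
  move=> ht; apply: is_cderive_eq (hX t ht 1 j) _.
  by rewrite !mxE sum_ord2 !mxE /= muE /d /s /h rmorphXn /= !mulr0 !add0r.
(* x -+ y/eta are the components along the two eigenlines of Phi. *)
pose x c t := (X t 0 0 + c * X t 0 1) * 2^-1 : R[i].
pose y c t := (X t 1 0 + c * X t 1 1) * 2^-1 : R[i].
(* The solution starts at (1, c) / 2: for [c = - h] it is purely amplified ([u] is 1, [w] is 0 at
   time 0), for [c = h] purely damped. *)
pose u c t := e t * (x c t + - h^-1 * y c t).
pose w c t := e t * (x c t + h^-1 * y c t).
have hx c t : 0 <= t <= 1 -> is_cderive (x c) t
    (- ((a t + h ^+ 2 * s 0 0 t) * x c t + (h ^- 2 * mu t + b t + h ^+ 2 * s 0 1 t) * y c t)).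
  move=> ht; apply: is_cderive_eq.
    apply: is_cderiveM; last exact: is_cderive_cst.
    apply: is_cderiveD; first exact: row0.
    by apply: is_cderiveM; [exact: is_cderive_cst|exact: row0].
  by rewrite /x /y; ring.
have hy c t : 0 <= t <= 1 -> is_cderive (y c) t
    (- ((mu t + h ^+ 2 * s 1 0 t) * x c t + (d t + h ^+ 2 * s 1 1 t) * y c t)).
  move=> ht; apply: is_cderive_eq.
    apply: is_cderiveM; last exact: is_cderive_cst.
    apply: is_cderiveD; first exact: row1.
    by apply: is_cderiveM; [exact: is_cderive_cst|exact: row1].
  by rewrite /x /y; ring.
have two0 : (2 : R[i]) != 0 by rewrite pnatr_eq0.
(* All coefficients of the transformed system are signed sums of terms [r n] times an entry of [M0]
   or [Psi], each bounded by [K] as [eta <= 1]. No sum has more than seven terms, hence [7 * K]. *)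
pose r n := (2^-1 * eta ^+ n)%:C : R[i].
have rE n : r n = 2^-1 * h ^+ n by rewrite -two /h -rmorphXn -rmorphM.
have rb n z : cbound K z -> cbound K (r n * z).
  apply: cboundZ; rewrite ger0_norm ?mulr_ge0 ?exprn_ge0 ?invr_ge0 ?(ltW e0) //.
  apply: mulr_ile1; rewrite ?exprn_ge0 ?invr_ge0 ?(ltW e0) //; first by rewrite invf_le1 // ler1n.
  by rewrite exprn_ile1 // ltW.
pose b11 t := - (r 1%N * s 0 0 t) + r 0%N * s 1 0 t + r 0%N * b t + r 2%N * s 0 1 t + - (r 1%N * s 1 1 t).
pose b12 t := - (r 0%N * a t) + - (r 2%N * s 0 0 t) + r 1%N * s 1 0 t + - (r 1%N * b t)
  + - (r 3%N * s 0 1 t) + (r 0%N * d t + r 2%N * s 1 1 t).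
pose b21 t := - (r 0%N * a t) + - (r 2%N * s 0 0 t) + - (r 1%N * s 1 0 t) + r 1%N * b t
  + r 3%N * s 0 1 t + (r 0%N * d t + r 2%N * s 1 1 t).
pose b22 t := - (r 2%N * s 0 0 t) + - (r 1%N * s 1 0 t) + - (r 1%N * b t)
  + - (r 3%N * s 0 1 t) + - (r 2%N * s 1 1 t).
have hbound t : 0 <= t <= 1 -> [/\ cbound (7 * K) (b11 t), cbound (7 * K) (b12 t),
    cbound (7 * K) (b21 t) & cbound (7 * K) (b22 t)].
  move=> ht.
  have hk n i j : cbound K (r n * s i j t) by apply: rb; exact: hP.
  have hl n : cbound K (r n * a t) by apply: rb; exact: hM.
  have hb n : cbound K (r n * b t) by apply: rb; exact: hM.
  have hd n : cbound K (r n * d t) by apply: rb; exact: hM.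
  have K5 : K + K + K + K + K <= 7 * K by lra.
  have K6 : K + K + K + K + K + (K + K) <= 7 * K by lra.
  by split; [apply: cbound_le K5 _|apply: cbound_le K6 _|apply: cbound_le K6 _|apply: cbound_le K5 _];
    repeat (first [apply: cboundD|apply: cboundN|exact: hk|exact: hl|exact: hb|exact: hd]).
have hsys c : nsq (u c 0) + nsq (w c 0) <= 1 ->
    [/\ nsq (u c 1) <= C, nsq (w c 1) <= C * eta & w c 0 = 0 -> nsq (u c 1 - u c 0) <= C * eta].
  apply: (energy eta (u c) (w c) mu b11 b12 b21 b22); first by rewrite e0.
  move=> t ht; split; first by have [? ? ? ?] := hbound t ht; split => //; exact: hm0.
  split.
  - apply: is_cderive_eq.
      apply: is_cderiveM; first exact: he.
      apply: is_cderiveD; first exact: hx.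
      by apply: is_cderiveM; [exact: is_cderive_cst|exact: hy].
    rewrite /u /w /b11 /b12 !rE hV /alpha two -/(a t) -/(d t) -/h.
    by move: (e t) (x c t) (y c t) (a t) (b t) (d t) (s _ _ t) (s _ _ t) (s _ _ t) (s _ _ t) (mu t)
      => v1 v2 v3 v4 v5 v6 v7 v8 v9 v10 v11; field.
  - apply: is_cderive_eq.
      apply: is_cderiveM; first exact: he.
      apply: is_cderiveD; first exact: hx.
      by apply: is_cderiveM; [exact: is_cderive_cst|exact: hy].
    rewrite /u /w /b22 /b21 !rE rmorphM rmorphMn rmorph1 hV /alpha two -/(a t) -/(d t) -/h.
    by move: (e t) (x c t) (y c t) (a t) (b t) (d t) (s _ _ t) (s _ _ t) (s _ _ t) (s _ _ t) (mu t)
      => v1 v2 v3 v4 v5 v6 v7 v8 v9 v10 v11; field.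
have X0E i j : X 0 i j = (i == j)%:R by rewrite X0 mxE.
have u0 c : u c 0 = (1 - h^-1 * c) * 2^-1.
  by rewrite /u /x /y !X0E e00 /=; ring.
have w0 c : w c 0 = (1 + h^-1 * c) * 2^-1.
  by rewrite /w /x /y !X0E e00 /=; ring.
have n1 : nsq (1 : R[i]) = 1 by rewrite /nsq /= expr0n addr0 expr1n.
have n0 : nsq (0 : R[i]) = 0 by rewrite /nsq /= expr0n addr0.
have [|uC1 wC1 /(_ _)] := hsys (- h).
  by rewrite u0 w0 mulrN mulVf // opprK subrr mul0r -mulr2n divff // n1 n0 addr0.
rewrite w0 mulrN mulVf // subrr mul0r => /(_ erefl).
rewrite u0 mulrN mulVf // opprK -mulr2n divff // => uE.
have [|uC2 wC2 _] := hsys h.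
  by rewrite u0 w0 mulVf // subrr mul0r -mulr2n divff // n1 n0 add0r.
(* In the eigenline basis the normalized trace of [X 1] is [u (- h) 1 + w h 1], while its entry 1 0
   carries a factor [h]; so [q] does not affect the limit. *)
have trE : \tr ((k%:M + q *: delta_mx 0 1) *m X 1) * cexp (- ((eta^-1)%:C * (F 1 - F 0))) - L0 * k
   = L0 * (k * ((u (- h) 1 - 1) + w h 1)
           + h * (q * (2^-1)%:C) * (w (- h) 1 + - u (- h) 1 + (w h 1 + - u h 1))).
  have -> : cexp (- ((eta^-1)%:C * (F 1 - F 0))) = L0 * e 1.
    by rewrite /L0 /e -cexpD; congr cexp; ring.
  rewrite trace_upper two /u /w /x /y.
  by move: (X 1 0 0) (X 1 0 1) (X 1 1 0) (X 1 1 1) (e 1) => v1 v2 v3 v4 v5; field.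
have nsqN z : nsq (- z) = nsq z by rewrite /nsq ReN ImN !sqrrN.
have hC : C * eta <= C by rewrite ler_piMr.
have h16 : nsq (w (- h) 1 + - u (- h) 1 + (w h 1 + - u h 1)) <= 16 * C.
  apply: le_trans (nsqD_le _ _) _.
  have := nsqD_le (w (- h) 1) (- u (- h) 1); have := nsqD_le (w h 1) (- u h 1).
  by rewrite !nsqN; lra.
have h4 : nsq (u (- h) 1 - 1 + w h 1) <= 4 * C * eta.
  by apply: le_trans (nsqD_le _ _) _; lra.
rewrite trE nsqM /C' -[leRHS]mulrA; apply: ler_wpM2l; first exact: nsq_ge0.
apply: le_trans (nsqD_le _ _) _; rewrite -[leRHS]mulrA; apply: ler_wpM2l => //.
rewrite [leRHS]mulrDl !nsqM nsqC; apply: lerD.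
  by rewrite -[leRHS]mulrA; apply: ler_wpM2l; first exact: nsq_ge0.
rewrite -[leRHS]mulrA -[leLHS]mulrA mulrCA.
apply: ler_wpM2l; first exact: mulr_ge0 (nsq_ge0 _) (nsq_ge0 _).
rewrite [leRHS]mulrC; apply: ler_pM => //; [exact: exprn_ge0 (ltW e0)|exact: nsq_ge0|].
by rewrite expr2 ler_piMr // ltW.
Qed.

End TraceAsymptotics.

(** * Forms and frames along a closed curve *)

Section CurveCalculus.
Variables (R : realType) (C : closedRiemannSurface R).

Lemma chart_image_open (i : cidx C) (W : set C) :
  open W -> W `<=` dom i -> open (chart i @` W).
Proof.
move=> oW Wi; rewrite openE => _ [p Wp <-]; rewrite /interior.
have dp := Wi _ Wp.
have near_dom : \forall z \near chart i p, (chart i @` dom i) z.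
  by apply: open_nbhs_nbhs; split; [exact: chart_open|exists p].
have near_W : \forall z \near chart i p, W (chart_inv i z).
  apply: (chart_inv_cont dp); rewrite chartK //.
  by apply: open_nbhs_nbhs.
by apply: filterS2 near_dom near_W => _ [x dx <-]; rewrite chartK // => Wx; exists x.
Qed.

Variable g : R -> C.
Hypothesis g_closed : closed_curve g.

Lemma near_curve (W : set C) t : open W -> W (g t) -> \forall u \near t, W (g u).
Proof. by move=> oW Wt; have [cg _ _] := g_closed; apply: cg; exact: open_nbhs_nbhs. Qed.

Lemma chart_curve_C1 (i : cidx C) t : dom i (g t) -> C1at (fun u => chart i (g u)) t.
Proof.
move=> dt; have [_ _ h] := g_closed; split; last by have [] := h i t dt.
by apply: filterS (near_curve (dom_open i) dt) => u /(h i) [].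
Qed.

Lemma velocityP (i : cidx C) t : dom i (g t) ->
  is_cderive (fun u => chart i (g u)) t (velocity i g t).
Proof. by move=> dt; exact: C1at_is_cderive (chart_curve_C1 dt). Qed.

Lemma velocity_continuous (i : cidx C) t : dom i (g t) -> ccont (velocity i g) t.
Proof. by move=> dt; have [] := chart_curve_C1 dt. Qed.

Lemma near_chartK (i : cidx C) t : dom i (g t) ->
  \forall u \near t, chart_inv i (chart i (g u)) = g u.
Proof. by move=> dt; apply: filterS (near_curve (dom_open i) dt) => u; exact: chartK. Qed.

Lemma C1at_along (i : cidx C) (W : set C) m n (F : C -> 'M[R[i]]_(m, n)) t k l :
  open W -> W `<=` dom i -> smooth_in i W F -> W (g t) -> C1at (fun u => F (g u) k l) t.
Proof.
move=> oW Wi sF Wt; have dt := Wi _ Wt.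
apply: (@C1at_near _ (fun u => F (chart_inv i (chart i (g u))) k l)).
  by apply: filterS (near_chartK dt) => u ->.
apply: (C1at_Ck (chart_image_open oW Wi) (sF k l 1%N)); last exact: chart_curve_C1.
by exists (g t).
Qed.

Lemma is_mxderive_along (i : cidx C) (W : set C) m n (F : C -> 'M[R[i]]_(m, n)) t :
  open W -> W `<=` dom i -> smooth_in i W F -> W (g t) ->
  is_mxderive (fun u => F (g u)) t
    (velocity i g t *: dz i F (g t) + conjc (velocity i g t) *: dzb i F (g t)).
Proof.
move=> oW Wi sF Wt k l; have dt := Wi _ Wt.
apply: (@is_cderive_near _ (fun u => F (chart_inv i (chart i (g u))) k l)).
  by apply: filterS (near_chartK dt) => u ->.
apply: is_cderive_eq.
  apply: (is_cderive_Ck (chart_image_open oW Wi) (sF k l 1%N)); last exact: velocityP.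
  by exists (g t).
by rewrite !mxE [_ * velocity _ _ _]mulrC [_ * conjc _]mulrC.
Qed.

Lemma velocity_jac (i j : cidx C) t : dom i (g t) -> dom j (g t) ->
  velocity j g t = jac i j (g t) * velocity i g t.
Proof.
move=> di dj.
have h := is_cderive_holo (chart_holo di dj) (velocityP di).
apply: is_cderiveE; apply: is_cderive_near h.
by apply: filterS (near_chartK di) => u /= ->.
Qed.

Lemma velocity_periodic (i : cidx C) t : velocity i g (t + 1) = velocity i g t.
Proof.
have [_ gp _] := g_closed.
have shift (f : R -> R) : (forall u, f (u + 1) = f u) -> derive1 f (t + 1) = derive1 f t.
  move=> fp; rewrite /derive1.
  rewrite (_ : (fun h : R => h^-1 *: (f (h + (t + 1)) - f (t + 1))) =
    (fun h : R => h^-1 *: (f (h + t) - f t))) //.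
  by apply/funext => h; rewrite addrA !fp.
by rewrite /velocity /cderive; congr (_ +i* _); apply: shift => u; rewrite gp.
Qed.

End CurveCalculus.

Section Pullback.
Variables (R : realType) (C : closedRiemannSurface R) (E : sl2Bundle C).
Variable g : R -> C.
Hypothesis g_closed : closed_curve g.
Local Notation zc a := (fchart (s := E) a).

Lemma conjcM (x y : R[i]) : conjc (x * y) = conjc x * conjc y.
Proof. exact: rmorphM. Qed.

Lemma pullback_end (w : oneForm E) a b t : is_end_form w -> fdom a (g t) -> fdom b (g t) ->
  pullback w g a t *m trans a b (g t) = trans a b (g t) *m pullback w g b t.
Proof.
move=> [_ h] da db; have [h1 h2] := h a b _ da db.
rewrite /pullback /evalf (velocity_jac g_closed (fdom_sub da) (fdom_sub db)).
rewrite mulmxDl mulmxDr -!scalemxAl -!scalemxAr h1 h2 !scalerA conjcM.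
by rewrite ![jac _ _ _ * _]mulrC ![conjc (jac _ _ _) * _]mulrC.
Qed.

Lemma pullback_connection (w : oneForm E) a b t : is_connection w -> fdom a (g t) -> fdom b (g t) ->
  is_mxderive (fun u => trans a b (g u)) t
    (trans a b (g t) *m pullback w g b t - pullback w g a t *m trans a b (g t)).
Proof.
move=> [_ h] da db; have [h1 h2] := h a b _ da db.
have oW : open (fdom a `&` fdom b) by apply: openI; exact: fdom_open.
have Wi : fdom a `&` fdom b `<=` dom (zc a) by move=> p [/fdom_sub].
have := is_mxderive_along g_closed oW Wi (trans_smooth a b) (conj da db).
congr (is_mxderive _ _ _).
rewrite /pullback /evalf (velocity_jac g_closed (fdom_sub da) (fdom_sub db)).
rewrite mulmxDl mulmxDr -!scalemxAl -!scalemxAr h1 h2 !scalerBr !scalerA conjcM.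
rewrite ![jac _ _ _ * _]mulrC ![conjc (jac _ _ _) * _]mulrC /jacE.
set x := _ *: (_ *m fz w b _); set y := _ *: (_ *m fzb w b _).
by rewrite (addrACA x) -opprD opprB [RHS]addrC subrK.
Qed.

Lemma transK (a b : fidx E) p : fdom a p -> fdom b p -> trans a b p *m trans b a p = 1%:M.
Proof. by move=> da db; rewrite trans_cocycle // trans_id. Qed.

End Pullback.

(** * Linear algebra in a fibre of rank 2 *)

Section FibreAlgebra.
Variable F : fieldType.
Implicit Types (A B G : 'M[F]_2) (s u v x : 'cV[F]_2).

Lemma ord2E (i : 'I_2) : i = 0 \/ i = 1.
Proof. by case: i => [[|[|//]] h]; [left|right]; exact/val_inj. Qed.

Lemma matrix2P A B : A 0 0 = B 0 0 -> A 0 1 = B 0 1 -> A 1 0 = B 1 0 -> A 1 1 = B 1 1 -> A = B.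
Proof.
move=> h1 h2 h3 h4; apply/matrixP => i j.
by case: (ord2E i) => ->; case: (ord2E j) => ->.
Qed.

Lemma col2P u v : u 0 0 = v 0 0 -> u 1 0 = v 1 0 -> u = v.
Proof. by move=> h1 h2; apply/colP => i; case: (ord2E i) => ->. Qed.

Definition mk2 u v : 'M[F]_2 := \matrix_(i, j) (if j == 0 then u i 0 else v i 0).

Definition det2 u v : F := u 0 0 * v 1 0 - u 1 0 * v 0 0.

Lemma mulmx_mk2 A u v : A *m mk2 u v = mk2 (A *m u) (A *m v).
Proof. by apply: matrix2P; rewrite !mxE !sum_ord2 !mxE. Qed.

Lemma mk2D u v u' v' : mk2 u v + mk2 u' v' = mk2 (u + u') (v + v').
Proof. by apply: matrix2P; rewrite !mxE. Qed.

(** Cramer's formula written out, so that C^1 regularity of the inverse can be read off the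
    entries. *)
Definition inv2 G : 'M[F]_2 := (G 0 0 * G 1 1 - G 0 1 * G 1 0)^-1 *:
  mk2 (\col_i (if i == 0 then G 1 1 else - G 1 0)) (\col_i (if i == 0 then - G 0 1 else G 0 0)).

Lemma mulmx_inv2 u v : det2 u v != 0 -> mk2 u v *m inv2 (mk2 u v) = 1%:M.
Proof.
rewrite /det2 => h; apply: matrix2P; rewrite !mxE !sum_ord2 !mxE /=; field; move: h;
  by rewrite -mulrC [u 1 0 * _]mulrC.
Qed.

Lemma inv2_mulmx u v : det2 u v != 0 -> inv2 (mk2 u v) *m mk2 u v = 1%:M.
Proof. by move=> /mulmx_inv2 /mulmx1C. Qed.

Lemma det2_eq0 u v : u != 0 -> det2 u v = 0 -> exists c, v = c *: u.
Proof.
move=> u0 /eqP; rewrite subr_eq0 => /eqP h.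
have [a0|a0] := eqVneq (u 0 0) 0.
  have b0 : u 1 0 != 0.
    by apply: contra u0 => /eqP b0; apply/eqP; apply: col2P; rewrite mxE.
  exists (v 1 0 / u 1 0); apply: col2P; rewrite !mxE; last by rewrite divfK.
  by rewrite a0 mulr0; apply/eqP; move: h; rewrite a0 mul0r => /esym/eqP; rewrite mulf_eq0 (negPf b0).
exists (v 0 0 / u 0 0); apply: col2P; rewrite !mxE; first by rewrite divfK.
by rewrite mulrAC [v 0 0 * _]mulrC -h mulrAC divff // mul1r.
Qed.

Lemma mx_eq_on_basis A B u v : det2 u v != 0 -> A *m u = B *m u -> A *m v = B *m v -> A = B.
Proof.
move=> d hu hv; rewrite -[A]mulmx1 -[B]mulmx1 -(mulmx_inv2 d) !mulmxA.
by congr (_ *m _); rewrite !mulmx_mk2 hu hv.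
Qed.

Lemma kernel_line A s x : A != 0 -> s != 0 -> A *m s = 0 -> A *m x = 0 -> exists c, x = c *: s.
Proof.
move=> A0 s0 As Ax; have [d|d] := eqVneq (det2 s x) 0; first exact: det2_eq0.
by case/negP: A0; apply/eqP; apply: (mx_eq_on_basis d); rewrite ?As ?Ax mul0mx.
Qed.

Lemma mulmx_eq0_col A : A != 0 -> exists j : 'I_2, A *m delta_mx j (0 : 'I_1) != 0.
Proof.
move=> A0; have [h0|h0] := eqVneq (A *m delta_mx 0 (0 : 'I_1)) 0; last by exists 0.
have [h1|h1] := eqVneq (A *m delta_mx 1 (0 : 'I_1)) 0; last by exists 1.
case/negP: A0; apply/eqP; apply: (@mx_eq_on_basis _ _ (delta_mx 0 0) (delta_mx 1 0)).
- by rewrite /det2 !mxE /= mulr1 mulr0 subr0 oner_eq0.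
- by rewrite h0 mul0mx.
- by rewrite h1 mul0mx.
Qed.

(* [A + B] is a square root of [m ^+ 2] whose parts interchange two lines, the
   first one being the kernel of the nilpotent part [A]. *)
Section NilpotentPart.
Variables (A B : 'M[F]_2) (m : F) (sigma : 'cV[F]_2).
Hypotheses (m0 : m != 0) (s0 : sigma != 0) (As : A *m sigma = 0) (AA : A *m A = 0).
Hypotheses (BBs : B *m (B *m sigma) = 0) (AB : (A + B) *m (A + B) = (m ^+ 2)%:M).

(** With [A = 0] the square of [B] would be the non-zero scalar [m ^+ 2], although it kills
    [sigma]. *)
Lemma nilpotent_part_neq0 : A != 0.
Proof.
apply/eqP => A0; move: AB; rewrite A0 add0r => /(congr1 (mulmx^~ sigma)).
rewrite -mulmxA BBs mul_scalar_mx => /esym/eqP; rewrite scaler_eq0 expf_eq0 /=.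
by rewrite (negPf m0) (negPf s0).
Qed.

Variable v : 'cV[F]_2.
Hypothesis Av : A *m v != 0.
Let s := m^-1 *: (A *m v).

(** As [A] squares to 0, its image lies in its kernel, which is the line of [sigma]. *)
Lemma image_line : exists2 c, c != 0 & s = c *: sigma.
Proof.
have [|c hc] := kernel_line nilpotent_part_neq0 s0 As (x := A *m v).
  by rewrite mulmxA AA mul0mx.
exists (m^-1 * c); last by rewrite /s hc scalerA.
rewrite mulf_neq0 ?invr_eq0 //; apply: contra Av => /eqP c0.
by rewrite hc c0 scale0r.
Qed.

Lemma image_neq0 : s != 0.
Proof. by rewrite scaler_eq0 invr_eq0 (negPf m0) (negPf Av). Qed.

Lemma kernel_image : A *m s = 0.
Proof. by rewrite -scalemxAr mulmxA AA mul0mx scaler0. Qed.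

Lemma det2_frame : det2 s v != 0.
Proof.
apply/eqP => /(det2_eq0 image_neq0) [c vE]; case/negP: Av.
by rewrite vE -scalemxAr kernel_image scaler0.
Qed.

Lemma mul_nilpotent_frame : A *m mk2 s v = mk2 s v *m (m *: delta_mx 0 1).
Proof.
rewrite mulmx_mk2 kernel_image (_ : A *m v = m *: s); last by rewrite /s scalerA divff // scale1r.
by generalize s => w; apply: matrix2P; rewrite !mxE !sum_ord2 !mxE /=; ring.
Qed.

(** On [s] the square of [A + B] reduces to [A B], so [A] sends both [B s] and [m v] to
    [m ^+ 2 *: s]; their difference lies in the kernel of [A], the line of [s]. *)
Lemma other_part_image : exists k, B *m s = m *: v + k *: s.
Proof.
have [c c0 sE] := image_line.
have BBs' : B *m (B *m s) = 0 by rewrite sE -!scalemxAr BBs scaler0.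
have h : A *m (B *m s) = m ^+ 2 *: s.
  have := congr1 (mulmx^~ s) AB.
  have Ns : (A + B) *m s = B *m s by rewrite mulmxDl kernel_image add0r.
  by rewrite -mulmxA mul_scalar_mx Ns mulmxDl BBs' addr0.
have [|k hk] := kernel_line nilpotent_part_neq0 image_neq0 kernel_image (x := B *m s - m *: v).
  by rewrite mulmxBr h -scalemxAr /s scalerA expr2 mulfK // subrr.
by exists k; rewrite -hk addrC subrK.
Qed.

End NilpotentPart.

End FibreAlgebra.

(** * Entrywise calculus of matrix valued functions *)

Section MatrixCalculus.
Variable R : realType.

Definition C1mx m n (X : R -> 'M[R[i]]_(m, n)) (t : R) : Prop :=
  forall i j, C1at (fun u => X u i j) t.

Definition ccmx (T : topologicalType) m n (X : T -> 'M[R[i]]_(m, n)) (t : T) : Prop :=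
  forall i j, ccont (fun u => X u i j) t.

Lemma is_mxderiveM m n p (X : R -> 'M[R[i]]_(m, n)) (Y : R -> 'M[R[i]]_(n, p)) t L L' :
  is_mxderive X t L -> is_mxderive Y t L' ->
  is_mxderive (fun u => X u *m Y u) t (L *m Y t + X t *m L').
Proof.
move=> hX hY i j.
rewrite (_ : (fun u => _) = fun u => \sum_k X u i k * Y u k j); last first.
  by apply/funext => u; rewrite mxE.
apply: is_cderive_eq.
  by apply: is_cderive_sum => k; apply: is_cderiveM; [exact: hX|exact: hY].
by rewrite !mxE -big_split.
Qed.

Lemma is_mxderive_cst m n (A : 'M[R[i]]_(m, n)) t : is_mxderive (fun=> A) t 0.
Proof. by move=> i j; rewrite mxE; exact: is_cderive_cst. Qed.

Lemma is_mxderive_near m n (X Y : R -> 'M[R[i]]_(m, n)) t L :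
  (\forall u \near t, X u = Y u) -> is_mxderive X t L -> is_mxderive Y t L.
Proof.
by move=> XY h i j; apply: is_cderive_near (h i j); apply: filterS XY => u ->.
Qed.

Lemma is_mxderiveE m n (X : R -> 'M[R[i]]_(m, n)) t L : is_mxderive X t L -> mxderive X t = L.
Proof. by move=> h; apply/matrixP => i j; rewrite mxE; exact: is_cderiveE. Qed.

Lemma is_mxderive_mxderivable m n (X : R -> 'M[R[i]]_(m, n)) t L :
  is_mxderive X t L -> mxderivable X t.
Proof. by move=> h i j; exact: is_cderive_cderivable (h i j). Qed.

Lemma mxderivableP m n (X : R -> 'M[R[i]]_(m, n)) t :
  mxderivable X t -> is_mxderive X t (mxderive X t).
Proof. by move=> h i j; rewrite mxE; exact: cderivableP. Qed.

Lemma is_mxderive_uniq m n (X : R -> 'M[R[i]]_(m, n)) t L L' :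
  is_mxderive X t L -> is_mxderive X t L' -> L = L'.
Proof. by move=> /is_mxderiveE <- /is_mxderiveE. Qed.

Lemma C1mx_is_mxderive m n (X : R -> 'M[R[i]]_(m, n)) t : C1mx X t -> is_mxderive X t (mxderive X t).
Proof. by move=> h i j; rewrite mxE; exact: C1at_is_cderive. Qed.

Lemma C1mx_ccmx m n (X : R -> 'M[R[i]]_(m, n)) t : C1mx X t -> ccmx X t.
Proof. by move=> h i j; exact: C1at_continuous. Qed.

Lemma C1mx_derive_ccmx m n (X : R -> 'M[R[i]]_(m, n)) t : C1mx X t -> ccmx (mxderive X) t.
Proof.
move=> h i j; have [_ c] := h i j.
by apply: ccontinuous_near c; apply: filterE => u; rewrite mxE.
Qed.

Lemma C1mx_near m n (X Y : R -> 'M[R[i]]_(m, n)) t :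
  (\forall u \near t, X u = Y u) -> C1mx X t -> C1mx Y t.
Proof.
by move=> XY h i j; apply: C1at_near (h i j); apply: filterS XY => u ->.
Qed.

Lemma ccmx_near (T : topologicalType) m n (X Y : T -> 'M[R[i]]_(m, n)) t :
  (\forall u \near t, X u = Y u) -> ccmx X t -> ccmx Y t.
Proof.
by move=> XY h i j; apply: ccontinuous_near (h i j); apply: filterS XY => u ->.
Qed.

Lemma C1mxM m n p (X : R -> 'M[R[i]]_(m, n)) (Y : R -> 'M[R[i]]_(n, p)) t :
  C1mx X t -> C1mx Y t -> C1mx (fun u => X u *m Y u) t.
Proof.
move=> hX hY i j; rewrite (_ : (fun u => _) = fun u => \sum_k X u i k * Y u k j); last first.
  by apply/funext => u; rewrite mxE.
by apply: C1at_sum => k; apply: C1atM; [exact: hX|exact: hY].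
Qed.

Lemma ccmxM (T : topologicalType) m n p (X : T -> 'M[R[i]]_(m, n)) (Y : T -> 'M[R[i]]_(n, p)) t :
  ccmx X t -> ccmx Y t -> ccmx (fun u => X u *m Y u) t.
Proof.
move=> hX hY i j; rewrite (_ : (fun u => _) = fun u => \sum_k X u i k * Y u k j); last first.
  by apply/funext => u; rewrite mxE.
by apply: ccontinuous_sum => k; apply: ccontinuousM; [exact: hX|exact: hY].
Qed.

Lemma C1mxD m n (X Y : R -> 'M[R[i]]_(m, n)) t :
  C1mx X t -> C1mx Y t -> C1mx (fun u => X u + Y u) t.
Proof.
move=> hX hY i j; rewrite (_ : (fun u => _) = fun u => X u i j + Y u i j).
  by apply: C1atD; [exact: hX|exact: hY].
by apply/funext => u; rewrite mxE.
Qed.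

Lemma ccmxD (T : topologicalType) m n (X Y : T -> 'M[R[i]]_(m, n)) t :
  ccmx X t -> ccmx Y t -> ccmx (fun u => X u + Y u) t.
Proof.
move=> hX hY i j; rewrite (_ : (fun u => _) = fun u => X u i j + Y u i j).
  by apply: ccontinuousD; [exact: hX|exact: hY].
by apply/funext => u; rewrite mxE.
Qed.

Lemma C1mxZ m n (f : R -> cplx R) (X : R -> 'M[R[i]]_(m, n)) t :
  C1at f t -> C1mx X t -> C1mx (fun u => f u *: X u) t.
Proof.
move=> hf hX i j; rewrite (_ : (fun u => _) = fun u => f u * X u i j).
  by apply: C1atM; [exact: hf|exact: hX].
by apply/funext => u; rewrite mxE.
Qed.

Lemma ccmxZ (T : topologicalType) m n (f : T -> cplx R) (X : T -> 'M[R[i]]_(m, n)) t :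
  ccont f t -> ccmx X t -> ccmx (fun u => f u *: X u) t.
Proof.
move=> hf hX i j; rewrite (_ : (fun u => _) = fun u => f u * X u i j).
  by apply: ccontinuousM; [exact: hf|exact: hX].
by apply/funext => u; rewrite mxE.
Qed.

Lemma C1mx_cst m n (A : 'M[R[i]]_(m, n)) t : C1mx (fun=> A) t.
Proof. by move=> i j; exact: C1at_cst. Qed.

Lemma C1mx_mk2 (s v : R -> 'cV[R[i]]_2) t : C1mx s t -> C1mx v t -> C1mx (fun u => mk2 (s u) (v u)) t.
Proof.
move=> hs hv i j; case: (ord2E j) => ->.
  rewrite (_ : (fun u => _) = fun u => s u i 0) //; last by apply/funext => u; rewrite mxE.
rewrite (_ : (fun u => _) = fun u => v u i 0) //; last by apply/funext => u; rewrite mxE.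
Qed.

Lemma C1mx_inv2 (G : R -> 'M[R[i]]_2) t :
  G t 0 0 * G t 1 1 - G t 0 1 * G t 1 0 != 0 -> C1mx G t -> C1mx (fun u => inv2 (G u)) t.
Proof.
move=> d hG; apply: C1mxZ.
  apply: C1atV => //; apply: C1atD; first by apply: C1atM.
  by apply: C1atN; apply: C1atM.
apply: C1mx_mk2 => i j.
  by case: (ord2E i) => -> /=; [apply: C1at_near (hG 1 1)|apply: C1at_near (C1atN (hG 1 0))];
    apply: filterE => u; rewrite mxE.
by case: (ord2E i) => -> /=; [apply: C1at_near (C1atN (hG 0 1))|apply: C1at_near (hG 0 0)];
  apply: filterE => u; rewrite mxE.
Qed.

End MatrixCalculus.

(** * Continuous square roots, gluing in time, and coverings of [0, 1] *)

Section ScalarRoots.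
Variable R : realType.
Local Notation Re := (@complex.Re R).
Local Notation Im := (@complex.Im R).

Lemma sqr_inj_Re (x y : R[i]) : 0 < Re x -> 0 < Re y -> x ^+ 2 = y ^+ 2 -> x = y.
Proof.
move=> hx hy /eqP; rewrite eqf_sqr => /orP[/eqP //|/eqP e].
by move: hx; rewrite e ReN oppr_gt0 => /(lt_trans hy); rewrite ltxx.
Qed.

(** Divide the difference of the squares by [f u + f t], whose modulus is at least the real part of
    [f t]. *)
Lemma ccont_sqrt (f h : R -> cplx R) (t : R) : (forall u, 0 < Re (f u)) ->
  (\forall u \near t, f u ^+ 2 = h u) -> ccont h t -> ccont f t.
Proof.
move=> fp fh ch; apply/(@cvgrPdist_lt _ _ _ (nbhs t)) => e e0.
have r0 : 0 < (Re (f t))%:C :> R[i] by rewrite ltcR.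
have /(@cvgrPdist_lt _ _ _ (nbhs t)) /(_ (e * (Re (f t))%:C)) := ch.
rewrite mulr_gt0 // => /(_ isT).
have fht := nbhs_singleton fh.
apply: filterS2 fh => u fhu; rewrite -fht -fhu subr_sqr normrM => H.
rewrite -(ltr_pM2r r0); apply: le_lt_trans H; apply: ler_wpM2l => //.
apply: le_trans (normc_ge_Re _); rewrite lecR ReD; apply: le_trans (ler_norm _).
by rewrite lerDl ltW.
Qed.

Lemma square_char_poly (N : 'M[R[i]]_2) (m : R[i]) :
  char_poly N = ('X - m%:P) * ('X + m%:P) -> N *m N = (m ^+ 2)%:M.
Proof.
move=> h; have := Cayley_Hamilton N; rewrite h rmorphM /= rmorphB rmorphD /= horner_mx_X horner_mx_C.
move=> H; have : (N - m%:M) *m (N + m%:M) = 0 by exact: H.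
rewrite mulmxBl !mulmxDr mul_mx_scalar !mul_scalar_mx scale_scalar_mx => /eqP.
by rewrite opprD addrA addrK subr_eq0 expr2 => /eqP.
Qed.

Lemma col_neq0 (F : fieldType) (x : 'cV[F]_2) : x != 0 -> exists i, x i 0 != 0.
Proof.
move=> x0; apply: contrapT => H; case/negP: x0; apply/eqP/colP => i; rewrite mxE.
by apply/eqP/negPn/negP => hi; apply: H; exists i.
Qed.

Lemma ccont_glue (f h : R -> cplx R) (t : R) : f t = h t -> ccont f t -> ccont h t ->
  ccont (fun u => if u < t then f u else h u) t.
Proof.
move=> fh cf ch; rewrite /ccont /prop_for /continuous_at ltxx; apply/cvgrPdist_lt => e e0.
have /cvgrPdist_lt /(_ e e0) h1 := cf; have /cvgrPdist_lt /(_ e e0) h2 := ch.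
by apply: filterS2 h1 h2 => z; rewrite fh; case: ifP.
Qed.

Lemma C1at_glue (f h : R -> cplx R) (t : R) : f t = h t -> cderive f t = cderive h t ->
  C1at f t -> C1at h t -> C1at (fun u => if u < t then f u else h u) t.
Proof.
move=> fh dfh /C1atP [hf cf] /C1atP [hh ch].
apply: (@C1atI _ _ (fun u => if u < t then cderive f u else cderive h u)); last exact: ccont_glue.
apply: filterS2 hf hh => u hfu hhu; case: (ltgtP u t) => ut.
- apply: is_cderive_near hfu.
  have : \forall z \near u, z < t by exact: lt_nbhsl.
  by apply: filterS => z ->.
- apply: is_cderive_near hhu.
  have : \forall z \near u, t < z by exact: lt_nbhsr.
  by apply: filterS => z zt; rewrite ltNge (ltW zt).
- by rewrite ut in hfu hhu *; apply: is_cderive_glue => //; rewrite -dfh.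
Qed.

End ScalarRoots.

(** Compactness of [0, 1] as a supremum argument: the left end stays fixed and the right end is
    pushed on. A piece around the supremum overlaps one that nearly reaches it, so the supremum is
    passed unless it is 1. Gluing happens at a point interior to both pieces. *)
Lemma interval_covering (R : realType) (P : R -> R -> Prop) :
  (forall t, exists2 d : R, 0 < d & P (t - d) (t + d)) ->
  (forall x y x' y' b, P x y -> P x' y' -> x < b < y -> x' < b < y' -> P x y') ->
  exists d d' : R, [/\ 0 < d, 0 < d' & P (- d) (1 + d')].
Proof.
move=> loc glue.
have [d0 d00 P0] := loc 0; rewrite sub0r add0r in P0.
pose A : set R := [set x | 0 <= x <= 1 /\ exists2 d : R, 0 < d & P (- d0) (x + d)].
have A0 : A 0 by split; [rewrite lexx ler01|exists d0; rewrite ?add0r].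
have uA : has_ubound A by exists 1 => x [/andP[]].
pose y := sup A.
have y1 : y <= 1 by apply: ge_sup; [exists 0|move=> x [/andP[]]].
have y0 : 0 <= y by exact: ub_le_sup.
have [d d_gt0 Py] := loc y.
have [x [/andP[x0 x1] [d' d'0 Px]] xy] : exists2 x, A x & y - d < x.
  by apply: sup_gt; [exists 0|rewrite ltrBlDr ltrDl].
have x_le : x <= y by apply: ub_le_sup => //; split; [rewrite x0 x1|exists d'].
have Q : P (- d0) (y + d).
  by apply: (glue _ _ _ _ x Px Py); apply/andP; split; lra.
have [y_lt1|] := ltP y 1; last first.
  move=> y_ge1; have e : y = 1 by apply/eqP; rewrite eq_le y1.
  by rewrite e in Q; exists d0, d.
pose z := Num.min 1 (y + d / 2).
have Az : A z.
  split; first by rewrite /z le_min ge_min lexx ler01 /= addr_ge0 // divr_ge0 // ltW.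
  exists (y + d - z); last by rewrite addrC subrK.
  by rewrite subr_gt0 /z gt_min; apply/orP; right; lra.
have : z <= y by exact: ub_le_sup.
by rewrite /z ge_min => /orP[]; lra.
Qed.

Lemma shuffle_identity (V : zmodType) (x a b p q : V) :
  x - (a + b) = p + q -> p + a + (q + b) = x.
Proof. by move=> e; rewrite addrACA -e subrK. Qed.

Lemma is_mxderiveD (R : realType) k n (X Y : R -> 'M[R[i]]_(k, n)) t L L' :
  is_mxderive X t L -> is_mxderive Y t L' -> is_mxderive (fun u => X u + Y u) t (L + L').
Proof.
move=> hX hY i j; rewrite (_ : (fun u => _) = fun u => X u i j + Y u i j).
  by rewrite mxE; apply: is_cderiveD; [exact: hX|exact: hY].
by apply/funext => u; rewrite mxE.
Qed.

Lemma intertwine_sum (F : comRingType) (T : 'M[F]_2) (k n : F) (x x' y y' : 'cV[F]_2) :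
  x = T *m x' -> y = T *m y' -> k *: x + n *: y = T *m (k *: x' + n *: y').
Proof. by move=> -> ->; rewrite mulmxDr !scalemxAr. Qed.

Lemma mulmx_sum_neq0 (F : fieldType) (A : 'M[F]_2) (k n : F) (x y : 'cV[F]_2) :
  k != 0 -> A *m x != 0 -> A *m y = 0 -> A *m (k *: x + n *: y) != 0.
Proof.
move=> k0 x0 y0; rewrite mulmxDr -!scalemxAr y0 scaler0 addr0.
by rewrite scaler_eq0 (negPf x0) orbF.
Qed.

Lemma mk2_minor (F : fieldType) (u v : 'cV[F]_2) :
  mk2 u v 0 0 * mk2 u v 1 1 - mk2 u v 0 1 * mk2 u v 1 0 = det2 u v.
Proof. by rewrite !mxE /= /det2 [u 1 0 * _]mulrC. Qed.

Lemma inv2_mk2_entry (F : fieldType) (u v w : 'cV[F]_2) (x k : F) : det2 u v != 0 ->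
  (inv2 (mk2 u v) *m mk2 (x *: v + k *: u) w) 1 0 = x.
Proof.
move=> d; have := inv2_mulmx d; rewrite !mulmx_mk2 => /matrixP H.
have h0 := H 1 0; have h1 := H 1 1; rewrite !mxE /= in h0 h1.
rewrite [LHS]mxE /= mulmxDr -!scalemxAr [LHS]mxE [X in X + _]mxE [X in _ + X]mxE.
by rewrite [X in _ * X + _]mxE [X in _ + _ * X]mxE h0 h1 mulr1 mulr0 addr0.
Qed.

Lemma mxderive_mk2 (R : realType) (u v : R -> 'cV[R[i]]_2) t : C1mx u t -> C1mx v t ->
  mxderive (fun z => mk2 (u z) (v z)) t = mk2 (mxderive u t) (mxderive v t).
Proof.
move=> cu cv; apply: is_mxderiveE => i j; case: (ord2E j) => ->; rewrite !mxE /=.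
  rewrite (_ : (fun z => _) = fun z => u z i 0); last by apply/funext => z; rewrite mxE.
  exact: C1at_is_cderive.
rewrite (_ : (fun z => _) = fun z => v z i 0); last by apply/funext => z; rewrite mxE.
exact: C1at_is_cderive.
Qed.

Lemma leibniz_identity (F : comRingType) (r' r w w' d : F) (x y p q : 'cV[F]_2) :
  r' *: x + r *: (w *: (d *: x + y - p) + w' *: - q) + (w *: (r *: p) + w' *: (r *: q))
  = (r' + r * w * d) *: x + w *: (r *: y).
Proof. by apply/colP => j; rewrite !mxE; ring. Qed.

Lemma scaler_sum_identity (F : comRingType) (V : lmodType F) (v w : F) (x y z t : V) :
  v *: (x + y) + w *: (z + t) = (v *: y + w *: t) + (v *: x + w *: z).
Proof. by rewrite !scalerDr addrACA addrC. Qed.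

Lemma intertwine_scale (F : comRingType) (A T B : 'M[F]_2) (c : F) (x y : 'cV[F]_2) :
  A *m T = T *m B -> x = T *m y -> c *: (A *m x) = T *m (c *: (B *m y)).
Proof. by move=> e ->; rewrite mulmxA e -mulmxA scalemxAr. Qed.

(* In such a frame D_epsilon becomes [wkb_matrix]: the lower left entry of D is the
   second fundamental form of ker phi, i.e. the part of Phi complementary to phi. *)
Definition wkb_frame (R : realType) (C : closedRiemannSurface R) (E : sl2Bundle C)
    (phi D : oneForm E) (g : R -> C) (m : R -> cplx R)
    (G : fidx E -> R -> 'M[R[i]]_2) (x y : R) : Prop :=
  forall t a, x < t < y -> fdom a (g t) ->
    [/\ C1mx (G a) t, G a t 0 0 * G a t 1 1 - G a t 0 1 * G a t 1 0 != 0,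
      pullback phi g a t *m G a t = G a t *m (m t *: delta_mx 0 1),
      (inv2 (G a t) *m (mxderive (G a) t + pullback D g a t *m G a t)) 1 0 = m t
    & forall b, fdom b (g t) -> G a t = trans a b (g t) *m G b t].

(** * The moving frame adapted to the kernel of phi *)

Section Geometry.
Variables (R : realType) (C : closedRiemannSurface R) (E : sl2Bundle C).
Variables (dbar : fidx E -> C -> 'M[R[i]]_2) (phi D Am1 A1 D' Phi : oneForm E).
Variables (h : fidx E -> C -> 'M[R[i]]_2) (L1 : fibrewise E).
Local Notation addf := Defs.addf.
Local Notation orthogonal := Defs.orthogonal.
Hypotheses (metric : hermitian_metric h) (kerL1 : kernel_subbundle dbar phi L1).
Hypotheses (phi_end : is_end_form phi) (phi10 : type10 phi) (phi_nil : nilpotent2 phi).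
Hypothesis D_dbar : forall a p, fdom a p -> fzb D a p = dbar a p.
Hypothesis (dec : decomposition L1 (orthogonal h L1) D A1 D' Am1).
Hypothesis (PhiE : eqf Phi (addf Am1 phi)).
Local Notation zc a := (fchart (s := E) a).

Lemma orthogonal_meet a p x : fdom a p -> L1 a p x -> orthogonal h L1 a p x -> x = 0.
Proof.
move=> da hx ox; have [_ _ _ pos _] := metric.
apply/eqP/negPn/negP => x0; have := pos a p x da x0.
by rewrite (ox x hx) mxE ltxx.
Qed.

Lemma adjZ (c : R[i]) (x : 'cV[R[i]]_2) : adj (c *: x) = conjc c *: adj x.
Proof. by apply/matrixP => i j; rewrite !mxE conjcM. Qed.

Lemma orthogonal_complement a p (x : 'cV[R[i]]_2) : fdom a p -> x != 0 ->
  L1 a p = [set c *: x | c in [set: R[i]]] ->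
  exists y, orthogonal h L1 a p y /\ det2 x y != 0.
Proof.
move=> da x0 LE; have [_ _ _ pos _] := metric.
pose r := adj x *m h a p.
(* The row [r] is the pairing with [x]. Turned by a right angle it gives a vector killed by [r], and
   [det2] of [x] with it is the pairing of [x] with itself. *)
exists (\col_i (if i == 0 then - r 0 1 else r 0 0)); split.
  move=> u; rewrite LE => -[c _ <-]; rewrite adjZ -!scalemxAl -/r.
  by apply/matrixP => i j; rewrite !ord1 !mxE sum_ord2 !mxE /=; ring.
have := pos a p x da x0; rewrite -/r mxE sum_ord2 => H.
rewrite /det2 ![(\col__ _) _ _]mxE /= (_ : _ - _ = r 0 0 * x 0 0 + r 0 1 * x 1 0); last by ring.
by rewrite gt_eqF.
Qed.

Lemma line_section p : exists W s, [/\ open W, W p, holo_section dbar W s, values_in L1 W s &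
  forall a x, W x -> fdom a x -> s a x != 0 /\ L1 a x = [set c *: s a x | c in [set: R[i]]]].
Proof.
have [hol _] := kerL1; have [W [s [oW Wp hs hL]]] := hol p.
exists W, s; split => // a x Wx dx; have [_ ->] := hL a x Wx dx.
by exists 1 => //; rewrite scale1r.
Qed.

Lemma D_parts a p : fdom a p ->
  fz D a p = fz A1 a p + fz D' a p + fz Am1 a p /\
  fzb D a p = fzb A1 a p + fzb D' a p + fzb Am1 a p.
Proof. by move=> da; have [hD _ _ _ _] := dec; exact: hD a p da. Qed.

Lemma A1_line a p x : fdom a p -> L1 a p x -> fz A1 a p *m x = 0 /\ fzb A1 a p *m x = 0.
Proof. by move=> da hx; have [_ [_ _ k] _ _ _] := dec; exact: k a p x da hx. Qed.

Lemma Am1_line a p x : fdom a p -> L1 a p x ->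
  orthogonal h L1 a p (fz Am1 a p *m x) /\ orthogonal h L1 a p (fzb Am1 a p *m x).
Proof. by move=> da hx; have [_ _ [_ k _] _ _] := dec; exact: k a p x da hx. Qed.

Lemma Am1_orthogonal a p x : fdom a p -> orthogonal h L1 a p x ->
  fz Am1 a p *m x = 0 /\ fzb Am1 a p *m x = 0.
Proof. by move=> da hx; have [_ _ [_ _ k] _ _] := dec; exact: k a p x da hx. Qed.

(* The second fundamental form of the holomorphic line L1 has type (1,0). *)
Lemma Am1_type10 a p : fdom a p -> fzb Am1 a p = 0.
Proof.
move=> da; have [W [s [oW Wp [ss hs] vs hL]]] := line_section p.
have [s0 LE] := hL a p Wp da.
have Ls := vs a p Wp da.
have [y [oy dy]] := orthogonal_complement da s0 LE.
apply: (mx_eq_on_basis dy); rewrite mul0mx; last exact: (Am1_orthogonal da oy).2.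
(* Holomorphy of the generator [s] makes [Am1 s] the opposite of the (0,1) derivative of [s] along
   [D'], which lies in L1; but [Am1 s] is also orthogonal to L1. *)
apply: (orthogonal_meet da); last exact: (Am1_line da Ls).2.
have [_ _ _ _ [pres _]] := dec.
have [_] := pres W s oW ss vs a p Wp da; rewrite LE => -[c _ hc].
exists (- c) => //; rewrite scaleNr hc.
have := hs a p Wp da; rewrite -D_dbar // (D_parts da).2 !mulmxDl (A1_line da Ls).2 add0r addrA.
by move/eqP; rewrite addr_eq0 => /eqP ->; rewrite opprK.
Qed.

Variable g : R -> C.
Hypothesis g_closed : closed_curve g.

Lemma pullback_phi a t : fdom a (g t) ->
  pullback phi g a t = velocity (zc a) g t *: fz phi a (g t).
Proof. by move=> da; rewrite /pullback /evalf phi10 // scaler0 addr0. Qed.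

Lemma pullback_Am1 a t : fdom a (g t) ->
  pullback Am1 g a t = velocity (zc a) g t *: fz Am1 a (g t).
Proof. by move=> da; rewrite /pullback /evalf Am1_type10 // scaler0 addr0. Qed.

Lemma pullback_Phi a t : fdom a (g t) ->
  pullback Phi g a t = pullback phi g a t + pullback Am1 g a t.
Proof.
move=> da; rewrite /pullback /evalf; have [-> ->] := PhiE da.
exact: scaler_sum_identity.
Qed.

Lemma pullback_phi_line a t x : fdom a (g t) -> L1 a (g t) x -> pullback phi g a t *m x = 0.
Proof.
move=> da hx; rewrite pullback_phi // -scalemxAl; have [_ k] := kerL1.
by rewrite k // scaler0.
Qed.

Lemma pullback_phi_sqr a t : fdom a (g t) -> pullback phi g a t *m pullback phi g a t = 0.
Proof. by move=> da; exact: phi_nil. Qed.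

Lemma pullback_Am1_line a t x : fdom a (g t) -> L1 a (g t) x ->
  pullback Am1 g a t *m (pullback Am1 g a t *m x) = 0.
Proof.
move=> da hx; rewrite pullback_Am1 // -!scalemxAl -scalemxAr.
have [-> _] := Am1_orthogonal da (Am1_line da hx).1.
by rewrite !scaler0.
Qed.

Variable m : R -> cplx R.
Hypothesis m_Re : forall t, 0 < complex.Re (m t).
Hypothesis m_sqr : forall a t, fdom a (g t) ->
  pullback Phi g a t *m pullback Phi g a t = (m t ^+ 2)%:M.

Lemma m_neq0 t : m t != 0.
Proof. by apply/eqP => e; have := m_Re t; rewrite e ltxx. Qed.

Lemma smooth_along (a : fidx E) k n (F : C -> 'M[R[i]]_(k, n)) t :
  smooth_in (zc a) (fdom a) F -> fdom a (g t) -> C1mx (fun u => F (g u)) t.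
Proof.
by move=> sF da i j; exact: (@C1at_along _ _ g g_closed (zc a) (fdom a) _ _ F t i j (fdom_open a) (@fdom_sub _ _ _ a) sF da).
Qed.

Lemma trans_along (a b : fidx E) t : fdom a (g t) -> fdom b (g t) ->
  C1mx (fun u => trans a b (g u)) t.
Proof.
move=> da db i j.
apply: (@C1at_along _ _ g g_closed (zc a) (fdom a `&` fdom b) _ _ (trans a b) t i j _ _ (trans_smooth a b)) => //.
  by apply: openI; exact: fdom_open.
by move=> p [/fdom_sub].
Qed.

Lemma pullback_continuous (w : oneForm E) a t : smooth_form w -> fdom a (g t) ->
  ccmx (pullback w g a) t.
Proof.
move=> sw da; have [s1 s2] := sw a.
have cv := velocity_continuous g_closed (fdom_sub da).
apply: ccmxD; apply: ccmxZ.
- exact: cv.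
- exact: C1mx_ccmx (smooth_along s1 da).
- exact: ccontinuous_conj cv.
- exact: C1mx_ccmx (smooth_along s2 da).
Qed.

(** Near [t], [m] is the root with positive real part of a diagonal entry of the square of Phi,
    which is continuous. *)
Lemma m_continuous t : ccont m t.
Proof.
have [a da] := @fdom_cover _ _ E (g t).
have cP : ccmx (pullback phi g a) t by apply: pullback_continuous da; exact: phi_end.1.
have cA : ccmx (pullback Am1 g a) t.
  by apply: pullback_continuous da; have [_ _ [[]]] := dec.
have cN := ccmxD cP cA.
apply: (@ccont_sqrt _ _ (fun u => ((pullback phi g a u + pullback Am1 g a u) *m
  (pullback phi g a u + pullback Am1 g a u)) 0 0)) => //.
  apply: filterS (near_curve g_closed (fdom_open a) da) => u du.
  by rewrite -pullback_Phi // m_sqr // mxE /= mulr1n.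
exact: (ccmxM cN cN).
Qed.

(** Both parts of Phi have type (1,0), so at zero velocity the pull-back of Phi would vanish, while
    its square is a non-zero scalar. *)
Lemma velocity_neq0 a t : fdom a (g t) -> velocity (zc a) g t != 0.
Proof.
move=> da; apply/eqP => v0; have := m_sqr da.
rewrite pullback_Phi // pullback_phi // pullback_Am1 // v0 !scale0r addr0 mul0mx.
move=> /matrixP /(_ 0 0); rewrite !mxE /= mulr1n => /esym/eqP.
by rewrite expf_eq0 /= (negPf (m_neq0 t)).
Qed.

(* m / velocity is a square root of the C^1 function given by the square of Phi_z,
   although the velocity, hence m, is only continuous. *)
Lemma m_velocity_C1 a t : fdom a (g t) -> C1at (fun u => velocity (zc a) g u / m u) t.
Proof.
move=> da.
have dn := near_curve g_closed (fdom_open a) da.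
have C1N : C1mx (fun u => fz Am1 a (g u) + fz phi a (g u)) t.
  apply: C1mxD; apply: smooth_along da; last by have [] := phi_end.1 a.
  by have [_ _ [[s _] _ _] _ _] := dec; have [] := s a.
have v0 := velocity_neq0 da.
apply: (@C1at_near _ (fun u => (m u / velocity (zc a) g u)^-1)).
  by apply: filterE => u; rewrite invf_div.
apply: C1atV; first by rewrite mulf_neq0 ?invr_eq0 // m_neq0.
apply: (@C1at_sqrt _ _ (fun u => ((fz Am1 a (g u) + fz phi a (g u)) *m
   (fz Am1 a (g u) + fz phi a (g u))) 0 0)).
- by rewrite mulf_neq0 ?invr_eq0 // m_neq0.
- apply: filterS dn => u du; have := m_sqr du.
  rewrite pullback_Phi // pullback_phi // pullback_Am1 // -scalerDr -scalemxAl -scalemxAr scalerA addrC.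
  move=> /matrixP /(_ 0 0); rewrite !mxE /= mulr1n => e.
  have vu := velocity_neq0 du.
  by rewrite expr_div_n -e -expr2 mulrAC divff ?expf_neq0 // mul1r.
- apply: filterS dn => u du; apply: ccontinuousM; first exact: m_continuous.
  apply: ccontinuousV; first exact: velocity_neq0.
  exact: velocity_continuous (fdom_sub du).
- exact: (C1mxM C1N C1N).
Qed.

Lemma line_data a t : fdom a (g t) -> exists sigma : 'cV[R[i]]_2,
  [/\ sigma != 0, L1 a (g t) = [set c *: sigma | c in [set: R[i]]],
    pullback phi g a t *m sigma = 0,
    pullback Am1 g a t *m (pullback Am1 g a t *m sigma) = 0 &
    (pullback phi g a t + pullback Am1 g a t) *m (pullback phi g a t + pullback Am1 g a t)
      = (m t ^+ 2)%:M].
Proof.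
move=> da; have [W [s [_ Wt _ vs hL]]] := line_section (g t).
have [s0 LE] := hL a _ Wt da; have Ls := vs a _ Wt da.
exists (s a (g t)); split => //; [exact: pullback_phi_line|exact: pullback_Am1_line|].
by rewrite -pullback_Phi // m_sqr.
Qed.

Lemma pullback_phi_neq0 a t : fdom a (g t) -> pullback phi g a t != 0.
Proof.
move=> da; have [sigma [s0 _ _ hB hN]] := line_data da.
exact: nilpotent_part_neq0 (m_neq0 t) s0 hB hN.
Qed.

Definition svec (v : fidx E -> R -> 'cV[R[i]]_2) (a : fidx E) (t : R) : 'cV[R[i]]_2 :=
  (m t)^-1 *: (pullback phi g a t *m v a t).

Definition transverse (v : fidx E -> R -> 'cV[R[i]]_2) (x y : R) : Prop :=
  forall t a, x < t < y -> fdom a (g t) ->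
    [/\ C1mx (v a) t, pullback phi g a t *m v a t != 0 &
      forall b, fdom b (g t) -> v a t = trans a b (g t) *m v b t].

Lemma svec_C1 v a t : fdom a (g t) -> C1mx (v a) t -> C1mx (svec v a) t.
Proof.
move=> da cv.
apply: (@C1mx_near _ _ _ (fun u => (velocity (zc a) g u / m u) *: (fz phi a (g u) *m v a u))).
  apply: filterS (near_curve g_closed (fdom_open a) da) => u du.
  by rewrite /svec pullback_phi // -scalemxAl scalerA mulrC.
apply: C1mxZ; first exact: m_velocity_C1.
apply: C1mxM; last exact: cv.
by apply: smooth_along da; have [] := phi_end.1 a.
Qed.

Lemma svec_trans v a b t : fdom a (g t) -> fdom b (g t) ->
  v a t = trans a b (g t) *m v b t -> svec v a t = trans a b (g t) *m svec v b t.
Proof.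
move=> da db vE; exact: intertwine_scale (pullback_end g_closed phi_end da db) vE.
Qed.

Lemma svec_line v a t : fdom a (g t) -> pullback phi g a t *m v a t != 0 ->
  L1 a (g t) (svec v a t).
Proof.
move=> da hv; have [sigma [s0 LE hA hB hN]] := line_data da.
have [c c0 sE] := image_line (m_neq0 t) s0 hA (pullback_phi_sqr da) hB hN hv.
by rewrite LE; exists c => //; rewrite -sE.
Qed.

Lemma is_mxderiveZ k n (f : R -> cplx R) (X : R -> 'M[R[i]]_(k, n)) t l L :
  is_cderive f t l -> is_mxderive X t L ->
  is_mxderive (fun u => f u *: X u) t (l *: X t + f t *: L).
Proof.
move=> hf hX i j; rewrite (_ : (fun u => _) = fun u => f u * X u i j).
  by rewrite !mxE; apply: is_cderiveM; [exact: hf|exact: hX].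
by apply/funext => u; rewrite mxE.
Qed.

(* The covariant derivative of svec is, modulo svec, its image under the second
   fundamental form of L1, which is mu * v since Phi squares to mu^2. *)
Lemma svec_derive v x y a t : transverse v x y -> x < t < y -> fdom a (g t) ->
  exists k, mxderive (svec v a) t + pullback D g a t *m svec v a t = m t *: v a t + k *: svec v a t.
Proof.
move=> hv /andP[xt ty] da.
have xty : x < t < y by rewrite xt ty.
have [cv v0 _] := hv t a xty da.
have [W [s [oW Wt [ss hs] vs hL]]] := line_section (g t).
have [s0 LE] := hL a _ Wt da; have Ls := vs a _ Wt da.
have [i i0] := col_neq0 s0.
have oWa : open (W `&` fdom a) by apply: openI => //; exact: fdom_open.
have sWa : W `&` fdom a `<=` dom (zc a) by move=> p [_ /fdom_sub].
have dsig := is_mxderive_along g_closed oWa sWa (ss.1 a) (conj Wt da).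
have csig k l := @C1at_along _ _ g g_closed _ _ _ _ _ t k l oWa sWa (ss.1 a) (conj Wt da).
(* The coefficient of [svec] with respect to a holomorphic generator [s] of L1; the component [i] of
   [s] is non-zero near [t]. This reduces the computation to derivatives of [s] on the surface. *)
pose rho u := svec v a u i 0 / s a (g u) i 0.
have crho : C1at rho t.
  apply: C1atM; first exact: (svec_C1 da cv).
  by apply: C1atV => //; exact: csig.
have near_s : \forall u \near t, svec v a u = rho u *: s a (g u).
  have n1 := near_curve g_closed oWa (conj Wt da).
  have n2 : \forall u \near t, x < u < y.
    have : \forall u \near t, u \in `]x, y[ by apply: near_in_itvoo; rewrite in_itv /= xt ty.
    by apply: filterS => u; rewrite in_itv.
  have n3 := ccontinuous_neq0 (C1at_continuous (csig i 0)) i0.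
  apply: filterS3 n1 n2 n3 => u [Wu du] xuy iu.
  have [_ vu _] := hv u a xuy du.
  have := svec_line du vu; have [_ ->] := hL a _ Wu du => -[c _ E0].
  by rewrite -E0 /rho -E0 mxE mulfK.
have drho := is_mxderiveZ (C1at_is_cderive crho) dsig.
have -> : mxderive (svec v a) t = cderive rho t *: s a (g t) + rho t *:
    (velocity (zc a) g t *: dz (zc a) (s a) (g t)
     + conjc (velocity (zc a) g t) *: dzb (zc a) (s a) (g t)).
  apply: is_mxderiveE; apply: is_mxderive_near drho.
  by apply: filterS near_s => u ->.
have [sigma [sg0 LE' hA hB hN]] := line_data da.
have [k hk] := other_part_image (m_neq0 t) sg0 hA (pullback_phi_sqr da) hB hN v0.
have [c c0 sE] := image_line (m_neq0 t) s0 (pullback_phi_line da Ls) (pullback_phi_sqr da)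
  (pullback_Am1_line da Ls) hN v0.
have [_ _ _ _ [pres _]] := dec.
have [] := pres W s oW ss vs a _ Wt da; rewrite {1}LE => -[d _ hd] _.
have hol : dzb (zc a) (s a) (g t) = - (fzb D a (g t) *m s a (g t)).
  by apply/eqP; rewrite -addr_eq0 D_dbar //; apply/eqP; exact: hs a _ Wt da.
(* [D'] preserves L1 and contributes a multiple of [s], [A1] kills [s]; what remains is the second
   fundamental form. *)
have hz : dz (zc a) (s a) (g t) + fz D a (g t) *m s a (g t) =
    d *: s a (g t) + fz Am1 a (g t) *m s a (g t).
  by rewrite (D_parts da).1 !mulmxDl (A1_line da Ls).1 add0r addrA hd.
have svE := nbhs_singleton near_s.
set w := velocity (zc a) g t in hz hk *.
have -> : cderive rho t *: s a (g t) + rho t *: (w *: dz (zc a) (s a) (g t)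
     + conjc w *: dzb (zc a) (s a) (g t)) + pullback D g a t *m svec v a t =
  (cderive rho t + rho t * w * d) *: s a (g t) + pullback Am1 g a t *m svec v a t.
  rewrite svE pullback_Am1 // /pullback /evalf -/w hol.
  have -> : dz (zc a) (s a) (g t) = d *: s a (g t) + fz Am1 a (g t) *m s a (g t)
    - fz D a (g t) *m s a (g t) by rewrite -hz addrK.
  rewrite mulmxDl -!scalemxAl -!scalemxAr.
  exact: leibniz_identity.
have -> : s a (g t) = c^-1 *: svec v a t by rewrite /svec sE scalerA mulVf // scale1r.
have -> : pullback Am1 g a t *m svec v a t = m t *: v a t + k *: svec v a t := hk.
exists ((cderive rho t + rho t * w * d) * c^-1 + k).
rewrite scalerA scalerDl addrCA; reflexivity.
Qed.

(** Some basis vector of a local frame lies outside the kernel of the non-zero pull-back of phi at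
    [t], and by continuity at nearby times too. *)
Lemma transverse_local t : exists2 d : R, 0 < d & exists v, transverse v (t - d) (t + d).
Proof.
have [a da] := @fdom_cover _ _ E (g t).
have [j hj] := mulmx_eq0_col (pullback_phi_neq0 da).
pose e : 'cV[R[i]]_2 := delta_mx j 0.
have cP : ccmx (fun u => pullback phi g a u *m e) t.
  apply: ccmxM; last exact: C1mx_ccmx (C1mx_cst _ _).
  by apply: pullback_continuous da; exact: phi_end.1.
have [i hi] := col_neq0 hj.
have near_ok : \forall u \near t, fdom a (g u) /\ (pullback phi g a u *m e) i 0 != 0.
  exact: filterI (near_curve g_closed (fdom_open a) da) (ccontinuous_neq0 (cP i 0) hi).
have /nbhs_ballP [d /= d0 hd] := near_ok.
exists d => //; exists (fun b u => trans b a (g u) *m e) => u b /andP[u1 u2] db.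
have [|du eu] := hd u; first by rewrite /ball /= distrC ltr_distl u1 u2.
have eu0 : pullback phi g a u *m e != 0.
  by apply: contra eu => /eqP ->; rewrite mxE.
split.
- by apply: C1mxM; [exact: trans_along|exact: C1mx_cst].
- rewrite mulmxA (pullback_end g_closed phi_end db du) -mulmxA.
  apply: contra eu0 => /eqP H; have := congr1 (mulmx (trans a b (g u))) H.
  by rewrite mulmx0 mulmxA transK // mul1mx => ->.
- by move=> b' db'; rewrite mulmxA trans_cocycle.
Qed.

(* A combination k v' + n s', with s' = svec v' in the kernel of phi and k nowhere
   zero, is again transverse; k and n are chosen to match v to first order at b. *)
Lemma transverse_glue v v' x y x' y' b : transverse v x y -> transverse v' x' y' ->
  x < b < y -> x' < b < y' -> exists w, transverse w x y'.
Proof.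
move=> hv hv' xby xby'.
have [a da] := @fdom_cover _ _ E (g b).
have [cv v0 vE] := hv b a xby da; have [cv' v0' vE'] := hv' b a xby' da.
have [sigma [s0 LE hA hB hN]] := line_data da.
have dt := det2_frame (m_neq0 b) (pullback_phi_sqr da) v0'.
have solve (p : 'cV[R[i]]_2) : exists k0 k1, p = k1 *: v' a b + k0 *: svec v' a b.
  pose q := inv2 (mk2 (svec v' a b) (v' a b)) *m p.
  have qE : mk2 (svec v' a b) (v' a b) *m q = p by rewrite /q mulmxA mulmx_inv2 // mul1mx.
  exists (q 0 0), (q 1 0); rewrite -qE.
  by apply: col2P; rewrite !mxE sum_ord2 !mxE /=; ring.
have [m0 [k0 e0]] := solve (v a b).
have k00 : k0 != 0.
  apply: contra v0 => /eqP z; rewrite e0 z scale0r add0r -scalemxAr.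
  by rewrite (kernel_image _ (pullback_phi_sqr da)) scaler0.
have cs' : C1mx (svec v' a) b by exact: svec_C1.
have [m1 [k1 e1]] := solve (mxderive (v a) b - (k0 *: mxderive (v' a) b + m0 *: mxderive (svec v' a) b)).
(* Value [k0] and derivative [k1] at [b]; unlike an affine function, the exponential stays non-zero
   on the whole interval. For [n], which may vanish, an affine function is enough. *)
pose k u := k0 * cexp (0 + k1 / k0 * (u - b)%:C) : R[i].
pose n u := m0 + m1 * (u - b)%:C : R[i].
have kC u : C1at k u.
  apply: C1atM; first exact: C1at_cst.
  apply: C1at_cexp; apply: (@C1atI _ _ (fun=> k1 / k0)); last exact: ccontinuous_cst.
  by apply: filterE => z; exact: is_cderive_affine.
have nC u : C1at n u.
  apply: (@C1atI _ _ (fun=> m1)); last exact: ccontinuous_cst.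
  by apply: filterE => z; exact: is_cderive_affine.
pose w' c u := k u *: v' c u + n u *: svec v' c u.
have w'C1 c u : x' < u < y' -> fdom c (g u) -> C1mx (w' c) u.
  move=> hu du; have [c1 _ _] := hv' u c hu du.
  by apply: C1mxD; apply: C1mxZ; [exact: kC|exact: c1|exact: nC|exact: svec_C1].
have kb : k b = k0 by rewrite /k subrr mulr0 addr0 cexp0 mulr1.
have nb : n b = m0 by rewrite /n subrr mulr0 addr0.
have w'b : w' a b = v a b by rewrite /w' kb nb -e0.
have dw' : is_mxderive (w' a) b (mxderive (v a) b).
  have dk : is_cderive k b k1.
    apply: is_cderive_eq.
      apply: is_cderiveM; first exact: is_cderive_cst.
      by apply: is_cderive_cexp; exact: is_cderive_affine.
    by rewrite /= !subrr mulr0 addr0 cexp0 mul0r add0r mulr1 mulrC divfK.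
  have dn : is_cderive n b m1 by exact: is_cderive_affine.
  have d1 := is_mxderiveZ dk (C1mx_is_mxderive cv').
  have d2 := is_mxderiveZ dn (C1mx_is_mxderive cs').
  have := is_mxderiveD d1 d2; rewrite kb nb (shuffle_identity e1); exact.
have left_in u : x < u -> u < b -> x < u < y.
  by case/andP: xby => _ by_ -> ub; rewrite (lt_trans ub by_).
have right_in u : b <= u -> u < y' -> x' < u < y'.
  by case/andP: xby' => xb _ bu ->; rewrite (lt_le_trans xb bu).
pose w c u := if u < b then v c u else w' c u.
have wtrans c c' u : x < u < y' -> fdom c (g u) -> fdom c' (g u) -> w c u = trans c c' (g u) *m w c' u.
  move=> /andP[u1 u2] dc dc'; rewrite /w; case: ltP => ub.
    by have [_ _ h1] := hv u c (left_in u u1 ub) dc; exact: h1.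
  have [_ _ h1] := hv' u c (right_in u ub u2) dc.
  exact: intertwine_sum (h1 c' dc') (svec_trans dc dc' (h1 c' dc')).
have wa : C1mx (w a) b.
  move=> i j; rewrite (_ : (fun u => _) = fun u => if u < b then v a u i j else w' a u i j); last first.
    by apply/funext => u; rewrite /w; case: ifP.
  apply: C1at_glue; [by rewrite w'b| |exact: cv|exact: w'C1].
  by rewrite (is_cderiveE (dw' i j)) mxE.
exists w => u c /andP[u1 u2] dc; split.
- case: (ltgtP u b) => ub.
  + apply: (@C1mx_near _ _ _ (v c)).
      have : \forall z \near u, z < b by exact: lt_nbhsl.
      by apply: filterS => z zb; rewrite /w zb.
    by have [] := hv u c (left_in u u1 ub) dc.
  + apply: (@C1mx_near _ _ _ (w' c)).
      have : \forall z \near u, b < z by exact: lt_nbhsr.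
      apply: filterS => z zb; rewrite /w ltNge (ltW zb); reflexivity.
    exact: w'C1 (right_in u (ltW ub) u2) dc.
  (* First order matching at [b] was arranged in the frame [a]; it passes to the frame [c] through
     the transition matrix. *)
  + rewrite ub in dc u1 u2 *.
    apply: (@C1mx_near _ _ _ (fun z => trans c a (g z) *m w a z)).
      have n1 := near_curve g_closed (openI (fdom_open a) (fdom_open c)) (conj da dc).
      have n2 : \forall z \near b, z \in `]x, y'[ by apply: near_in_itvoo; rewrite in_itv /= u1 u2.
      apply: filterS2 n1 n2 => z [dza dzc]; rewrite in_itv /= => hz.
      exact/esym/wtrans.
    by apply: C1mxM; [exact: trans_along|exact: wa].
- rewrite /w; case: ltP => ub.
    by have [] := hv u c (left_in u u1 ub) dc.
  have [_ h0 _] := hv' u c (right_in u ub u2) dc.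
  have ku : k u != 0 by rewrite mulf_neq0 // cexp_neq0.
  exact: (mulmx_sum_neq0 (n u) ku h0 (kernel_image (m u) (pullback_phi_sqr dc) (v' c u))).
- by move=> c' dc'; apply: wtrans => //; rewrite u1 u2.
Qed.

Lemma transverse_exists : exists v, exists d d' : R,
  [/\ 0 < d, 0 < d' & transverse v (- d) (1 + d')].
Proof.
have [d [d' [d0 d'0 [v hv]]]] : exists d d' : R,
    [/\ 0 < d, 0 < d' & exists v, transverse v (- d) (1 + d')].
  apply: (@interval_covering R (fun x y => exists v, transverse v x y)).
    by move=> t; have [d d0 hd] := transverse_local t; exists d.
  move=> x y x' y' b [v hv] [v' hv'] h1 h2; exact: transverse_glue hv hv' h1 h2.
by exists v, d, d'.
Qed.

Lemma wkb_frame_exists : exists (G : fidx E -> R -> 'M[R[i]]_2) (d d' : R),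
  [/\ 0 < d, 0 < d' & wkb_frame phi D g m G (- d) (1 + d')].
Proof.
have [v [d [d' [d0 d'0 hv]]]] := transverse_exists.
exists (fun a t => mk2 (svec v a t) (v a t)), d, d'; split => // t a ht da.
have [cv v0 vE] := hv t a ht da.
have [sigma [s0 LE hA hB hN]] := line_data da.
have dt : det2 (svec v a t) (v a t) != 0.
  exact: (det2_frame (m_neq0 t) (pullback_phi_sqr da) v0).
have cs := svec_C1 da cv.
split.
- exact: C1mx_mk2.
- by rewrite mk2_minor.
- exact: (mul_nilpotent_frame (m_neq0 t) (pullback_phi_sqr da) (v a t)).
- have [k hk] := svec_derive hv ht da.
  rewrite (mxderive_mk2 cs cv) mulmx_mk2 mk2D hk; exact: inv2_mk2_entry.
- move=> b db; rewrite mulmx_mk2 -(vE b db) -(svec_trans da db (vE b db)); reflexivity.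
Qed.

End Geometry.

(** * Matrix identities for changes of frame *)

Section Inv2.
Variable F : fieldType.
Implicit Types G A B T : 'M[F]_2.

Definition minor2 G : F := G 0 0 * G 1 1 - G 0 1 * G 1 0.

Lemma mk2_cols G : mk2 (\col_i G i 0) (\col_i G i 1) = G.
Proof. by apply: matrix2P; rewrite !mxE. Qed.

Lemma mul_inv2 G : minor2 G != 0 -> G *m inv2 G = 1%:M.
Proof.
move=> h; rewrite -{1 2}(mk2_cols G); apply: mulmx_inv2.
by rewrite /det2 !mxE [G 1 0 * _]mulrC.
Qed.

Lemma inv2_mul G : minor2 G != 0 -> inv2 G *m G = 1%:M.
Proof. by move=> /mul_inv2 /mulmx1C. Qed.

Lemma inv2_intertwine n A B T (X Y : 'M[F]_(2, n)) : minor2 A != 0 -> minor2 B != 0 ->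
  A = T *m B -> X = T *m Y -> inv2 A *m X = inv2 B *m Y.
Proof.
move=> hA hB AE ->; rewrite -[in LHS](mul1mx Y) -(mul_inv2 hB) -(mulmxA B) (mulmxA T) -AE.
by rewrite mulmxA inv2_mul // mul1mx.
Qed.

Lemma commute_delta T : delta_mx 0 1 *m T = T *m delta_mx 0 1 ->
  T = (T 0 0)%:M + T 0 1 *: delta_mx 0 1.
Proof.
move=> /matrixP h; have := h 0 0; have := h 0 1; rewrite !mxE !sum_ord2 !mxE /=.
rewrite !(mul0r, mul1r, mulr0, mulr1, addr0, add0r) => e1 e0.
by apply: matrix2P; rewrite !mxE /= ?(mulr1n, mulr0n, mulr0, mulr1, addr0, add0r).
Qed.

Lemma gauge_identity T P Q B B' :
  (T *m P - Q *m T) *m B + T *m B' + Q *m (T *m B) = T *m (B' + P *m B).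
Proof.
by rewrite mulmxBl mulmxDr !mulmxA addrAC subrK addrC.
Qed.

Lemma intertwine_mul T P Q B : Q *m T = T *m P -> Q *m (T *m B) = T *m (P *m B).
Proof. by move=> e; rewrite mulmxA e mulmxA. Qed.

Lemma scaled_sum (e f v w : F) (x y z x' y' z' : 'M[F]_2) :
  v *: (e *: x + y + f *: z) + w *: (e *: x' + y' + f *: z') =
  e *: (v *: x + w *: x') + (v *: y + w *: y') + f *: (v *: z + w *: z').
Proof. by apply/matrixP => i j; rewrite !mxE; ring. Qed.

Lemma diagonal_neq0 T S (k q : F) : T *m S = 1%:M -> T = k%:M + q *: delta_mx 0 1 -> k != 0.
Proof.
move=> TS TE; apply/eqP => k0; have /matrixP /(_ 1 1) := TS.
rewrite TE k0 !mxE sum_ord2 !mxE /= !(mul0rn, mulr0, addr0, mul0r) => /esym /eqP.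
by rewrite mulr1n oner_eq0.
Qed.

(** Two frames that bring the same [P] to the same normal form differ by an element of the
    centralizer of that form. *)
Lemma conjugate_commute (c : F) P G0 I0 G1 : c != 0 -> I0 *m G0 = 1%:M -> G0 *m I0 = 1%:M ->
  P *m G0 = G0 *m (c *: delta_mx 0 1) -> P *m G1 = G1 *m (c *: delta_mx 0 1) ->
  delta_mx 0 1 *m (I0 *m G1) = (I0 *m G1) *m delta_mx 0 1.
Proof.
move=> c0 h1 h2 h3 h4.
have e : (c *: delta_mx 0 1) *m I0 = I0 *m P.
  by rewrite -[P]mulmx1 -h2 (mulmxA P) h3 !mulmxA h1 mul1mx.
apply: (scalerI c0); rewrite scalemxAl mulmxA e.
by rewrite -[LHS]mulmxA h4 scalemxAr mulmxA.
Qed.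

Lemma inverse_derivative_identity G G' I I' : I *m G = 1%:M -> G' *m I + G *m I' = 0 ->
  I' = - (I *m G' *m I).
Proof.
move=> h e; rewrite -[LHS]mul1mx -h -!mulmxA -mulmxN; congr (_ *m _).
by apply/eqP; rewrite -addr_eq0 addrC e.
Qed.

Lemma parallel_identity G G' P M X (K : 'M[F]_2) : G' + P *m G = G *m M ->
  (G' *m X + G *m - (M *m X)) *m K + (G *m X) *m (0 : 'M[F]_2) = - (P *m (G *m X *m K)).
Proof.
move=> e; rewrite mulmx0 addr0 mulmxN (mulmxA G) -e (mulmxDl G' (P *m G) X) opprD addrA subrr add0r.
by rewrite mulNmx !mulmxA.
Qed.

Lemma solution_identity G G' I P M Y (K : 'M[F]_2) : I *m G = 1%:M -> G *m I = 1%:M -> G' + P *m G = G *m M ->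
  (- (I *m G' *m I) *m Y + I *m - (P *m Y)) *m K + (I *m Y) *m (0 : 'M[F]_2) = - (M *m (I *m Y *m K)).
Proof.
move=> h1 h2 e; have -> : M = I *m (G' + P *m G) by rewrite e mulmxA h1 mul1mx.
rewrite mulmx0 addr0 mulmxN mulNmx -opprD mulNmx; congr (- _).
rewrite (mulmxDr I) [LHS]mulmxDl [RHS]mulmxDl -!mulmxA (mulmxA G I) h2 mul1mx; reflexivity.
Qed.

Lemma frame_identity (e f : F) G G' P Q S M K L : P *m G = G *m M ->
  G *m K = G' + Q *m G -> G *m L = S *m G ->
  G' + (e *: P + Q + f *: S) *m G = G *m (e *: M + K + f *: L).
Proof.
move=> h1 h2 h3; rewrite !mulmxDr !mulmxDl -!scalemxAr -!scalemxAl h2 h3 -h1 !addrA.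
by rewrite [G' + _]addrC -!addrA.
Qed.

End Inv2.

(** * The holonomy in the moving frame *)

Section Holonomy.
Variables (R : realType) (C : closedRiemannSurface R) (E : sl2Bundle C).
Variables (phi D psi : oneForm E) (g : R -> C) (m : R -> cplx R).
Variables (G : fidx E -> R -> 'M[R[i]]_2) (d d' : R).
Hypotheses (psi_end : is_end_form psi) (D_conn : is_connection D).
Hypothesis (g_closed : closed_curve g).
Hypotheses (d0 : 0 < d) (d'0 : 0 < d').
Hypothesis frame : wkb_frame phi D g m G (- d) (1 + d').
Hypotheses (m_Re : forall t, 0 < complex.Re (m t)) (m_cont : forall t, ccont m t) (m1 : m 1 = m 0).

Lemma frame_minor t a : - d < t < 1 + d' -> fdom a (g t) -> minor2 (G a t) != 0.
Proof. by move=> ht da; have [_ h _ _ _] := frame ht da. Qed.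

Lemma frame_C1 t a : - d < t < 1 + d' -> fdom a (g t) -> C1mx (G a) t.
Proof. by move=> ht da; have [h _ _ _ _] := frame ht da. Qed.

Lemma frame_trans t a b : - d < t < 1 + d' -> fdom a (g t) -> fdom b (g t) ->
  G a t = trans a b (g t) *m G b t.
Proof. by move=> ht da db; have [_ _ _ _ h] := frame ht da; exact: h. Qed.

Lemma near_range t : - d < t < 1 + d' -> \forall u \near t, - d < u < 1 + d'.
Proof.
move=> ht; have : \forall u \near t, u \in `]- d, 1 + d'[ by apply: near_in_itvoo; rewrite in_itv.
by apply: filterS => u; rewrite in_itv.
Qed.

Lemma range01 (t : R) : 0 <= t <= 1 -> - d < t < 1 + d'.
Proof. by move: d0 d'0 => h h' /andP[t0 t1]; apply/andP; split; lra. Qed.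

Definition covariant (w : oneForm E) (a : fidx E) (t : R) : 'M[R[i]]_2 :=
  mxderive (G a) t + pullback w g a t *m G a t.

(** The inhomogeneous term in the change of connection form cancels the derivative of the transition
    matrix. *)
Lemma covariant_trans w t a b : is_connection w -> - d < t < 1 + d' ->
  fdom a (g t) -> fdom b (g t) -> covariant w a t = trans a b (g t) *m covariant w b t.
Proof.
move=> hw ht da db.
have dT := pullback_connection g_closed hw da db.
have dG := is_mxderiveM dT (C1mx_is_mxderive (frame_C1 ht db)).
have -> : covariant w a t =
    (trans a b (g t) *m pullback w g b t - pullback w g a t *m trans a b (g t)) *m G b t
    + trans a b (g t) *m mxderive (G b) t + pullback w g a t *m G a t.
  congr (_ + _); apply: is_mxderiveE; apply: is_mxderive_near dG.
  have n1 := near_curve g_closed (openI (fdom_open a) (fdom_open b)) (conj da db).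
  by apply: filterS2 (near_range ht) n1 => u hu [dua dub]; rewrite -frame_trans.
rewrite (frame_trans ht da db); exact: gauge_identity.
Qed.

Lemma index_choice : exists al : R -> fidx E, forall t, fdom (al t) (g t).
Proof. by apply: (@ex_choice _ _ (fun t a => fdom a (g t))) => t; exact: fdom_cover. Qed.

Variable al : R -> fidx E.
Hypothesis alP : forall t, fdom (al t) (g t).

(** The matrix of D in the moving frame. The selection [al] may jump, but the result does not depend
    on it ([coefD_frame]), so continuity can be proved with a frame fixed near each time. *)
Definition coefD t : 'M[R[i]]_2 := inv2 (G (al t) t) *m covariant D (al t) t.
Definition coefpsi t : 'M[R[i]]_2 := inv2 (G (al t) t) *m (pullback psi g (al t) t *m G (al t) t).

Lemma coefD_frame t a : - d < t < 1 + d' -> fdom a (g t) ->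
  coefD t = inv2 (G a t) *m covariant D a t.
Proof.
move=> ht da; apply: (inv2_intertwine (T := trans (al t) a (g t))).
- exact: frame_minor.
- exact: frame_minor.
- exact: frame_trans.
- exact: covariant_trans.
Qed.

Lemma coefpsi_frame t a : - d < t < 1 + d' -> fdom a (g t) ->
  coefpsi t = inv2 (G a t) *m (pullback psi g a t *m G a t).
Proof.
move=> ht da; apply: (inv2_intertwine (T := trans (al t) a (g t))).
- exact: frame_minor.
- exact: frame_minor.
- exact: frame_trans.
- rewrite (frame_trans ht (alP t) da); apply: intertwine_mul.
  exact: (pullback_end g_closed psi_end (alP t) da).
Qed.

Lemma inv2_continuous t a : - d < t < 1 + d' -> fdom a (g t) -> ccmx (fun u => inv2 (G a u)) t.
Proof.
move=> ht da; apply: C1mx_ccmx; apply: C1mx_inv2; last exact: frame_C1.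
exact: frame_minor.
Qed.

Lemma near_frame t (a : fidx E) : - d < t < 1 + d' -> fdom a (g t) ->
  \forall u \near t, - d < u < 1 + d' /\ fdom a (g u).
Proof. by move=> ht da; exact: filterI (near_range ht) (near_curve g_closed (fdom_open a) da). Qed.

Lemma coefD_continuous t : 0 <= t <= 1 -> ccmx coefD t.
Proof.
move=> /range01 ht; have da := alP t.
apply: (@ccmx_near _ _ _ _ (fun u => inv2 (G (al t) u) *m covariant D (al t) u)).
  by apply: filterS (near_frame ht da) => u [hu du]; rewrite -coefD_frame.
apply: ccmxM; first exact: inv2_continuous.
apply: ccmxD; first exact: C1mx_derive_ccmx (frame_C1 ht da).
apply: ccmxM; first exact: pullback_continuous D_conn.1 da.
exact: C1mx_ccmx (frame_C1 ht da).
Qed.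

Lemma coefpsi_continuous t : 0 <= t <= 1 -> ccmx coefpsi t.
Proof.
move=> /range01 ht; have da := alP t.
apply: (@ccmx_near _ _ _ _ (fun u => inv2 (G (al t) u) *m (pullback psi g (al t) u *m G (al t) u))).
  by apply: filterS (near_frame ht da) => u [hu du]; rewrite -coefpsi_frame.
apply: ccmxM; first exact: inv2_continuous.
apply: ccmxM; first exact: pullback_continuous psi_end.1 da.
exact: C1mx_ccmx (frame_C1 ht da).
Qed.

Lemma coefD_lower t : 0 <= t <= 1 -> coefD t 1 0 = m t.
Proof. by move=> /range01 ht; have [_ _ _ h _] := frame ht (alP t). Qed.

Lemma scaled_covariant (eta t : R) a : 0 < eta -> - d < t < 1 + d' -> fdom a (g t) ->
  mxderive (G a) t + pullback (conn_family phi D psi (eta ^+ 2)%:C) g a t *m G a t =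
  G a t *m wkb_matrix m coefD coefpsi eta t.
Proof.
move=> e0 ht da; have [_ _ hphi _ _] := frame ht da.
have GK := mul_inv2 (frame_minor ht da).
have cE : G a t *m coefD t = covariant D a t.
  by rewrite (coefD_frame ht da) mulmxA GK mul1mx.
have pE : G a t *m coefpsi t = pullback psi g a t *m G a t.
  by rewrite (coefpsi_frame ht da) mulmxA GK mul1mx.
have -> : pullback (conn_family phi D psi (eta ^+ 2)%:C) g a t =
    (eta ^- 2)%:C *: pullback phi g a t + pullback D g a t + (eta ^+ 2)%:C *: pullback psi g a t.
  by rewrite fmorphV; exact: scaled_sum.
exact: frame_identity.
Qed.

Lemma inv2_derive t a : - d < t < 1 + d' -> fdom a (g t) ->
  is_mxderive (fun u => inv2 (G a u)) t (- (inv2 (G a t) *m mxderive (G a) t *m inv2 (G a t))).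
Proof.
move=> ht da; have n0 := frame_minor ht da; have cG := frame_C1 ht da.
have dI := C1mx_is_mxderive (C1mx_inv2 n0 cG).
have dGI := is_mxderiveM (C1mx_is_mxderive cG) dI.
have d1 : is_mxderive (fun u => G a u *m inv2 (G a u)) t 0.
  apply: is_mxderive_near (is_mxderive_cst 1%:M t).
  by apply: filterS (near_frame ht da) => u [hu du]; exact/esym/mul_inv2/frame_minor.
have e := is_mxderive_uniq dGI d1.
suff <- : mxderive (fun u => inv2 (G a u)) t = - (inv2 (G a t) *m mxderive (G a) t *m inv2 (G a t)).
  exact: dI.
exact: inverse_derivative_identity (inv2_mul n0) e.
Qed.

(** The curve closes up together with its velocity, so at times 0 and 1 the moving frame gives the
    same pull-back of phi the same normal form. Changing [a] multiplies both values of [G] by one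
    transition matrix, which cancels. *)
Lemma monodromy_exists : exists k q : R[i], k != 0 /\
  forall a, fdom a (g 0) -> inv2 (G a 0) *m G a 1 = k%:M + q *: delta_mx 0 1.
Proof.
have r0 : - d < 0 < 1 + d' by apply: range01; rewrite lexx ler01.
have r1 : - d < 1 < 1 + d' by apply: range01; rewrite lexx ler01.
have [_ gp _] := g_closed; have g10 : g 1 = g 0 by rewrite -(gp 0) add0r.
have [a0 da0] := fdom_cover E (g 0); have da1 : fdom a0 (g 1) by rewrite g10.
pose T := inv2 (G a0 0) *m G a0 1.
have n0 := frame_minor r0 da0; have n1 := frame_minor r1 da1.
have P10 : pullback phi g a0 1 = pullback phi g a0 0.
  by rewrite /pullback -{2}(add0r 1) (velocity_periodic g_closed) g10.
have [_ _ h0 _ _] := frame r0 da0; have [_ _ h1 _ _] := frame r1 da1.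
rewrite P10 m1 in h1.
have m00 : m 0 != 0.
  by apply/eqP => e; have := m_Re 0; rewrite e ltxx.
have TE : T = (T 0 0)%:M + T 0 1 *: delta_mx 0 1.
  exact: commute_delta (conjugate_commute m00 (inv2_mul n0) (mul_inv2 n0) h0 h1).
exists (T 0 0), (T 0 1); split.
  apply: (@diagonal_neq0 _ T (inv2 (G a0 1) *m G a0 0)); last exact: TE.
  by rewrite /T mulmxA -(mulmxA _ (G a0 1)) (mul_inv2 n1) mulmx1 (inv2_mul n0).
move=> a da; have da' : fdom a (g 1) by rewrite g10.
rewrite -TE; apply: (inv2_intertwine (T := trans a a0 (g 0))).
- exact: frame_minor.
- exact: n0.
- exact: frame_trans.
- by rewrite -g10; exact: frame_trans.
Qed.

Definition ode_matrix (eta t : R) : 'M[R[i]]_2 :=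
  wkb_matrix (fun u => m (clamp01 u)) (fun u => coefD (clamp01 u)) (fun u => coefpsi (clamp01 u)) eta t.

Lemma ode_matrixE (eta t : R) : 0 <= t <= 1 -> ode_matrix eta t = wkb_matrix m coefD coefpsi eta t.
Proof. by move=> ht; rewrite /ode_matrix /wkb_matrix (clamp01_id ht). Qed.

Lemma coefD_clamp (i j : 'I_2) t : ccont (fun u => coefD (clamp01 u) i j) t.
Proof. have h u : 0 <= u <= 1 -> ccont (fun u => coefD u i j) u by move=> hu; exact: coefD_continuous.
exact: (@clamp01_comp_continuous R (cplx R) (fun u => coefD u i j) h t). Qed.

Lemma coefpsi_clamp (i j : 'I_2) t : ccont (fun u => coefpsi (clamp01 u) i j) t.
Proof. have h u : 0 <= u <= 1 -> ccont (fun u => coefpsi u i j) u by move=> hu; exact: coefpsi_continuous.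
exact: (@clamp01_comp_continuous R (cplx R) (fun u => coefpsi u i j) h t). Qed.

Lemma ode_matrix_continuous (eta t : R) : ccmx (fun u => - ode_matrix eta u) t.
Proof.
have cm : ccont (fun u => m (clamp01 u)) t.
  have h u : 0 <= u <= 1 -> ccont (fun u => m u) u by move=> _; exact: m_cont.
  exact: (@clamp01_comp_continuous R (cplx R) (fun u => m u) h t).
have c1 : ccmx (fun u => ode_matrix eta u) t.
  apply: ccmxD; first apply: ccmxD.
  - apply: ccmxZ; first exact: ccontinuous_cst.
    apply: ccmxZ; first exact: cm.
    by move=> i j; exact: ccontinuous_cst.
  - by move=> i j; exact: coefD_clamp.
  - apply: ccmxZ; first exact: ccontinuous_cst.
    by move=> i j; exact: coefpsi_clamp.
move=> i j; apply: ccontinuous_near (ccontinuousN (c1 i j)).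
by apply: filterE => u; rewrite [RHS]mxE.
Qed.

(** Ensures that [tr_hol] is the trace of a genuine parallel transport and not the default value of
    [xget]. *)
Lemma parallel_frame_exists (eta : R) : 0 < eta -> exists a Y, [/\ fdom a (g 0),
  parallel_frame (conn_family phi D psi (eta ^+ 2)%:C) g Y & Y a 0 = 1%:M].
Proof.
move=> e0.
have cM (i j : 'I_2) t : ccont (fun u => (- ode_matrix eta u) i j) t.
  exact: ode_matrix_continuous.
have [X [X0 hX]] := @complex_linear_ode R 2 (fun u => - ode_matrix eta u) 1%:M cM.
have [a da] := fdom_cover E (g 0).
have r0 : - d < 0 < 1 + d' by apply: range01; rewrite lexx ler01.
exists a, (fun b u => G b u *m X u *m inv2 (G a 0)); split.
- exact: da.
- split=> [b t ht db|b c t ht db dc]; last first.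
    by rewrite (frame_trans (range01 ht) db dc) !mulmxA.
  have dG := C1mx_is_mxderive (frame_C1 (range01 ht) db).
  have dX := hX t ht; rewrite mulNmx (ode_matrixE eta ht) in dX.
  have dY := is_mxderiveM (is_mxderiveM dG dX) (is_mxderive_cst (inv2 (G a 0)) t).
  split; first exact: is_mxderive_mxderivable dY.
  rewrite (is_mxderiveE dY).
  exact: parallel_identity (scaled_covariant e0 (range01 ht) db).
- by rewrite X0 mulmx1; apply: mul_inv2; exact: frame_minor.
Qed.

(** Converse gauge transformation, for whichever parallel frame [tr_hol] selects: [X] is [Y] read in
    the moving frame and normalized at time 0, so that the monodromy reappears in the trace. *)
Lemma parallel_frame_solution (eta : R) a Y k q : 0 < eta -> fdom a (g 0) ->
  parallel_frame (conn_family phi D psi (eta ^+ 2)%:C) g Y -> Y a 0 = 1%:M ->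
  inv2 (G a 0) *m G a 1 = k%:M + q *: delta_mx 0 1 ->
  exists X : R -> 'M[R[i]]_2, [/\ X 0 = 1%:M,
    forall t, 0 <= t <= 1 -> is_mxderive X t (- (ode_matrix eta t *m X t))
    & \tr ((k%:M + q *: delta_mx 0 1) *m X 1) = \tr (Y a 1)].
Proof.
move=> e0 da0 [hY transY] Y0 TE.
have i0 : 0 <= (0 : R) <= 1 by rewrite lexx ler01.
have i1 : 0 <= (1 : R) <= 1 by rewrite lexx ler01.
have [_ gp _] := g_closed; have g10 : g 1 = g 0 by rewrite -(gp 0) add0r.
have da1 : fdom a (g 1) by rewrite g10.
have n0 := frame_minor (range01 i0) da0; have n1 := frame_minor (range01 i1) da1.
(* At times 0 and 1 the frame has to be [a], where [Y] is normalized and its trace is taken. *)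
pose b u : fidx E := if (0 < u) && (u < 1) then al u else a.
have b0 : b 0 = a by rewrite /b ltxx.
have b1 : b 1 = a by rewrite /b ltxx andbF.
have bP t : 0 <= t <= 1 -> fdom (b t) (g t).
  move=> /andP[t0 t1]; rewrite /b; case: ifPn => [_|]; first exact: alP.
  rewrite negb_and -!leNgt => /orP[ht|ht].
    by rewrite (@le_anti _ _ t 0 _) ?ht //.
  by rewrite (@le_anti _ _ t 1 _) ?ht ?t1.
pose Z c u := inv2 (G c u) *m Y c u *m G a 0.
have dZ t c : 0 <= t <= 1 -> fdom c (g t) -> is_mxderive (Z c) t (- (ode_matrix eta t *m Z c t)).
  move=> ht dc; have r := range01 ht; have [dY eY] := hY c t ht dc.
  have nc := frame_minor r dc.
  have dYt := mxderivableP dY; rewrite eY in dYt.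
  have := is_mxderiveM (is_mxderiveM (inv2_derive r dc) dYt) (is_mxderive_cst (G a 0) t).
  rewrite (ode_matrixE eta ht).
  by rewrite (solution_identity _ _ (inv2_mul nc) (mul_inv2 nc) (scaled_covariant e0 r dc)).
have ZE t c c' : 0 <= t <= 1 -> fdom c (g t) -> fdom c' (g t) -> Z c t = Z c' t.
  move=> ht dc dc'; apply: (congr1 (mulmx^~ _)).
  apply: (inv2_intertwine (T := trans c c' (g t))).
  - exact: frame_minor (range01 ht) dc.
  - exact: frame_minor (range01 ht) dc'.
  - exact: frame_trans (range01 ht) dc dc'.
  - exact: transY.
exists (fun u => Z (b u) u); split.
- by rewrite b0 /Z Y0 mulmx1; exact: inv2_mul.
- move=> t ht; have dt := bP t ht.
  apply: is_mxderive_near (dZ t _ ht dt).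
  (* [Z] is known to be independent of the frame on [0, 1] only. Outside the open interval [b] is
     constantly [a], which settles the two-sided derivatives at 0 and 1. *)
  have nb : \forall u \near t, (0 < u < 1) \/ b u = b t.
    have [/andP[t0 t1]|nt] := boolP (0 < t < 1).
      have : \forall u \near t, u \in `]0, 1[ by apply: near_in_itvoo; rewrite in_itv /= t0 t1.
      by apply: filterS => u; rewrite in_itv; left.
    apply: filterE => u; have [hu|hu] := boolP (0 < u < 1); [by left|right].
    by rewrite /b (negPf nt) (negPf hu).
  apply: filterS2 (near_frame (range01 ht) dt) nb => u [_ du] [hu|->]; last reflexivity.
  have hu' : 0 <= u <= 1 by case/andP: hu => /ltW -> /ltW ->.
  exact: ZE hu' du (bP u hu').
- rewrite b1 -TE /Z !mulmxA.
  rewrite -(mulmxA _ (G a 1)) (mul_inv2 n1) mulmx1 -mulmxA mxtrace_mulC -mulmxA (mul_inv2 n0).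
  by rewrite mulmx1.
Qed.

Lemma tr_hol_estimate (F : R -> cplx R) : (forall t, 0 <= t <= 1 -> is_cderive F t (m t)) ->
  exists2 l : R[i], l != 0 & exists2 K : R, 0 <= K & forall eta : R, 0 < eta <= 1 ->
    nsq (tr_hol (conn_family phi D psi (eta ^+ 2)%:C) g
         * cexp (- ((eta^-1)%:C * (F 1 - F 0))) - l) <= K * eta.
Proof.
move=> hF; have [k [q [k0 kP]]] := monodromy_exists.
have hF' t : 0 <= t <= 1 -> is_cderive F t (m (clamp01 t)).
  by move=> ht; rewrite (clamp01_id ht); exact: hF.
have [l l0 [K K0 hK]] := @trace_wkb_limit R (fun u => m (clamp01 u)) F (fun u => coefD (clamp01 u))
  (fun u => coefpsi (clamp01 u)) k q coefD_clamp coefpsi_clamp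
  (fun t => coefD_lower (clamp01_itv t)) (fun t _ => m_Re (clamp01 t)) hF' k0.
exists l => //; exists K => // eta he; have /andP[e0 _] := he.
set w := conn_family _ _ _ _.
have [a [Y [da hY Y0 ->]]] : [set c | exists a Y, [/\ fdom a (g 0), parallel_frame w g Y,
    Y a 0 = 1%:M & c = \tr (Y a 1)]] (tr_hol w g).
  have [a [Y [da hY Y0]]] := parallel_frame_exists e0.
  by apply: (@xgetPex _ 0); exists (\tr (Y a 1)), a, Y.
have [X [X0 dX <-]] := parallel_frame_solution e0 da hY Y0 (kP a da).
exact: hK.
Qed.

End Holonomy.

(** * From the estimate in eta to the limit in epsilon *)

Section FinalAnalysis.
Variable R : realType.
Local Notation Re := (@complex.Re R).
Local Notation Im := (@complex.Im R).

Lemma increment01_gt0 (f df : R -> R) :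
  (forall t : R, 0 <= t <= 1 -> is_derive t 1 f (df t)) ->
  (forall t, 0 <= t <= 1 -> 0 < df t) -> 0 < f 1 - f 0.
Proof.
move=> h pos.
have [x|  |c] := @MVT_segment _ f df 0 1 ler01.
- by rewrite in_itv /= => /andP[/ltW x0 /ltW x1]; apply: h; rewrite x0 x1.
- apply: continuous_in_subspaceT => x; rewrite inE /= in_itv /= => x01.
  have [d _] := h x x01; exact/differentiable_continuous/derivable1_diffP.
- by rewrite in_itv /= => c01 ->; rewrite subr0 mulr1; exact: pos.
Qed.

Lemma periodic_floor (T : Type) (f : R -> T) (t : R) : (forall u, f (u + 1) = f u) ->
  f (t - (Num.floor t)%:~R) = f t.
Proof.
move=> fp; have shiftn (n : nat) u : f (u + n%:R) = f u.
  by elim: n => [|n IHn]; rewrite ?addr0 // -natr1 addrA fp.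
case: (Num.floor t) => n.
  by rewrite -[in RHS](subrK n%:R t) shiftn.
by rewrite NegzE mulrNz opprK; exact: shiftn.
Qed.

Lemma floor_frac01 (t : R) : 0 <= t - (Num.floor t)%:~R <= 1.
Proof.
have /andP[h1] := floor_itv t; rewrite intrD => h2.
by rewrite subr_ge0 h1 lerBlDr addrC ltW.
Qed.

(** Taking eta to be the square root of the variable, each part of the error has square at most
    [K * eta]. *)
Lemma cvg0_sqrt_bound (f : R -> cplx R) (l : R[i]) (K : R) : 0 <= K ->
  (forall eta : R, 0 < eta <= 1 -> nsq (f (eta ^+ 2) - l) <= K * eta) ->
  f @ 0^'+ --> (l : cplx R).
Proof.
move=> K0 h.
have part (p : R[i] -> R) : (forall x y, p (x - y) = p x - p y) -> (forall x, p x ^+ 2 <= nsq x) ->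
    (fun e => p (f e)) @ 0^'+ --> p l.
  move=> pB pq; apply/cvgrPdist_lt => e e0.
  (* The 1 keeps eta in the range of the hypothesis; dividing by [K + 1] avoids the case [K = 0]. *)
  pose c := Num.min 1 (e ^+ 2 / (K + 1)).
  have K1 : 0 < K + 1 by rewrite ltr_wpDl.
  have c0 : 0 < c by rewrite lt_min ltr01 divr_gt0 // exprn_gt0.
  near=> x.
  have x0 : 0 < x by near: x; exact: nbhs_right_gt.
  have xc : x < c ^+ 2 by near: x; apply: nbhs_right_lt; rewrite exprn_gt0.
  have s0 : 0 < Num.sqrt x by rewrite sqrtr_gt0.
  have sc : Num.sqrt x < c.
    by rewrite -(@ltr_pXn2r _ 2) ?nnegrE ?ltW // sqr_sqrtr // ltW.
  have [s1 s2] : Num.sqrt x < 1 /\ Num.sqrt x < e ^+ 2 / (K + 1).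
    by move: sc; rewrite lt_min => /andP[].
  have hx : nsq (f x - l) <= K * Num.sqrt x.
    by rewrite -[in X in f X](sqr_sqrtr (ltW x0)); apply: h; rewrite s0 ltW.
  rewrite distrC -pB -(@ltr_pXn2r _ 2) ?nnegrE ?normr_ge0 ?ltW // real_normK ?num_real //.
  apply: le_lt_trans (pq _) _; apply: le_lt_trans hx _.
  apply: (@le_lt_trans _ _ ((K + 1) * Num.sqrt x)).
    by rewrite ler_wpM2r ?ltW // ltrDl ltr01.
  by rewrite mulrC -ltr_pdivlMr.
apply/cvg_complexP; split; apply: part.
- by move=> x y; rewrite ReD ReN.
- by move=> x; rewrite lerDl sqr_ge0.
- by move=> x y; rewrite ImD ImN.
- by move=> x; rewrite lerDr sqr_ge0.
Unshelve. all: by end_near.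
Qed.

Lemma cintegral01_eq (f g : R -> cplx R) : (forall t, 0 <= t <= 1 -> f t = g t) ->
  cintegral01 f = cintegral01 g.
Proof.
move=> fg; rewrite /cintegral01; congr (_ +i* _); apply: eq_Rintegral => t.
  by rewrite inE /= in_itv /= => ht; rewrite fg.
by rewrite inE /= in_itv /= => ht; rewrite fg.
Qed.

End FinalAnalysis.

(** The WKB condition controls [mu] on [0, 1] only, whereas derivatives at the end points look
    beyond. The periodic continuation through fractional parts remains an eigenvalue because the
    curve and its velocity are periodic; it agrees with [mu] also at 1, since [mu 0] and [mu 1] have
    equal squares and positive real parts. *)
Lemma periodic_eigenvalue (R : realType) (C : closedRiemannSurface R) (E : sl2Bundle C)
    (Phi : oneForm E) (g : R -> C) (mu : R -> cplx R) :
  closed_curve g -> wkb_curve Phi g mu -> exists m : R -> cplx R,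
  [/\ forall t, 0 < complex.Re (m t),
      forall a t, fdom a (g t) -> pullback Phi g a t *m pullback Phi g a t = (m t ^+ 2)%:M,
      m 1 = m 0 & forall t, 0 <= t <= 1 -> m t = mu t].
Proof.
move=> g_closed [_ mu_Re mu_char]; have [_ gp _] := g_closed.
pose m (t : R) := mu (t - (Num.floor t)%:~R).
have i0 : 0 <= (0 : R) <= 1 by rewrite lexx ler01.
have i1 : 0 <= (1 : R) <= 1 by rewrite lexx ler01.
have m0E t : 0 <= t < 1 -> m t = mu t.
  by move=> ht; rewrite /m (@floor_def _ _ 0) ?subr0.
have m1E : m 1 = mu 0.
  by rewrite /m (@floor_def _ _ 1) ?subrr // lexx /= ltr1n.
have mu10 : mu 1 = mu 0.
  apply: sqr_inj_Re; [exact: mu_Re i1|exact: mu_Re i0|].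
  have [a da0] := fdom_cover E (g 0).
  have g10 : g 1 = g 0 by rewrite -(gp 0) add0r.
  have da1 : fdom a (g 1) by rewrite g10.
  have := square_char_poly (mu_char a 1 i1 da1); have := square_char_poly (mu_char a 0 i0 da0).
  have -> : pullback Phi g a 1 = pullback Phi g a 0.
    by rewrite /pullback -{2}(add0r 1) (velocity_periodic g_closed) g10.
  by move=> -> /matrixP /(_ 0 0); rewrite !mxE /= !mulr1n => ->.
exists m; split.
- by move=> t; exact: mu_Re (floor_frac01 t).
- move=> a t da.
  have gE := periodic_floor t gp; rewrite -gE in da.
  have vE := periodic_floor t (velocity_periodic g_closed (fchart a)).
  have := square_char_poly (mu_char a _ (floor_frac01 t) da).
  by rewrite /pullback vE gE.
- by rewrite m1E m0E // lexx ltr01.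
- move=> t /andP[t0]; rewrite le_eqVlt => /orP[/eqP ->|t1]; first by rewrite m1E mu10.
  by rewrite m0E // t0 t1.
Qed.

Theorem theorem3p7 (R : realType) (C : closedRiemannSurface R)
    (E : sl2Bundle C) (dbar : fidx E -> C -> 'M[R[i]]_2)
    (phi D psi Phi : oneForm E) (gamma : R -> C) (mu : R -> cplx R)
    (higgs : sl2_higgs dbar phi) (phi_stable : higgs_stable dbar phi)
    (phi_neq0 : nonzero phi) (phi_nilpotent : nilpotent2 phi)
    (D_connection : is_connection D) (D_sl2 : traceless D)
    (D_dbar : forall a p, fdom a p -> fzb D a p = dbar a p)
    (psi_form : is_end_form psi) (psi_type : type01 psi)
    (D_flat : forall eps : R[i], eps != 0 -> flat (conn_family phi D psi eps))
    (Phi_secondary : secondary_higgs dbar phi D Phi)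
    (Phi_not_nilpotent : ~ nilpotent2 Phi)
    (gamma_closed : closed_curve gamma)
    (gamma_wkb : wkb_curve Phi gamma mu) :
  let Z := cintegral01 mu in
  (forall eps : R, 0 < eps -> 0 < complex.Re ((eps `^ (- 2^-1))%:C * Z)) /\
  exists2 l : R[i], l != 0 &
    (fun eps : R => tr_hol (conn_family phi D psi eps%:C) gamma
                    * cexp (- ((eps `^ (- 2^-1))%:C * Z)) : cplx R)
      @ 0^'+ --> (l : cplx R).
Proof.
have [_ phi_end phi10 _ _] := higgs.
have [h [L1 [A1 [D' [Am1 [[metric _] kerL1 dec PhiE]]]]]] := Phi_secondary.
have [m [m_Re m_sqr m10 mE]] := periodic_eigenvalue gamma_closed gamma_wkb.
have m_cont : forall t, ccont m t.
  by move=> t; exact: (m_continuous phi_end dec PhiE gamma_closed m_Re m_sqr).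
have [G [d [d' [d0 d'0 frame]]]] := wkb_frame_exists metric kerL1 phi_end phi10
  phi_nilpotent D_dbar dec PhiE gamma_closed m_Re m_sqr.
have [F [_ hF]] := complex_antiderivative m_cont.
have ZE : cintegral01 mu = F 1 - F 0.
  by rewrite -(cintegral01E m_cont hF); apply: cintegral01_eq => t /mE.
rewrite ZE /=; split.
  move=> eps e0; rewrite ReM /= mul0r subr0 mulr_gt0 ?powR_gt0 // ReD ReN.
  exact: (increment01_gt0 (fun t ht => (hF t ht).1) (fun t _ => m_Re t)).
have [al alP] := index_choice E gamma.
have [l l0 [K K0 hK]] := tr_hol_estimate psi_form D_connection gamma_closed d0 d'0
  frame m_Re m_cont m10 alP hF.
exists l => //; apply: (cvg0_sqrt_bound K0) => eta he; have /andP[e0 _] := he.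
have -> : (eta ^+ 2) `^ (- 2^-1) = eta^-1.
  by rewrite powRN powR12_sqrt ?sqr_ge0 // sqrtr_sqr gtr0_norm.
exact: hK.
Qed.
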